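(* Let $\mu$ be a bounded perturbation of the uniform distribution on $[a,b]$, with support $[a,b]$, density $\rho$ and potential $V=-\log\rho$, and let $(\lambda_m,\varphi_m)_{m\in\mathbb{N}}$ be the eigenvalues and $L^2(\mu)$-normalized eigenfunctions of the Poincaré spectral problem of $\mu$. Set $\alpha_m=(1+\lambda_m)^{-1}$. Then $H^1(\mu)$, with its usual Hilbert norm $\|f\|_{H^1(\mu)}^2=\|f\|^2+\|f'\|^2$, is a reproducing kernel Hilbert space. Its kernel $K$ is continuous on $[a,b]^2$ and satisfies $\int_a^b K(x,y)\,d\mu(y)=1$ for all $x\in[a,b]$. Its Mercer decomposition is $$K(x,y)=\sum_{m=0}^{\infty}\alpha_m\varphi_m(x)\varphi_m(y),$$ where the convergence is uniform on $[a,b]^2$. Furthermore, $K$ can be computed as $$K(x,y)=\frac{1}{C}\,\psi(\min(x,y))\,\chi(\max(x,y)),$$ where $\psi,\chi$ are two linearly independent solutions of the homogeneous equation $f''-f'V'-f=0$ such that $\psi'(a)=0$ and $\chi'(b)=0$, and $C=\chi(b)\int_a^b\psi(x)\,d\mu(x)=\psi(a)\int_a^b\chi(y)\,d\mu(y)$ is a normalization constant.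
   Context: Let $-\infty<a<b<\infty$. A probability distribution $\mu$ on $[a,b]$ is a bounded perturbation of the uniform distribution if it has a density $\rho$ (with respect to Lebesgue measure) that is positive, continuous and piecewise $C^1$ on $[a,b]$; its potential is $V=-\log\rho$, so $\rho=e^{-V}$. The norm and inner product of $L^2(\mu)$ are $\|f\|^2=\int_a^b f^2\,d\mu$ and $\langle f,g\rangle=\int_a^b fg\,d\mu$. $H^1(\mu)=\{f\in L^2(\mu): f'\in L^2(\mu)\}$ and $H^2(\mu)=\{f\in H^1(\mu): f''\in L^2(\mu)\}$ (weak derivatives); elements of $H^1(\mu)$ are identified with their continuous representatives on $[a,b]$. The inner product of $H^1(\mu)$ is $\langle f,g\rangle+\langle f',g'\rangle$. Poincaré spectral problem: find $f\in H^1(\mu)$ and $\lambda$ with $\langle f',g'\rangle=\lambda\langle f,g\rangle$ for all $g\in H^1(\mu)$; equivalently, find $f\in H^2(\mu)$ with $f''-V'f'=-\lambda f$ and $f'(a)=f'(b)=0$. It is known that the eigenvalues are simple and form an increasing sequence $0=\lambda_0<\lambda_1<\cdots\to\infty$, and that the normalized eigenfunctions $(\varphi_m)_{m\ge0}$ (unique up to sign, with $\varphi_0=1$) form an orthonormal basis of $L^2(\mu)$, called the Poincaré basis. *)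

(* Defs.v *)
From HB Require Import structures.
From mathcomp Require Export all_boot all_order all_algebra.
From mathcomp Require Export all_classical all_reals all_analysis.

Set Implicit Arguments.
Unset Strict Implicit.
Unset Printing Implicit Defensive.

Import Order.TTheory GRing.Theory Num.Theory.
Import numFieldNormedType.Exports.

Local Open Scope classical_set_scope.
Local Open Scope ring_scope.

(** ** Reproducing kernel Hilbert spaces of real functions on a set [X]

    A function on [X] is represented by a total function on [T] whose values
    outside [X] are irrelevant: equality of functions is equality on [X]. *)

Record is_rkhs (R : realType) (T : Type) (X : set T) (H : set (T -> R))
    (ip : (T -> R) -> (T -> R) -> R) : Prop := {
  rkhs_ext : forall f g, (forall x, X x -> f x = g x) -> H f -> H g;
  rkhs_zero : H (fun=> 0);
  rkhs_lin : forall (c : R) f g, H f -> H g -> H (fun x => c * f x + g x);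
  rkhs_sym : forall f g, H f -> H g -> ip f g = ip g f;
  rkhs_bilin : forall (c : R) f g h, H f -> H g -> H h ->
    ip (fun x => c * f x + g x) h = c * ip f h + ip g h;
  rkhs_ge0 : forall f, H f -> 0 <= ip f f;
  rkhs_def : forall f, H f -> ip f f = 0 -> forall x, X x -> f x = 0;
  rkhs_complete : forall u : nat -> T -> R, (forall n, H (u n)) ->
    (forall e : R, 0 < e -> exists N : nat, forall m n : nat,
       (N <= m)%N -> (N <= n)%N ->
       Num.sqrt (ip (u m \- u n) (u m \- u n)) < e) ->
    exists2 f, H f & (fun n => Num.sqrt (ip (u n \- f) (u n \- f))) @ \oo --> 0;
  rkhs_eval : forall x, X x -> exists c : R, forall f, H f ->
    `|f x| <= c * Num.sqrt (ip f f) }.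

Definition reproducing_kernel (R : realType) (T : Type) (X : set T)
    (H : set (T -> R)) (ip : (T -> R) -> (T -> R) -> R) (K : T -> T -> R) :
    Prop :=
  forall x, X x -> H (K x) /\ (forall f, H f -> ip f (K x) = f x).

(** ** Bounded perturbations of the uniform distribution *)

(* The derivative inside the interval extends continuously to its endpoints. *)
Definition C1_on (R : realType) (c d : R) (f : R -> R) : Prop :=
  {within `[c, d], continuous f} /\
  exists2 df : R -> R, {within `[c, d], continuous df} &
    forall x, x \in `]c, d[ -> is_derive x 1 f (df x).

Definition piecewise_C1 (R : realType) (a b : R) (f : R -> R) : Prop :=
  exists (n : nat) (t : nat -> R), [/\ t 0%N = a, t n = b &
    forall i : nat, (i < n)%N -> t i < t i.+1 /\ C1_on (t i) (t i.+1) f].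

Record bounded_perturbation (R : realType) (a b : R)
    (mu : probability (measurableTypeR R) R) (rho : R -> R) : Prop := {
  bp_density : forall A : set (measurableTypeR R), measurable A ->
    mu A = (\int[lebesgue_measure]_(x in A `&` `[a, b]) (rho x)%:E)%E;
  bp_gt0 : forall x, x \in `[a, b] -> 0 < rho x;
  bp_continuous : {within `[a, b], continuous rho};
  bp_piecewise : piecewise_C1 a b rho }.

Definition potential (R : realType) (rho : R -> R) : R -> R :=
  fun x => - ln (rho x).

(** ** Weak derivatives on [`]a, b[] *)

(* [C_c^oo(]a, b[)]: a closed subset of the line inside [`]a, b[] is compact. *)
Definition test_function (R : realType) (a b : R) (p : R -> R) : Prop :=
  (forall (n : nat) (x : R), derivable (derive1n n p) x 1) /\
  closure [set x | p x != 0] `<=` `]a, b[.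

Definition is_weak_deriv (R : realType) (a b : R) (f g : R -> R) : Prop :=
  [/\ locally_integrable `]a, b[ f, locally_integrable `]a, b[ g &
    forall p, test_function a b p ->
      \int[lebesgue_measure]_(x in `]a, b[) (f x * derive1 p x) =
      - \int[lebesgue_measure]_(x in `]a, b[) (g x * p x)].

(* Some weak derivative of [f], which is unique almost everywhere;
   [0] if there is none. *)
Definition wderiv (R : realType) (a b : R) (f : R -> R) : R -> R :=
  xget (fun=> 0) [set g | is_weak_deriv a b f g].

(* [f'(c) = 0], for the continuous representative of the weak derivative. *)
Definition wderiv_vanishes (R : realType) (a b : R) (f : R -> R) (c : R) :
    Prop :=
  exists g : R -> R,
    [/\ {within `[a, b], continuous g}, is_weak_deriv a b f g & g c = 0].

(** ** [L^2(mu)] and the Sobolev spaces *)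

Section spaces.
Variables (R : realType) (a b : R) (mu : probability (measurableTypeR R) R).

Definition ip (f g : R -> R) : R := \int[mu]_(x in `[a, b]) (f x * g x).

Definition L2norm (f : R -> R) : R := Num.sqrt (ip f f).

Definition L2 : set (R -> R) :=
  [set f | (f \_ `[a, b] : measurableTypeR R -> R) \in Lfun mu 2%:E].

(* Elements of [H^1(mu)] are their continuous representatives. *)
Definition H1 : set (R -> R) :=
  [set f | [/\ {within `[a, b], continuous f}, L2 f &
    exists2 g, is_weak_deriv a b f g & L2 g]].

(* [wderiv f] matters only up to almost everywhere equality here. *)
Definition H2 : set (R -> R) :=
  [set f | H1 f /\ exists2 g, is_weak_deriv a b (wderiv a b f) g & L2 g].

Definition ipH1 (f g : R -> R) : R :=
  ip f g + ip (wderiv a b f) (wderiv a b g).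

(** ** The Poincaré spectral problem *)

Definition poincare_solution (l : R) (f : R -> R) : Prop :=
  H1 f /\ forall g, H1 g -> ip (wderiv a b f) (wderiv a b g) = l * ip f g.

(* The increasing sequence of all eigenvalues, which are simple, and the
   associated orthonormal basis of [L^2(mu)]. *)
Record poincare_basis (lambda : nat -> R) (phi : nat -> R -> R) : Prop := {
  pb_solution : forall m, poincare_solution (lambda m) (phi m);
  pb_lambda0 : lambda 0%N = 0;
  pb_increasing : forall m, lambda m < lambda m.+1;
  pb_unbounded : lambda @ \oo --> +oo;
  pb_exhaustive : forall l f, poincare_solution l f ->
    (exists2 x, x \in `[a, b] & f x != 0) -> exists m, l = lambda m;
  pb_simple : forall m f, poincare_solution (lambda m) f ->
    exists c, forall x, x \in `[a, b] -> f x = c * phi m x;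
  pb_phi0 : forall x, x \in `[a, b] -> phi 0%N x = 1;
  pb_orthonormal : forall m n, ip (phi m) (phi n) = (m == n)%:R;
  pb_total : forall f, L2 f ->
    (fun n => L2norm (fun x => f x - \sum_(m < n) ip f (phi m) * phi m x))
      @ \oo --> 0 }.

(** ** The homogeneous equation [f'' - f' V' - f = 0] *)

(* [V'] exists on [`]a, b[] outside finitely many points. *)
Definition homogeneous_solution (rho f : R -> R) : Prop :=
  H2 f /\
  {ae lebesgue_measure, forall x : measurableTypeR R, x \in `]a, b[ ->
     wderiv a b (wderiv a b f) x - wderiv a b f x * derive1 (potential rho) x
       - f x = 0}.

Definition lin_indep (f g : R -> R) : Prop :=
  forall c d : R, (forall x, x \in `[a, b] -> c * f x + d * g x = 0) ->
    c = 0 /\ d = 0.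

Definition fundamental_pair (rho psi chi : R -> R) : Prop :=
  [/\ homogeneous_solution rho psi, homogeneous_solution rho chi,
      lin_indep psi chi, wderiv_vanishes a b psi a & wderiv_vanishes a b chi b].

End spaces.

(* Main.v *)
(* Elements of [H^1(mu)] are the absolutely continuous functions with square
   integrable derivative, encoded as indefinite integrals (du Bois-Reymond).
   With the flux [P = rho psi'], the equation [f'' - f' V' - f = 0] becomes the
   system [psi' = P / rho], [P' = rho psi]. Picard iteration gives a solution
   with [P a = 0] and [psi >= 1], and reduction of order a second one with flux
   [Q] vanishing at [b] and [chi P - psi Q = 1]. Integrating by parts on both
   sides of [x] shows that [psi(min(x, y)) chi(max(x, y))] reproduces [f(x)].
   Any other fundamental pair is proportional to this one, since integration by
   parts identifies its members with multiples of [K(., b)] and [K(., a)].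
   The [sqrt(alpha_m) phi_m] are orthonormal and total in [H^1(mu)], so the
   partial sums of the kernel converge pointwise; the remainder is itself a
   kernel, and Dini's theorem on the diagonal with Cauchy-Schwarz off it gives
   uniform convergence. *)
Require Import Defs.
From mathcomp Require Import measurable_realfun.
From mathcomp Require Import ring lra.
Import Order.TTheory GRing.Theory Num.Theory.
Import numFieldNormedType.Exports.
Set Implicit Arguments.
Unset Strict Implicit.
Unset Printing Implicit Defensive.
Local Open Scope classical_set_scope.
Local Open Scope ring_scope.

(** * Absolutely continuous functions *)

(** The derivative in [H1] is a weak one, picked by [xget] and fixed only up to a null set, so
    nothing can be computed with it directly. Passing to indefinite integrals removes it. Since
    [is_weak_deriv] speaks only of smooth test functions, explicit ones are needed: dilated
    translates of one bump and antiderivatives of differences of two of them suffice, together with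
    Lebesgue differentiation. [V'] may fail to exist at the breakpoints of [rho]. The flux is
    absolutely continuous across them, and the first-order system contains no derivative of [rho];
    that derivative enters only in the translation to and from [homogeneous_solution]. The bound
    [psi >= 1] is what permits division by [psi] in the reduction of order. The order of the
    argument matters: the Green function is shown to reproduce by direct computation. The evaluation
    bound that it yields then enters the completeness of [H1], and completeness in turn gives the
    partial sums of the kernel a limit in [H1]. *)

Section real_integrable.
Context d (T : measurableType d) (R : realType) (m : {measure set T -> \bar R}).
Variables (D : set T) (mD : measurable D).
Implicit Types f g : T -> R.

Lemma integrable_eq f g : (forall x, D x -> f x = g x) ->
  m.-integrable D (EFin \o f) -> m.-integrable D (EFin \o g).
Proof.
by move=> fg; apply: eq_integrable => // x; rewrite inE => Dx; rewrite /= fg.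
Qed.

Lemma integrable_addr f g :
  m.-integrable D (EFin \o f) -> m.-integrable D (EFin \o g) ->
  m.-integrable D (EFin \o (fun x => f x + g x)).
Proof. by move=> i j; have := integrableD mD i j. Qed.

Lemma integrable_subr f g :
  m.-integrable D (EFin \o f) -> m.-integrable D (EFin \o g) ->
  m.-integrable D (EFin \o (fun x => f x - g x)).
Proof. by move=> i j; have := integrableB mD i j. Qed.

Lemma integrable_mulrl c f :
  m.-integrable D (EFin \o f) -> m.-integrable D (EFin \o (fun x => c * f x)).
Proof. by move=> i; have := integrableZl mD c i. Qed.

End real_integrable.

Section primitives.
Context {R : realType}.
Local Notation leb := (@lebesgue_measure R).
Implicit Types (f g u v : R -> R).

Lemma integrable_measurable D f :
  leb.-integrable D (EFin \o f) -> measurable_fun D f.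
Proof. by move=> i; apply/measurable_EFinP; exact: (measurable_int leb i). Qed.

Lemma integrable_patch (D : set (measurableTypeR R)) f : measurable D ->
  leb.-integrable D (EFin \o f) <-> leb.-integrable setT (EFin \o (f \_ D)).
Proof. by move=> mD; rewrite -restrict_EFin; exact: integrable_mkcond. Qed.

(** Fubini for [u t * v s] on the half-plane [s <= t]. Integrating in [s] first leaves [V t];
    integrating in [t] first leaves the tail of [u] beyond [s], that is, the total mass minus
    [U s]. *)
Lemma fubini_cumulative u v :
  leb.-integrable setT (EFin \o u) -> leb.-integrable setT (EFin \o v) ->
  let U := fun s => \int[leb]_(t in `]-oo, s]) u t in
  let V := fun t => \int[leb]_(s in `]-oo, t]) v s in
  leb.-integrable setT (EFin \o (fun t => u t * V t)) /\
  \int[leb]_t (u t * V t) = \int[leb]_s (v s * (\int[leb]_t u t - U s)).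
Proof.
move=> iu iv U V.
have mu_ : measurable_fun setT u by exact: integrable_measurable.
have mv_ : measurable_fun setT v by exact: integrable_measurable.
pose F (z : R * R) : \bar R := (if z.2 <= z.1 then u z.1 * v z.2 else 0)%:E.
have muv : measurable_fun setT (fun z : measurableTypeR R * measurableTypeR R => u z.1 * v z.2).
  apply: measurable_funM.
    by apply: (measurableT_comp mu_); exact: measurable_fst.
  by apply: (measurableT_comp mv_); exact: measurable_snd.
have mF : measurable_fun setT (F : measurableTypeR R * measurableTypeR R -> \bar R).
  apply/measurable_EFinP; apply: measurable_fun_ifT => //.
  apply: measurable_fun_ler; [exact: measurable_snd|exact: measurable_fst].
have iF : (leb \x leb)%E.-integrable setT F.
  apply/(integrable12ltyP _ _ mF).
  apply: (@le_lt_trans _ _ (\int[leb]_x (`|u x|%:E * \int[leb]_y `|v y|%:E))%E).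
    apply: ge0_le_integral => //=.
    - move=> x _; exact: integral_ge0.
    - apply: (measurable_fun_fubini_tonelli_F (m2 := leb) (abse \o F)) => //=.
      exact: measurableT_comp.
    - apply: emeasurable_funM => //.
      by apply/measurable_EFinP; exact: measurableT_comp.
    - move=> x _; rewrite -ge0_integralZl//=; last first.
        by apply/measurable_EFinP; exact: measurableT_comp.
      apply: ge0_le_integral => //=.
      + apply/measurable_EFinP; apply: measurableT_comp => //.
        apply: measurable_fun_ifT => //; first exact: measurable_fun_ler.
        exact: measurable_funM.
      + apply/measurable_EFinP; apply: measurable_funM => //.
        exact: measurableT_comp.
      + move=> y _; rewrite -EFinM lee_fin -normrM; case: ifP => // _.
        by rewrite normr0.
  have vfin : (\int[leb]_y `|v y|%:E)%E \is a fin_num.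
    rewrite ge0_fin_numE; first by case/integrableP: iv.
    exact: integral_ge0.
  rewrite -(fineK vfin).
  under eq_integral do rewrite muleC.
  rewrite ge0_integralZl//=; last 2 first.
    by apply/measurable_EFinP; exact: measurableT_comp.
    by rewrite lee_fin fine_ge0// integral_ge0.
  rewrite lte_mul_pinfty//.
    by rewrite lee_fin fine_ge0// integral_ge0.
  by case/integrableP: iu.
have FE t : (\int[leb]_s F (t, s) = (u t * V t)%:E)%E.
  rewrite /F/=.
  transitivity (\int[leb]_(s in `]-oo, t]) (u t * v s)%:E)%E.
    rewrite [RHS]integral_mkcond; apply: eq_integral => s _.
    rewrite patchE; case: ifPn => st; first by rewrite mem_set//= in_itv.
    by rewrite memNset//= in_itv/=; exact/negP.
  have ivt : leb.-integrable `]-oo, t] (EFin \o v) by apply: integrableS iv.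
  under eq_integral do rewrite EFinM.
  by rewrite integralZl//= EFinM /V /Rintegral fineK//; exact: integrable_fin_num.
have GE s : (\int[leb]_t F (t, s) = (v s * (\int[leb]_t u t - U s))%:E)%E.
  rewrite /F/=.
  have ius : leb.-integrable `]s, +oo[ (EFin \o u) by apply: integrableS iu.
  transitivity (\int[leb]_(t in `]s, +oo[) (v s * u t)%:E)%E.
    rewrite integral_itv_obnd_cbnd//; last first.
      apply/measurable_EFinP; apply: measurable_funM => //.
      exact: measurable_funTS.
    rewrite [RHS]integral_mkcond; apply: eq_integral => t _.
    rewrite patchE; case: ifPn => st.
      by rewrite mem_set//= ?in_itv/= ?andbT// mulrC.
    by rewrite memNset//= in_itv/= andbT; exact/negP.
  under eq_integral do rewrite EFinM.
  rewrite integralZl//= EFinM; congr (_ * _)%E.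
  have := @Rintegral_itvB R u -oo%O +oo%O s; rewrite set_itvNyy => /(_ iu).
  rewrite /U => ->//.
  by rewrite /Rintegral fineK//; exact: integrable_fin_num.
split.
  apply: eq_integrable (integrable_fubini_F iF) => //.
  by move=> s _; rewrite /fubini_F FE.
rewrite /Rintegral; congr fine.
under eq_integral do rewrite -FE.
under [RHS]eq_integral do rewrite -GE.
exact: Fubini.
Qed.

(** The tail formula of [fubini_cumulative] is the product of the integrals minus the opposite
    triangle. This is integration by parts for antiderivatives of integrable functions. *)
Lemma fubini_triangle u v :
  leb.-integrable setT (EFin \o u) -> leb.-integrable setT (EFin \o v) ->
  let U := fun s => \int[leb]_(t in `]-oo, s]) u t in
  let V := fun t => \int[leb]_(s in `]-oo, t]) v s in
  [/\ leb.-integrable setT (EFin \o (fun t => u t * V t)),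
      leb.-integrable setT (EFin \o (fun s => v s * U s)) &
      \int[leb]_t (u t * V t) + \int[leb]_s (v s * U s) =
      (\int[leb]_t u t) * (\int[leb]_s v s)].
Proof.
move=> iu iv U V.
have [iuV E] := fubini_cumulative iu iv.
have [ivU _] := fubini_cumulative iv iu.
split => //; rewrite E.
have ivI : leb.-integrable setT (EFin \o (fun s => \int[leb]_t u t * v s)).
  exact: integrable_mulrl.
have -> : \int[leb]_s (v s * (\int[leb]_t u t - U s)) =
   \int[leb]_s (\int[leb]_t u t * v s) - \int[leb]_s (v s * U s).
  by rewrite -RintegralB//; apply: eq_Rintegral => s _; ring.
by rewrite subrK RintegralZl.
Qed.

(** Absolute continuity in integrated form: [g] counts only up to a null set, and differentiability
    of [f] at a given point is not asserted. *)
Definition primitive (a b : R) f g :=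
  leb.-integrable `[a, b] (EFin \o g) /\
  forall x, x \in `[a, b] -> f x = f a + \int[leb]_(t in `[a, x]) g t.

(** This is [fubini_triangle] for the derivatives cut off to [[a, x]]: their cumulative integrals
    are [f - f a] and [g - g a], and linearity restores the constants. *)
Lemma primitiveM a b f f' g g' : primitive a b f f' -> primitive a b g g' ->
  primitive a b (fun x => f x * g x) (fun x => f' x * g x + f x * g' x).
Proof.
move=> [if' fE] [ig' gE].
have key x : x \in `[a, b] ->
   leb.-integrable `[a, x] (EFin \o (fun x => f' x * g x + f x * g' x)) /\
   f x * g x = f a * g a + \int[leb]_(t in `[a, x]) (f' t * g t + f t * g' t).
  move=> xab; have /andP[ax xb] : a <= x <= b by rewrite in_itv in xab.
  have sub : `[a, x] `<=` `[a, b] by apply: subset_itvl; rewrite bnd_simp.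
  have if'x : leb.-integrable `[a, x] (EFin \o f') by apply: integrableS if'.
  have ig'x : leb.-integrable `[a, x] (EFin \o g') by apply: integrableS ig'.
  have iu : leb.-integrable setT (EFin \o (f' \_ `[a, x])).
    by apply: (integrable_patch _ _).1.
  have iv : leb.-integrable setT (EFin \o (g' \_ `[a, x])).
    by apply: (integrable_patch _ _).1.
  have [iuV ivU E] := fubini_triangle iu iv.
  have UE (h : R -> R) y : `[a, x]%classic y ->
      \int[leb]_(t in `]-oo, y]) (h \_ `[a, x]) t = \int[leb]_(t in `[a, y]) h t.
    rewrite /= in_itv/= => /andP[ay yx].
    rewrite -Rintegral_mkcondr; congr Rintegral.
    apply/seteqP; split => z /=; rewrite !in_itv/=; last first.
      by move=> /andP[-> zy]; rewrite zy (le_trans zy yx).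
    by move=> [-> /andP[->]].
  have eqf y : `[a, x]%classic y -> \int[leb]_(t in `[a, y]) f' t = f y - f a.
    by move=> yx; rewrite (fE y) 1?addrC ?addKr//; exact: sub.
  have eqg y : `[a, x]%classic y -> \int[leb]_(t in `[a, y]) g' t = g y - g a.
    by move=> yx; rewrite (gE y) 1?addrC ?addKr//; exact: sub.
  have i1 : leb.-integrable `[a, x] (EFin \o (fun t => f' t * (g t - g a))).
    apply: (integrable_patch _ _).2 => //; apply: eq_integrable iuV => // t _.
    rewrite /= !patchE; case: ifPn; last by rewrite mul0r.
    by rewrite inE => tx; rewrite UE// eqg.
  have i2 : leb.-integrable `[a, x] (EFin \o (fun t => g' t * (f t - f a))).
    apply: (integrable_patch _ _).2 => //; apply: eq_integrable ivU => // t _.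
    rewrite /= !patchE; case: ifPn; last by rewrite mul0r.
    by rewrite inE => tx; rewrite UE// eqf.
  have j1 : leb.-integrable `[a, x] (EFin \o (fun t => g a * f' t)).
    exact: integrable_mulrl.
  have j2 : leb.-integrable `[a, x] (EFin \o (fun t => f a * g' t)).
    exact: integrable_mulrl.
  have k1 : leb.-integrable `[a, x] (EFin \o (fun t => f' t * g t)).
    apply: integrable_eq (integrable_addr _ i1 j1) => // t _; ring.
  have k2 : leb.-integrable `[a, x] (EFin \o (fun t => f t * g' t)).
    apply: integrable_eq (integrable_addr _ i2 j2) => // t _; ring.
  split.
    exact: integrable_addr.
  rewrite RintegralD//.
  have -> : \int[leb]_(t in `[a, x]) (f' t * g t) =
    \int[leb]_(t in `[a, x]) (f' t * (g t - g a)) +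
    \int[leb]_(t in `[a, x]) (g a * f' t).
    by rewrite -RintegralD//; apply: eq_Rintegral => t _; ring.
  have -> : \int[leb]_(t in `[a, x]) (f t * g' t) =
    \int[leb]_(t in `[a, x]) (g' t * (f t - f a)) +
    \int[leb]_(t in `[a, x]) (f a * g' t).
    by rewrite -RintegralD//; apply: eq_Rintegral => t _; ring.
  rewrite !RintegralZl// eqf ?eqg//=; last 2 first.
    by rewrite in_itv/= lexx ax.
    by rewrite in_itv/= lexx ax.
  have E1 : \int[leb]_(t in `[a, x]) (f' t * (g t - g a)) +
    \int[leb]_(t in `[a, x]) (g' t * (f t - f a)) = (f x - f a) * (g x - g a).
    have xx : `[a, x]%classic x by rewrite /= in_itv/= lexx ax.
    rewrite -(eqf _ xx) -(eqg _ xx).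
    rewrite !(Rintegral_mkcond leb `[a, x]) -E; congr (_ + _).
      apply: eq_Rintegral => t _; rewrite !patchE; case: ifPn; last by rewrite mul0r.
      by rewrite inE => tx; rewrite UE// eqg.
    apply: eq_Rintegral => t _; rewrite !patchE; case: ifPn; last by rewrite mul0r.
    by rewrite inE => tx; rewrite UE// eqf.
  rewrite addrACA E1; ring.
(* Integrability on [[a, b]] is read off at [x = b], which belongs to the interval only if
   [a <= b]. *)
have [ab|ab] := leP a b; last first.
  split; first by rewrite set_itv_ge ?bnd_simp -?ltNge//; exact: integrable_set0.
  by move=> x xab; have [] := key x xab.
split; first by apply: (key b _).1; rewrite in_itv/= lexx ab.
by move=> x xab; have [] := key x xab.
Qed.

End primitives.

(** * Pointwise differentiation rules *)

Section pointwise_derivatives.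
Context {R : realType}.
Implicit Types (f g : R -> R) (x p q c : R).

Lemma is_derive_val f x p q : is_derive x 1 f p -> p = q -> is_derive x 1 f q.
Proof. by move=> + <-. Qed.

Lemma is_derive_near f g x p : (\forall y \near x, f y = g y) ->
  is_derive x 1 f p -> is_derive x 1 g p.
Proof. exact: near_eq_is_derive. Qed.

Lemma is_derive_add f g x p q : is_derive x 1 f p -> is_derive x 1 g q ->
  is_derive x 1 (fun y => f y + g y) (p + q).
Proof. by move=> df dg; exact: (@is_deriveD _ _ _ f g). Qed.

Lemma is_derive_opp f x p : is_derive x 1 f p ->
  is_derive x 1 (fun y => - f y) (- p).
Proof. by move=> df; exact: (@is_deriveN _ _ _ f). Qed.

Lemma is_derive_sub f g x p q : is_derive x 1 f p -> is_derive x 1 g q ->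
  is_derive x 1 (fun y => f y - g y) (p - q).
Proof. by move=> df dg; exact: (@is_deriveB _ _ _ f g). Qed.

Lemma is_derive_mul f g x p q : is_derive x 1 f p -> is_derive x 1 g q ->
  is_derive x 1 (fun y => f y * g y) (p * g x + f x * q).
Proof.
move=> df dg; have := @is_deriveM _ _ f g _ _ _ _ df dg.
by rewrite /GRing.scale/= addrC [g x * p]mulrC.
Qed.

Lemma is_derive_inv f x p : f x != 0 -> is_derive x 1 f p ->
  is_derive x 1 (fun y => (f y)^-1) (- (p / f x ^+ 2)).
Proof.
move=> fx df; have := is_deriveV fx df.
by rewrite /GRing.scale/= mulNr mulrC.
Qed.

Lemma is_derive_affine c k x : is_derive x 1 (fun y : R => c * y + k) c.
Proof.
have := is_derive_add (is_derive_mul (is_derive_cst c x 1) (is_derive_id x 1)) (is_derive_cst k x 1).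
by rewrite mul0r add0r addr0 mulr1.
Qed.

End pointwise_derivatives.

(** * Smooth bump functions *)

Section smooth_bump.
Context {R : realType}.
Implicit Types (f g : R -> R) (P Q : {poly R}) (x : R).

Definition smooth f := forall (n : nat) x, derivable (derive1n n f) x 1.

(** A class stable under differentiation contains all iterated derivatives of its members. It
    remains to find such a class that contains the bumps. *)
Lemma smooth_class (C : set (R -> R)) :
  (forall f, C f -> exists2 g, C g & forall x, is_derive x 1 f (g x)) ->
  forall f, C f -> smooth f.
Proof.
move=> CP f Cf; have key n : C (derive1n n f).
  elim: n => [//|n /CP[g Cg dg]]; rewrite derive1nS.
  suff -> : derive1 (derive1n n f) = g by [].
  by apply/funext => x; rewrite derive1E; exact: derive_val.
by move=> n x; have [g _ dg] := CP _ (key n); exact: ex_derive.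
Qed.

(** Each monomial is bounded by one term of the exponential series, [y ^ i <= i! * expR y]; this is
    the origin of the factorials in the constant. *)
Lemma horner_le_expR P :
  exists C : R, forall y : R, 0 <= y -> `|P.[y]| <= C * expR y.
Proof.
exists (\sum_(i < size P) `|P`_i| * i`!%:R) => y y0.
rewrite horner_coef mulr_suml (le_trans (ler_norm_sum _ _ _))//.
apply: ler_sum => i _; rewrite normrM normrX (ger0_norm y0) -mulrA.
apply: ler_wpM2l => //.
case: (nat_of_ord i) => [|n].
  by rewrite expr0 fact0 mul1r (le_trans _ (expR_ge1Dx _))// lerDl.
rewrite -ler_pdivrMl ?ltr0n ?fact_gt0// mulrC.
by rewrite (le_trans _ (expR_ge1Dxn n y0))// lerDr.
Qed.

(* All derivatives of [x |-> exp(-1/x)] on the positive half-line have this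
   form. *)
Definition flat P x : R := if 0 < x then P.[x^-1] * expR (- x^-1) else 0.

(** The difference quotient is at most [C * |h|]. Meant for the origin, where formulas in [1 / x]
    break down. *)
Lemma is_derive_quadratic f x (C : R) :
  (forall h, `|f (h + x) - f x| <= C * h ^+ 2) -> is_derive x 1 f 0.
Proof.
move=> fC; have key : h^-1 *: ((f \o shift x) (h *: (1 : R)) - f x) @[h --> (0:R)^'] --> (0 : R).
  apply: norm_cvg0; apply: (@squeeze_cvgr _ _ _ _ (cst 0) (fun h => C * `|h|)).
  - near=> h; rewrite normr_ge0/= normrZ /= [h *: 1]mulr1.
    have h0 : h != 0 by near: h; exact: nbhs_dnbhs_neq.
    rewrite normfV ler_pdivrMl ?normr_gt0//.
    by rewrite (le_trans (fC h))// [leRHS]mulrCA -normrM -expr2 ger0_norm ?sqr_ge0.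
  - exact: cvg_cst.
  - rewrite -[X in _ --> X](mulr0 C).
    apply: cvgMr; rewrite -[X in _ --> X](@normr0 _ R).
    by apply: cvg_norm; exact: cvg_within.
by split; [apply/cvg_ex; exists 0|apply/cvg_lim].
Unshelve. all: by end_near. Qed.

(** At [y = 1 / x], [horner_le_expR] for [P * 'X^2] bounds [|P(y)| * y ^ 2] by [C * expR y]; divide
    by [y ^ 2 * expR y]. *)
Lemma flat_quadratic P : exists C : R, forall x, `|flat P x| <= C * x ^+ 2.
Proof.
have [C PC] := horner_le_expR (P * 'X^2).
have C0 : 0 <= C.
  by have := PC 0 (lexx _); rewrite expR0 mulr1; apply: le_trans.
exists C => x; rewrite /flat; case: ifPn => [x0|_]; last first.
  by rewrite normr0 mulr_ge0// sqr_ge0.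
have xV : 0 < x^-1 by rewrite invr_gt0.
have := PC _ (ltW xV); rewrite hornerM hornerXn !normrM.
rewrite [`|expR _|]ger0_norm ?expR_ge0// expRN.
rewrite (ger0_norm (ltW xV)) -expr2 exprVn.
rewrite ler_pdivrMr ?exprn_gt0// => H.
rewrite ler_pdivrMr ?expR_gt0//; apply: (le_trans H).
by rewrite mulrAC.
Qed.

(** For [x > 0] the chain rule gives [x^-2 (P - P')(1/x) exp(-1/x)], which is [flat] of the stated
    polynomial. For [x < 0] the function is locally zero, and at 0 the quadratic bound applies. *)
Lemma is_derive_flat P x :
  is_derive x 1 (flat P) (flat ('X^2 * (P - P^`())) x).
Proof.
have [x0|x0|->] := ltgtP x 0.
- rewrite [X in is_derive _ _ _ X](_ : _ = 0); last first.
    by rewrite /flat ltNge (ltW x0).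
  apply: (@is_derive_near _ (cst 0)).
  near=> y; rewrite /flat ltNge ifF//; apply/negbTE; rewrite negbK; apply/ltW.
  by near: y; exact: lt_nbhsl.
- have dV : is_derive x 1 (fun y : R => y^-1) (- x ^- 2).
    have := @is_derive_inv _ id x 1 (lt0r_neq0 x0) (is_derive_id _ _).
    by rewrite mul1r.
  have dE : is_derive x 1 (fun y => expR (- y^-1)) (expR (- x^-1) * x ^- 2).
    have -> : expR (- x^-1) * x ^- 2 = expR (- x^-1) * (- (- x ^- 2)).
      by rewrite opprK.
    exact: (@is_derive1_comp _ expR (fun y => - y^-1) _ _ _
      (is_derive_expR _) (is_derive_opp dV)).
  have dP : is_derive x 1 (fun y => P.[y^-1]) (P^`().[x^-1] * (- x ^- 2)).
    exact: (@is_derive1_comp _ (horner P) (fun y => y^-1)).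
  apply: (@is_derive_near _ (fun y => P.[y^-1] * expR (- y^-1))).
    near=> y; rewrite /flat ifT//.
    by near: y; exact: lt_nbhsr.
  apply: (is_derive_val (is_derive_mul dP dE)).
  rewrite /flat x0 hornerM hornerXn hornerD hornerN -!exprVn; ring.
- rewrite [X in is_derive _ _ _ X](_ : _ = 0); last by rewrite /flat ltxx.
  have [C PC] := flat_quadratic P.
  apply: (@is_derive_quadratic _ _ C) => h.
  by rewrite addr0 [flat P 0]/flat ltxx subr0.
Unshelve. all: by end_near. Qed.

(** The class fed to [smooth_class]. The generating products vanish outside [[0, 1]]; sums and
    affine substitutions make room for the product rule, scaled bumps and their differences. *)
Inductive flat_span : set (R -> R) :=
| flat_spanM P Q : flat_span (fun x => flat P x * flat Q (1 - x))
| flat_spanD f g : flat_span f -> flat_span g -> flat_span (fun x => f x + g x)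
| flat_spanZ (c k s : R) f : flat_span f -> flat_span (fun x => c * f (k * x + s)).

Lemma smooth_flat_span f : flat_span f -> smooth f.
Proof.
apply: smooth_class => {f}; apply: flat_span_ind => [P Q|f g _ [f' sf df] _ [g' sg dg]|c k s f _ [f' sf df]].
(* Product rule, with a sign from [1 - x]. The neutral [1 * x + 0] appears because [flat_spanZ] is
   used only to insert a scalar. *)
- exists (fun x => 1 * (flat ('X^2 * (P - P^`())) (1 * x + 0) * flat Q (1 - (1 * x + 0)))
      + (-1) * (flat P (1 * x + 0) * flat ('X^2 * (Q - Q^`())) (1 - (1 * x + 0)))).
    apply: flat_spanD.
      by apply: (@flat_spanZ 1 1 0 (fun x => flat ('X^2 * (P - P^`())) x * flat Q (1 - x))); constructor.
    by apply: (@flat_spanZ (-1) 1 0 (fun x => flat P x * flat ('X^2 * (Q - Q^`())) (1 - x))); constructor.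
  move=> x; have d1 : is_derive x 1 (fun y : R => 1 - y) (-1).
    have := is_derive_affine (-1) 1 x; congr is_derive.
    by apply/funext => y; rewrite mulN1r addrC.
  have d2 : is_derive x 1 (fun y => flat Q (1 - y)) (flat ('X^2 * (Q - Q^`())) (1 - x) * -1).
    by apply: (@is_derive1_comp _ (flat Q) (fun y => 1 - y)); exact: is_derive_flat.
  have d3 := is_derive_flat P x.
  apply: (is_derive_val (is_derive_mul d3 d2)).
  rewrite !mul1r !addr0; ring.
- exists (fun x => f' x + g' x); first exact: flat_spanD.
  by move=> x; exact: is_derive_add.
- exists (fun x => (c * k) * f' (k * x + s)); first exact: flat_spanZ.
  move=> x.
  have d1 : is_derive x 1 (fun y : R => k * y + s) k.
    exact: is_derive_affine.
  have d2 : is_derive x 1 (fun y => f (k * y + s)) (f' (k * x + s) * k).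
    exact: (@is_derive1_comp _ f (fun y => k * y + s)).
  apply: (is_derive_val (is_derive_mul (is_derive_cst c x 1) d2)).
  by rewrite mul0r add0r [f' _ * k]mulrC mulrA.
Qed.

Definition bump x : R := flat 1 x * flat 1 (1 - x).

Lemma bump_ge0 x : 0 <= bump x.
Proof.
by rewrite /bump /flat; do 2 case: ifP => _; rewrite ?hornerE ?mulr_ge0 ?expR_ge0.
Qed.

Lemma bump_le1 x : bump x <= 1.
Proof.
have f1 y : 0 <= flat 1 y <= 1.
  rewrite /flat; case: ifP => [y0|_]; last by rewrite lexx ler01.
  by rewrite hornerE mul1r expR_ge0/= -expR0 ler_expR oppr_le0 invr_ge0 ltW.
rewrite /bump; have /andP[? ?] := f1 x; have /andP[? ?] := f1 (1 - x).
by rewrite mulr_ile1.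
Qed.

Lemma bump_supp x : bump x != 0 -> 0 < x < 1.
Proof.
rewrite /bump mulf_eq0 negb_or /flat subr_gt0.
by case: (0 < x); case: (x < 1); rewrite ?eqxx ?andbF.
Qed.

(** Both [x] and [1 - x] are at least 1/4, so each factor is at least [exp(-4)]. This will make the
    mass of the bump positive. *)
Lemma bump_lbound x : 1/4 <= x <= 3/4 -> expR (- 8) <= bump x.
Proof.
move=> /andP[x1 x3].
have f1 y : 1/4 <= y -> expR (- 4) <= flat 1 y.
  move=> y4; have y0 : 0 < y by lra.
  rewrite /flat y0 hornerE mul1r ler_expR lerN2 invf_ple ?posrE//; lra.
rewrite (_ : - 8 = - 4 + - 4 :> R); last by ring.
by rewrite expRD /bump ler_pM ?expR_ge0// f1//; lra.
Qed.

End smooth_bump.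

(** * Continuity on a subset and integration over intervals *)

Section within_continuity.
Context {R : realType} {T : topologicalType} (A : set T).
Implicit Types f g : T -> R.

Lemma within_eqf f g : (forall x, A x -> f x = g x) ->
  {within A, continuous f} -> {within A, continuous g}.
Proof.
move=> fg; apply: subspace_eq_continuous => x; rewrite inE => Ax.
exact: fg.
Qed.

Lemma within_cst (c : R) : {within A, continuous (fun _ : T => c)}.
Proof. by apply: continuous_subspaceT => x; exact: cvg_cst. Qed.

Lemma within_addr f g : {within A, continuous f} -> {within A, continuous g} ->
  {within A, continuous (fun x => f x + g x)}.
Proof. by move=> cf cg x; apply: cvgD; [exact: cf|exact: cg]. Qed.

Lemma within_subr f g : {within A, continuous f} -> {within A, continuous g} ->
  {within A, continuous (fun x => f x - g x)}.
Proof. by move=> cf cg x; apply: cvgB; [exact: cf|exact: cg]. Qed.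

Lemma within_mulr f g : {within A, continuous f} -> {within A, continuous g} ->
  {within A, continuous (fun x => f x * g x)}.
Proof. by move=> cf cg x; apply: cvgM; [exact: cf|exact: cg]. Qed.

Lemma within_invr f : {within A, continuous f} -> (forall x, A x -> f x != 0) ->
  {within A, continuous (fun x => (f x)^-1)}.
Proof.
move=> cf f0; apply: (@within_continuous_comp R^o T R^o A f GRing.inv _ cf) => _ /set_mem[x Ax <-].
exact: (inv_continuous (f0 x Ax)).
Qed.

Lemma within_comp {U : topologicalType} (D : set U) (f : U -> R) (g : T -> U) :
  {within A, continuous g} -> (forall x, A x -> D (g x)) ->
  {within D, continuous f} -> {within A, continuous (fun x => f (g x))}.
Proof.
move=> /subspace_continuousP cg AD /subspace_continuousP cf.
apply/subspace_continuousP => x Ax.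
have cg' : g @ within A (nbhs x) --> within D (nbhs (g x)).
  move=> W hW; have H : \forall y \near x, A y -> D (g y) -> W (g y) := cg x Ax _ hW.
  suff : \forall y \near x, A y -> W (g y) by [].
  by apply: filterS H => y h Ay; exact: h Ay (AD y Ay).
exact: cvg_comp cg' (cf (g x) (AD x Ax)).
Qed.

End within_continuity.

Section integration_tools.
Context {R : realType}.
Local Notation leb := (@lebesgue_measure R).
Implicit Types (f g h : R -> R).

Lemma within_subset (a b c d : R) f : a <= c -> d <= b ->
  {within `[a, b], continuous f} -> {within `[c, d], continuous f}.
Proof.
move=> ac db; apply: continuous_subspaceW => x/=.
by rewrite !in_itv/= => /andP[cx xd]; rewrite (le_trans ac)//= (le_trans xd).
Qed.

Lemma continuous_integrable (a b : R) f : {within `[a, b], continuous f} ->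
  leb.-integrable `[a, b] (EFin \o f).
Proof. by move=> cf; apply: continuous_compact_integrable => //; exact: segment_compact. Qed.

Lemma itv_in (a b x : R) : x \in `[a, b] <-> a <= x <= b.
Proof. by rewrite in_itv. Qed.

Lemma FTC2 (a b : R) f g : a <= b -> {within `[a, b], continuous f} ->
  {within `[a, b], continuous g} ->
  (forall x, x \in `]a, b[ -> is_derive x 1 f (g x)) ->
  \int[leb]_(x in `[a, b]) g x = f b - f a.
Proof.
rewrite le_eqVlt => /predU1P[->|ab] cf cg dfg.
  by rewrite set_itv1 Rintegral_set1 subrr.
rewrite /Rintegral (@continuous_FTC2 _ _ f)//.
- have [_ cfa cfb] := (continuous_within_itvP f ab).1 cf.
  by split => // x xab; case: (dfg x xab).
- by move=> x xab; rewrite derive1E; case: (dfg x xab).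
Qed.

Lemma C1_primitive (a b : R) f g : {within `[a, b], continuous f} ->
  {within `[a, b], continuous g} ->
  (forall x, x \in `]a, b[ -> is_derive x 1 f (g x)) -> primitive a b f g.
Proof.
move=> cf cg dfg; split; first exact: continuous_integrable.
move=> x; rewrite itv_in => /andP[ax xb].
have -> : \int[leb]_(t in `[a, x]) g t = f x - f a; last by rewrite addrC subrK.
apply: FTC2 => //.
- exact: within_subset cf.
- exact: within_subset cg.
- move=> y; rewrite in_itv/= => /andP[ay yx]; apply: dfg.
  by rewrite in_itv/= ay (lt_le_trans yx).
Qed.

Lemma itv_integrable_eq (i : interval R) f g : (forall x, x \in i -> f x = g x) ->
  leb.-integrable [set` i] (EFin \o f) -> leb.-integrable [set` i] (EFin \o g).
Proof. by move=> fg; apply: integrable_eq => // x; exact: fg. Qed.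

Lemma itv_integrableD (i : interval R) f g :
  leb.-integrable [set` i] (EFin \o f) -> leb.-integrable [set` i] (EFin \o g) ->
  leb.-integrable [set` i] (EFin \o (fun x => f x + g x)).
Proof. exact: integrable_addr. Qed.

Lemma itv_integrableB (i : interval R) f g :
  leb.-integrable [set` i] (EFin \o f) -> leb.-integrable [set` i] (EFin \o g) ->
  leb.-integrable [set` i] (EFin \o (fun x => f x - g x)).
Proof. exact: integrable_subr. Qed.

Lemma itv_integrableZ (i : interval R) c f :
  leb.-integrable [set` i] (EFin \o f) ->
  leb.-integrable [set` i] (EFin \o (fun x => c * f x)).
Proof. exact: integrable_mulrl. Qed.

Lemma itv_integrableM (i : interval R) h f (M : R) :
  leb.-integrable [set` i] (EFin \o h) -> measurable_fun [set` i] f ->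
  (forall x, x \in i -> `|f x| <= M) ->
  leb.-integrable [set` i] (EFin \o (fun x => h x * f x)).
Proof.
move=> ih mf fM; apply: (integrableMl _ ih mf) => //; exists M; split; first exact: num_real.
by move=> x Mx y Dy; exact: le_trans (fM _ Dy) (ltW Mx).
Qed.

Lemma itv_integrable_norm (i : interval R) f :
  leb.-integrable [set` i] (EFin \o f) ->
  leb.-integrable [set` i] (EFin \o (fun x => `|f x|)).
Proof. by move=> /integrable_abse; exact: eq_integrable. Qed.

Lemma itv_integrable_cst (a b c : R) : leb.-integrable `[a, b] (EFin \o cst c).
Proof. by apply: continuous_integrable; apply: continuous_subspaceT => ?; exact: cvg_cst. Qed.

Lemma itv_RintegralD (i : interval R) f g :
  leb.-integrable [set` i] (EFin \o f) -> leb.-integrable [set` i] (EFin \o g) ->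
  \int[leb]_(x in [set` i]) (f x + g x) =
  \int[leb]_(x in [set` i]) f x + \int[leb]_(x in [set` i]) g x.
Proof. by move=> ? ?; rewrite RintegralD. Qed.

Lemma itv_RintegralB (i : interval R) f g :
  leb.-integrable [set` i] (EFin \o f) -> leb.-integrable [set` i] (EFin \o g) ->
  \int[leb]_(x in [set` i]) (f x - g x) =
  \int[leb]_(x in [set` i]) f x - \int[leb]_(x in [set` i]) g x.
Proof. by move=> ? ?; rewrite RintegralB. Qed.

Lemma itv_RintegralZ (i : interval R) c f :
  leb.-integrable [set` i] (EFin \o f) ->
  \int[leb]_(x in [set` i]) (c * f x) = c * \int[leb]_(x in [set` i]) f x.
Proof. by move=> ?; rewrite RintegralZl. Qed.

Lemma locally_integrable_itv (a b c d : R) h :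
  locally_integrable `]a, b[ h -> a < c -> d < b ->
  leb.-integrable `[c, d] (EFin \o h).
Proof.
move=> [mh _ hK] ac db.
have sub : `[c, d] `<=` `]a, b[.
  move=> x /=; rewrite !in_itv/= => /andP[cx xd].
  by rewrite (lt_le_trans ac cx) (le_lt_trans xd db).
apply/integrableP; split.
  by apply/measurable_EFinP; apply: measurable_funS mh.
by apply: hK => //; exact: segment_compact.
Qed.

Lemma integrable_locally_oo (a b : R) h :
  leb.-integrable `[a, b] (EFin \o h) -> locally_integrable `]a, b[ h.
Proof.
move=> ih; apply: open_integrable_locally; first exact: itv_open.
by apply: integrableS ih => //; exact: subset_itv_oo_cc.
Qed.

Lemma Rintegral_shrink (a b c d : R) f : a < c -> d < b ->
  (forall x, x \notin `[c, d] -> f x = 0) ->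
  \int[leb]_(x in `]a, b[) f x = \int[leb]_(x in `[c, d]) f x.
Proof.
move=> ac db f0; rewrite Rintegral_mkcond [RHS]Rintegral_mkcond.
apply: eq_Rintegral => x _; rewrite !patchE.
have [xcd|xcd] := boolP (x \in `[c, d]); last first.
  by rewrite f0//; do 2 case: ifP.
move: (xcd); rewrite itv_in => /andP[cx xd].
rewrite !mem_set//= in_itv/=.
by rewrite (lt_le_trans ac cx) (le_lt_trans xd db).
Qed.

Lemma Rintegral_oo_cc (a b : R) f : leb.-integrable `[a, b] (EFin \o f) ->
  \int[leb]_(x in `]a, b[) f x = \int[leb]_(x in `[a, b]) f x.
Proof.
move=> i; rewrite Rintegral_itv_obnd_cbnd; last first.
  by apply: integrableS i => //; exact: subset_itv_oo_cc.
by rewrite Rintegral_itv_bndo_bndc//; apply: integrableS i => //; exact: subset_itv_co_cc.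
Qed.

End integration_tools.

(** * Scaled bumps as test functions *)

Section scaled_bump.
Context {R : realType}.
Local Notation leb := (@lebesgue_measure R).
Implicit Types (f g h p : R -> R) (s r x a b : R).

(** Supported in [[s, s + r]], of height at most 1 and mass [r * bump_mass], not normalized. The
    affine argument has the shape required by [flat_spanZ]. *)
Definition sbump s r x : R := bump (r^-1 * x + - (r^-1 * s)).

Lemma smooth_continuous f : smooth f -> continuous f.
Proof.
by move=> /(_ 0%N) sf x; apply: differentiable_continuous; exact/derivable1_diffP.
Qed.

Lemma flat_span_sbump s r : flat_span (sbump s r).
Proof.
have := @flat_spanZ R 1 r^-1 (- (r^-1 * s)) bump (flat_spanM 1 1).
by congr flat_span; apply/funext => x; rewrite mul1r.
Qed.

Lemma smooth_sbump s r : smooth (sbump s r).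
Proof. exact/smooth_flat_span/flat_span_sbump. Qed.

Lemma continuous_sbump s r : continuous (sbump s r).
Proof. exact/smooth_continuous/smooth_sbump. Qed.

Lemma sbump_supp s r x : 0 < r -> x \notin `[s, s + r] -> sbump s r x = 0.
Proof.
move=> r0; apply: contraNeq => /bump_supp; rewrite itv_in -mulrBr.
rewrite [0 < _]pmulr_rgt0 ?invr_gt0// subr_gt0 mulrC ltr_pdivrMr// mul1r.
by rewrite ltrBlDl => /andP[/ltW -> /ltW ->].
Qed.

Lemma sbump_norm s r x : `|sbump s r x| <= 1.
Proof. by rewrite ger0_norm ?bump_ge0 ?bump_le1. Qed.

Definition bump_integral x : R := \int[leb]_(t in `]-oo, x]) bump t.

Lemma continuous_bump : continuous (@bump R).
Proof. exact: (smooth_continuous (smooth_flat_span (flat_spanM 1 1))). Qed.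

Lemma bump_eq0 x : ~~ (0 < x < 1) -> bump x = 0.
Proof. by apply: contraNeq => /bump_supp. Qed.

Lemma integrable_bump : leb.-integrable setT (EFin \o @bump R).
Proof.
have := @continuous_integrable R 0 1 bump.
move=> /(_ (continuous_subspaceT continuous_bump)).
move=> /(integrable_patch _ (measurable_itv _)).1.
apply: integrable_eq => // x _; rewrite patchE; case: ifPn => //.
rewrite notin_setE/= in_itv/= => x01; rewrite bump_eq0//.
by apply/negP => /andP[x0 x1]; apply: x01; rewrite !ltW.
Qed.

Lemma is_derive_bump_integral x : is_derive x 1 bump_integral (bump x).
Proof.
have [] := @continuous_FTC1 R bump -oo%O x (x + 1) _ _ _ _.
- by rewrite ltrDl.
- by apply: integrableS integrable_bump.
- by rewrite ltNyr.
- exact: continuous_bump.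
- by move=> d1 d2; split; [exact: d1|rewrite -derive1E].
Qed.

Lemma bump_integral_le0 x : x <= 0 -> bump_integral x = 0.
Proof.
move=> x0; rewrite /bump_integral; under eq_Rintegral => t.
  rewrite inE/= in_itv/= => tx; rewrite bump_eq0; last by lra.
  over.
by rewrite Rintegral_cst// mul0r.
Qed.

Definition bump_mass : R := \int[leb]_t bump t.

Lemma bump_integral_ge1 x : 1 <= x -> bump_integral x = bump_mass.
Proof.
move=> x1; rewrite /bump_integral Rintegral_mkcond; apply: eq_Rintegral => t _.
rewrite patchE; case: ifPn => //; rewrite notin_setE/= in_itv/= => tx.
by rewrite bump_eq0//; apply/negP => /andP[_ t1]; apply: tx; lra.
Qed.

Lemma bump_mass_gt0 : 0 < bump_mass.
Proof.
rewrite -(bump_integral_ge1 (lexx _)) /bump_integral.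
apply: (@lt_le_trans _ _ (\int[leb]_(t in `]-oo, 1]) (expR (- 8) * \1_`[1/4, 3/4] t))).
  rewrite RintegralZl//; last first.
    by apply: integrableS (integrable_indic_itv _ _ _ _).
  rewrite mulr_gt0 ?expR_gt0//.
  rewrite /Rintegral integral_indic// setIidl; last first.
    by move=> t /=; rewrite !in_itv/=; lra.
  rewrite [X in fine X](_ : _ = (3/4 - 1/4)%:E); first by rewrite /=; lra.
  apply: (etrans (@lebesgue_measure_itv R `[1/4, 3/4])).
  by rewrite /= lte_fin ifT ?EFinB//; lra.
apply: le_Rintegral => //.
- apply: integrable_mulrl => //.
  by apply: integrableS (integrable_indic_itv _ _ _ _).
- by apply: integrableS integrable_bump.
- move=> t _; rewrite indicE; case: (boolP (t \in _)) => [|_].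
    by rewrite inE/= in_itv/= mulr1; exact: bump_lbound.
  by rewrite mulr0 bump_ge0.
Qed.

Lemma is_derive_sbump_integral s r x : 0 < r ->
  is_derive x 1 (fun x => r * bump_integral (r^-1 * x + - (r^-1 * s))) (sbump s r x).
Proof.
move=> r0.
have d := @is_derive1_comp _ bump_integral (fun x => r^-1 * x + - (r^-1 * s))
  x _ _ (is_derive_bump_integral _) (is_derive_affine _ _ _).
apply: (is_derive_val (is_derive_mul (is_derive_cst r x 1) d)).
by rewrite mul0r add0r mulrCA mulfV ?mulr1// gt_eqF.
Qed.

Lemma sbump_mass s r : 0 < r ->
  \int[leb]_(x in `[s, s + r]) sbump s r x = r * bump_mass.
Proof.
move=> r0; have rV : r^-1 * r = 1 by rewrite mulVf ?gt_eqF.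
pose G x : R := r * bump_integral (r^-1 * x + - (r^-1 * s)).
have -> : \int[leb]_(x in `[s, s + r]) sbump s r x = G (s + r) - G s; last first.
  rewrite /G (_ : r^-1 * (s + r) + _ = 1); last by rewrite mulrDr rV; ring.
  rewrite bump_integral_ge1// subrr.
  by rewrite bump_integral_le0// mulr0 subr0.
apply: FTC2.
- by rewrite lerDl ltW.
- apply: continuous_subspaceT => x.
  apply/differentiable_continuous/derivable1_diffP.
  by case: (is_derive_sbump_integral s x r0).
- by apply: continuous_subspaceT; exact: continuous_sbump.
- by move=> x _; exact: is_derive_sbump_integral.
Qed.

Lemma test_function_itv (a b c d : R) p : smooth p -> a < c -> d < b ->
  (forall x, x \notin `[c, d] -> p x = 0) -> test_function a b p.
Proof.
move=> sp ac db p0; split => // x px.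
suff : `[c, d]%classic x.
  by rewrite /= !in_itv/= => /andP[cx xd]; rewrite (lt_le_trans ac cx) (le_lt_trans xd db).
suff : closure `[c, d]%classic x.
  by rewrite -((closure_id `[c, d]%classic).1 (@itv_closed _ _ _ _)).
apply: closure_subset px => y /=; apply: contraNP => /negP ycd.
by rewrite p0.
Qed.

Lemma test_function_sbump a b s r : 0 < r -> a < s -> s + r < b ->
  test_function a b (sbump s r).
Proof.
move=> r0 as_ sb; apply: (@test_function_itv a b s (s + r)) => //.
  exact: smooth_sbump.
by move=> x; exact: sbump_supp.
Qed.

(** The antiderivatives of two bumps of equal width both end at [r * bump_mass], so their difference
    has compact support although neither term has. These test functions detect constants. *)
Lemma test_function_diff a b s t r : 0 < r -> a < s -> a < t -> s + r < b -> t + r < b ->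
  exists2 p, test_function a b p &
    forall x, derive1 p x = sbump s r x - sbump t r x.
Proof.
move=> r0 as_ at_ sb tb.
pose G u x : R := r * bump_integral (r^-1 * x + - (r^-1 * u)).
pose p x := G s x - G t x.
have dp x : is_derive x 1 p (sbump s r x - sbump t r x).
  by apply: is_derive_sub; exact: is_derive_sbump_integral.
have dpE : derive1 p = (fun x => sbump s r x - sbump t r x).
  by apply/funext => x; rewrite derive1E; exact: derive_val.
exists p; last by move=> x; rewrite dpE.
(* The derivative lies in [flat_span], which settles all orders from 1 on; order 0 is [dp]. *)
have sp : smooth p.
  move=> [|n] x; first by case: (dp x).
  rewrite /derive1n iterSr -/(derive1n n _) dpE; apply: smooth_flat_span.
  apply: flat_spanD; first exact: flat_span_sbump.
  have := @flat_spanZ R (-1) 1 0 _ (flat_span_sbump t r).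
  by congr flat_span; apply/funext => y; rewrite mul1r addr0 mulN1r.
apply: (@test_function_itv _ _ (Num.min s t) (Num.max s t + r)) => //.
- by rewrite lt_min as_ at_.
- by rewrite -ltrBrDr gt_max !ltrBrDr sb tb.
have Glow u x : x <= u -> G u x = 0.
  move=> xu; rewrite /G bump_integral_le0 ?mulr0// -mulrBr.
  by rewrite pmulr_rle0 ?invr_gt0// subr_le0.
have Ghigh u x : u + r <= x -> G u x = r * bump_mass.
  move=> xu; rewrite /G bump_integral_ge1// -mulrBr mulrC.
  by rewrite ler_pdivlMr// mul1r lerBrDl.
move=> x; rewrite in_itv/= negb_and -!ltNge => /orP[|].
  by rewrite lt_min /p => /andP[/ltW xs /ltW xt]; rewrite !Glow// subrr.
rewrite -ltrBrDr gt_max !ltrBrDr /p => /andP[/ltW xs /ltW xt].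
by rewrite !Ghigh// subrr.
Qed.

End scaled_bump.

(** * Lebesgue points and the fundamental lemma of the calculus of variations *)

Section lebesgue_points.
Context {R : realType}.
Local Notation leb := (@lebesgue_measure R).
Implicit Types (f g h p : R -> R) (s r x a b e : R).

Lemma ae_sub (P Q : R -> Prop) : (forall x, P x -> Q x) ->
  {ae leb, forall x, P x} -> {ae leb, forall x, Q x}.
Proof. by move=> PQ; apply: filterS => //; exact: (ae_filter_ringOfSetsType leb). Qed.

Lemma ae_sub2 (P P' Q : R -> Prop) : (forall x, P x -> P' x -> Q x) ->
  {ae leb, forall x, P x} -> {ae leb, forall x, P' x} -> {ae leb, forall x, Q x}.
Proof. by move=> PQ; apply: filterS2 => //; exact: (ae_filter_ringOfSetsType leb). Qed.

(* Right averages suffice because the bumps are supported in [[s, s + r]]. *)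
Definition right_lebesgue_pt b h x := forall e, 0 < e ->
  exists2 d, 0 < d & forall r, 0 < r -> r < d ->
    x + r < b /\ \int[leb]_(y in `[x, x + r]) `|h y - h x| <= e * r.

(** Lebesgue differentiation is applied to the restrictions of [h] to the compact intervals [K n],
    which are integrable and exhaust []a, b[]. *)
Lemma ae_right_lebesgue_pt a b h : locally_integrable `]a, b[ h ->
  {ae leb, forall x, x \in `]a, b[ -> right_lebesgue_pt b h x}.
Proof.
move=> lh.
pose K n : set R := `[a + n.+1%:R^-1, b - n.+1%:R^-1]%classic.
have n0 n : 0 < (n.+1%:R^-1 : R) by rewrite invr_gt0.
have iK n : leb.-integrable (K n) (EFin \o h).
  by apply: (locally_integrable_itv lh); rewrite ?ltrDl ?ltrBlDr ?ltrDl.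
have : {ae leb, forall x n, lebesgue_pt (h \_ (K n)) x}.
  apply: ae_foralln => n; apply: lebesgue_differentiation.
  by apply: integrable_locally_restrict => //; exact: measurable_itv.
apply: ae_sub => x Lx; rewrite in_itv/= => /andP[ax xb] e e0.
have [eta [eta0 etaa etab]] : exists eta : R, [/\ 0 < eta, eta <= x - a & eta <= b - x].
  exists (Num.min (x - a) (b - x)).
  by rewrite lt_min !subr_gt0 ax xb !ge_min !lexx orbT.
have [n nlt] : exists n, n.+1%:R^-1 < eta.
  exists (Num.bound eta^-1).
  rewrite invf_plt ?posrE//.
  apply: (lt_le_trans (archi_boundP _)); first by rewrite invr_ge0 ltW.
  by rewrite ler_nat.
(* Here [rho] is a radius, not the density: every point closer than [rho] to [x] lies in [K n]. *)
pose rho : R := eta - n.+1%:R^-1.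
have rho0 : 0 < rho by rewrite subr_gt0.
have Kin (y : R) : x - rho < y -> y < x + rho -> K n y.
  move=> h1 h2; rewrite /K/= in_itv/=; move: h1 h2 etaa etab; rewrite /rho.
  by move: (n.+1%:R^-1 : R) => z *; apply/andP; split; lra.
have rhole : rho <= eta by rewrite /rho lerBlDr lerDl ltW.
clearbody rho.
have := Lx n => /fine_cvgP[fin].
(* The average will be taken over the ball of radius [2 r], of measure [4 r]. The doubled radius
   lets the open ball contain the closed interval [[x, x + r]]. *)
move=> /cvgrPdist_le /(_ (e / 4)); rewrite divr_gt0// => /(_ isT) cv.
have [d d0 dP] : exists2 d, 0 < d & forall r, 0 < r -> r < d ->
   davg (h \_ (K n)) x r \is a fin_num /\ fine (davg (h \_ (K n)) x r) <= e / 4.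
  have [d /= d0 dP] := @filterI _ _ _ _ _ fin cv.
  exists d => // r r0 rd; have [] := dP r _ r0.
    by rewrite /ball_/= sub0r normrN gtr0_norm.
  move=> -> /=; rewrite sub0r normrN => E; split => //.
  by apply: le_trans E; exact: ler_norm.
exists (Num.min (d / 2) (rho / 2)); first by rewrite lt_min !divr_gt0.
move=> r r0; rewrite lt_min => /andP[rd rrho]; split.
  by lra.
have r2 : 0 < r *+ 2 by rewrite mulrn_wgt0.
have r2d : r *+ 2 < d by rewrite -mulr_natr; lra.
have [Dfin Dle] := dP _ r2 r2d.
have subK : ball x (r *+ 2) `<=` K n.
  move=> y; rewrite /ball/= ltr_norml => /andP[y1 y2].
  by rewrite -mulr_natr in y1 y2; apply: Kin; lra.
have Kx : K n x by apply: Kin; lra.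
have bound : (\int[leb]_(y in ball x (r *+ 2)) `|h y - h x|%:E <= (e * r)%:E)%E.
  have : (davg (h \_ (K n)) x (r *+ 2) <= (e / 4)%:E)%E.
    by rewrite -(fineK Dfin) lee_fin.
  rewrite /davg /iavg (lebesgue_measure_ball _ (ltW r2)) inver gt_eqF ?mulrn_wgt0//.
  rewrite lee_pdivrMl ?mulrn_wgt0// -EFinM.
  rewrite (_ : (r *+ 2) *+ 2 * (e / 4) = e * r); last by rewrite -mulr_natr; field.
  apply: le_trans; rewrite le_eqVlt; apply/orP; left; apply/eqP.
  apply: eq_integral => y; rewrite inE => /subK Ky.
  by rewrite /= !patchE !mem_set.
have itv_sub : `[x, x + r]%classic `<=` ball x (r *+ 2).
  move=> y /=; rewrite in_itv/= /ball/= => /andP[xy yx].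
  by rewrite ltr_norml -mulr_natr; apply/andP; split; lra.
have mh : measurable_fun (ball x (r *+ 2)) (fun y => `|h y - h x|).
  apply: measurableT_comp => //; apply: measurable_funB => //.
  apply: (measurable_funS _ subK); first exact: measurable_itv.
  exact: integrable_measurable (iK n).
have bound2 : (\int[leb]_(y in `[x, (x + r)%R]) `|h y - h x|%:E <= (e * r)%:E)%E.
  apply: le_trans bound; apply: ge0_subset_integral => //.
  - exact: measurable_ball.
  - exact/measurable_EFinP.
rewrite /Rintegral -lee_fin fineK// ge0_fin_numE ?integral_ge0//.
exact: le_lt_trans bound2 (ltry _).
Qed.

(** As the bump is at most 1, replacing [h] by [h x] under the integral costs at most the integral
    of [|h - h x|] over [[x, x + r]]. *)
Lemma bump_concentration b h x : right_lebesgue_pt b h x -> forall e, 0 < e ->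
  exists2 d, 0 < d & forall r, 0 < r -> r < d -> x + r < b /\
    (leb.-integrable `[x, x + r] (EFin \o h) ->
     `|\int[leb]_(y in `[x, x + r]) (h y * sbump x r y) - h x * (r * bump_mass)|
       <= e * r).
Proof.
move=> Lx e e0; have [d d0 dP] := Lx e e0; exists d => // r r0 rd.
have [xb Le] := dP r r0 rd; split => // ih.
have cb := @continuous_subspaceT _ _ `[x, x + r]%classic _ (@continuous_sbump R x r).
have ib := continuous_integrable cb.
have ihb := itv_integrableM ih (integrable_measurable ib) (fun y _ => sbump_norm x r y).
rewrite -(@sbump_mass R x r)// -RintegralZl// -RintegralB//; last exact: itv_integrableZ.
have idiff := itv_integrableB ihb (itv_integrableZ (h x) ib).
apply: (le_trans (le_normr_Rintegral _ idiff)) => //; apply: le_trans Le.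
apply: le_Rintegral => //.
- exact: itv_integrable_norm idiff.
- exact: itv_integrable_norm (itv_integrableB ih (itv_integrable_cst _ _ _)).
- by move=> y yI; rewrite -mulrBl normrM ler_piMr// sbump_norm.
Qed.

Lemma sbump_integral a b h s r : locally_integrable `]a, b[ h ->
  0 < r -> a < s -> s + r < b ->
  leb.-integrable `]a, b[ (EFin \o (fun y => h y * sbump s r y)) /\
  \int[leb]_(y in `]a, b[) (h y * sbump s r y) =
  \int[leb]_(y in `[s, s + r]) (h y * sbump s r y).
Proof.
move=> lh r0 as_ sb; split; last first.
  by rewrite (Rintegral_shrink as_ sb)// => y ynot; rewrite sbump_supp ?mulr0.
have cb := @continuous_subspaceT _ _ `[s, s + r]%classic _ (@continuous_sbump R s r).
have := itv_integrableM (locally_integrable_itv lh as_ sb)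
  (integrable_measurable (continuous_integrable cb)) (fun y _ => sbump_norm s r y).
move=> /(integrable_patch _ (measurable_itv _)).1 i.
have : leb.-integrable `]a, b[ (EFin \o ((fun y => h y * sbump s r y) \_ `[s, s + r])).
  by apply: integrableS i.
apply: integrable_eq => // y _; rewrite patchE; case: ifPn => //.
rewrite notin_setE/= => /negP yn.
by rewrite sbump_supp ?mulr0.
Qed.

(** At a Lebesgue point the vanishing bump integral is close to [h x * (r * bump_mass)]; dividing by
    the mass leaves [|h x| <= e]. *)
Lemma ae_eq0_of_bumps a b h : locally_integrable `]a, b[ h ->
  (forall s r, 0 < r -> a < s -> s + r < b ->
     \int[leb]_(x in `]a, b[) (h x * sbump s r x) = 0) ->
  {ae leb, forall x, x \in `]a, b[ -> h x = 0}.
Proof.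
move=> lh h0; have := ae_right_lebesgue_pt lh; apply: ae_sub => x Lx xab.
have /andP[ax xb] : a < x < b by rewrite in_itv in xab.
apply/eqP; rewrite -normr_le0; apply/ler_addgt0Pl => e e0; rewrite addr0.
have em0 : 0 < e * bump_mass by rewrite mulr_gt0 ?bump_mass_gt0.
have [d d0 dP] := bump_concentration (Lx xab) em0.
have r0 : 0 < d / 2 by rewrite divr_gt0.
have [|xrb H] := dP _ r0 _; first lra.
have := H (locally_integrable_itv lh ax xrb).
have [_ <-] := sbump_integral lh r0 ax xrb; rewrite h0//.
rewrite sub0r normrN normrM [`|_ * bump_mass|]ger0_norm; last first.
  by rewrite mulr_ge0 ?ltW ?bump_mass_gt0.
rewrite (_ : e * bump_mass * (d / 2) = e * (d / 2 * bump_mass)); last by ring.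
by rewrite ler_pM2r// mulr_gt0 ?bump_mass_gt0.
Qed.

(** Bumps of equal width at two Lebesgue points have equal integrals, so the values of [h] there
    agree. *)
Lemma ae_cst_of_bumps a b h : locally_integrable `]a, b[ h ->
  (forall s t r, 0 < r -> a < s -> s + r < b -> a < t -> t + r < b ->
     \int[leb]_(x in `]a, b[) (h x * sbump s r x) =
     \int[leb]_(x in `]a, b[) (h x * sbump t r x)) ->
  exists c, {ae leb, forall x, x \in `]a, b[ -> h x = c}.
Proof.
move=> lh h0; have Lh := ae_right_lebesgue_pt lh.
have key s t : s \in `]a, b[ -> t \in `]a, b[ -> right_lebesgue_pt b h s ->
    right_lebesgue_pt b h t -> h s = h t.
  rewrite !in_itv/= => /andP[as_ sb] /andP[at_ tb] Ls Lt.
  apply/eqP; rewrite -subr_eq0 -normr_le0; apply/ler_addgt0Pl => e e0; rewrite addr0.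
  have em0 : 0 < e * bump_mass / 2 by rewrite divr_gt0 ?mulr_gt0 ?bump_mass_gt0.
  have [d d0 dP] := bump_concentration Ls em0.
  have [d' d'0 d'P] := bump_concentration Lt em0.
  (* One width has to serve both points; each of them contributes half of [e]. *)
  pose r := Num.min d d' / 2.
  have m0 : 0 < Num.min d d' by rewrite lt_min d0 d'0.
  have md : Num.min d d' <= d by rewrite ge_min lexx.
  have md' : Num.min d d' <= d' by rewrite ge_min lexx orbT.
  have r0 : 0 < r by rewrite divr_gt0.
  have [|srb Hs] := dP r r0 _; first by rewrite /r; lra.
  have [|trb Ht] := d'P r r0 _; first by rewrite /r; lra.
  have {}Hs := Hs (locally_integrable_itv lh as_ srb).
  have {}Ht := Ht (locally_integrable_itv lh at_ trb).
  have [_ Es] := sbump_integral lh r0 as_ srb.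
  have [_ Et] := sbump_integral lh r0 at_ trb.
  have E := h0 s t r r0 as_ srb at_ trb; rewrite Es Et in E.
  rewrite E in Hs.
  have rm0 : 0 < r * bump_mass by rewrite mulr_gt0 ?bump_mass_gt0.
  rewrite -(ler_pM2r rm0) -[X in _ * X <= _]gtr0_norm// -normrM.
  set I := \int[leb]_(y in _) _ in Hs Ht.
  rewrite (_ : (h s - h t) * _ = (I - h t * (r * bump_mass)) - (I - h s * (r * bump_mass))); last by ring.
  apply: (le_trans (ler_normB _ _)).
  rewrite (_ : e * _ = e * bump_mass / 2 * r + e * bump_mass / 2 * r); last by field.
  exact: lerD.
(* The constant is the value at any Lebesgue point. If there is none, almost no point lies in []a,
   b[] and 0 will do. *)
have [[s sab Ls]|none] := pselect (exists2 s, s \in `]a, b[ & right_lebesgue_pt b h s).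
  exists (h s); apply: ae_sub Lh => x Lx xab; exact: key (Lx xab) Ls.
exists 0; apply: ae_sub Lh => x Lx xab; exfalso; apply: none.
by exists x => //; exact: Lx.
Qed.

End lebesgue_points.

(** * Weak derivatives *)

Section weak_derivatives.
Context {R : realType}.
Local Notation leb := (@lebesgue_measure R).
Implicit Types (f g h p : R -> R) (s r x a b c e : R).

Lemma subr_swap x (y z t : R) : x - y = z - t -> x - z = y - t.
Proof. by move=> *; lra. Qed.

Lemma primitive_continuous a b f g : primitive a b f g ->
  {within `[a, b], continuous f}.
Proof.
move=> [ig fE]; have [ab|ab] := leP a b; last first.
  by rewrite set_itv_ge ?bnd_simp -?ltNge//; exact: continuous_subspace0.
have cG := parameterized_integral_continuous ab ig.
apply: (@within_eqf _ _ _ (fun x => f a + parameterized_integral leb a x g)); last first.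
  apply: (@within_addr R R _ (fun=> f a) (fun x => parameterized_integral leb a x g)).
    exact: within_cst.
  exact: cG.
move=> x xab.
by rewrite [RHS]fE.
Qed.

Lemma continuous_measurable a b f : {within `[a, b], continuous f} ->
  measurable_fun `[a, b] f.
Proof. by move=> cf; exact: integrable_measurable (continuous_integrable cf). Qed.

Lemma continuous_bounded a b f : {within `[a, b], continuous f} ->
  exists M, forall x, x \in `[a, b] -> `|f x| <= M.
Proof.
move=> cf; have [M [_ HM]] := compact_bounded (continuous_compact cf (@segment_compact R a b)).
exists (M + 1) => x xab; apply: (HM (M + 1)); first by rewrite ltrDl.
by exists x.
Qed.

(** A nonzero difference at an interior point persists on an open interval, whose positive measure
    contradicts its inclusion in a null set. One-sided limits give the endpoints. *)
Lemma ae_eq_continuous a b f g : a < b -> {within `[a, b], continuous f} ->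
  {within `[a, b], continuous g} ->
  {ae leb, forall x, x \in `]a, b[ -> f x = g x} ->
  forall x, x \in `[a, b] -> f x = g x.
Proof.
move=> ab cf cg fg.
pose h x := f x - g x.
have ch : {within `[a, b], continuous h} by exact: within_subr.
have [chi cha chb] := (continuous_within_itvP h ab).1 ch.
have h0 x : x \in `]a, b[ -> h x = 0.
  move=> xab; apply/eqP/negPn/negP => hx.
  have n1 : \forall y \near x, h y != 0 
    := @cvgr_neq0 R R^o R (nbhs x) (nbhs_filter x) h (h x) (chi x xab) hx.
  have n2 : \forall y \near x, y \in `]a, b[ := near_in_itvoo xab.
  have [d /= d0 dP] := @filterI _ _ _ _ _ n1 n2.
  have [Z [mZ Z0 NZ]] := fg.
  have sub : `]x - d, x + d[ `<=` ~` [set z | z \in `]a, b[ -> f z = g z].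
    move=> y /=; rewrite in_itv/= => /andP[y1 y2].
    have [] := dP y; first by rewrite /ball_/= ltr_norml; apply/andP; split; lra.
    by move=> hy yab /(_ yab) E; move: hy; rewrite /h E subrr eqxx.
  have mI : measurable (`]x - d, x + d[%classic : set (measurableTypeR R)) by [].
  pose I : set R := `]x - d, x + d[%classic.
  have : (leb I <= leb Z)%E.
    by apply: le_measure; rewrite ?inE//; exact: subset_trans sub NZ.
  rewrite [X in (_ <= X)%E]Z0.
  rewrite [X in (X <= _)%E](_ : _ = ((x + d) - (x - d))%:E); last first.
    apply: (etrans (@lebesgue_measure_itv R `]x - d, x + d[)).
    by rewrite /= lte_fin ifT ?EFinB//; lra.
  by rewrite lee_fin; lra.
have end0 (F : set_system R) c : ProperFilter F -> h x @[x --> F] --> h c ->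
    (\forall x \near F, h x = 0) -> h c = 0.
  move=> PF hc F0.
  have h00 : h x @[x --> F] --> (0 : R) by exact: cvg_near_cst.
  exact: (cvg_unique (@Rhausdorff R) hc h00).
move=> x; rewrite itv_in => /andP[ax xb]; apply/eqP; rewrite -subr_eq0; apply/eqP.
rewrite -/(h x); move: ax; rewrite le_eqVlt => /predU1P[<-|ax].
  apply: (end0 _ _ _ cha); near=> y; apply: h0; rewrite in_itv/=; apply/andP; split.
    by near: y; exact: nbhs_right_gt.
  by near: y; exact: nbhs_right_lt.
move: xb; rewrite le_eqVlt => /predU1P[->|xb]; last by apply: h0; rewrite in_itv/= ax xb.
apply: (end0 _ _ _ chb); near=> y; apply: h0; rewrite in_itv/=; apply/andP; split.
  by near: y; exact: nbhs_left_gt.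
by near: y; exact: nbhs_left_lt.
Unshelve. all: by end_near. Qed.

Lemma test_functionE a b p : test_function a b p ->
  [/\ p a = 0, p b = 0 & primitive a b p (derive1 p)].
Proof.
move=> [sp cp].
have out x : x \notin `]a, b[ -> p x = 0.
  by apply: contraNeq => px; apply: cp; apply: subset_closure.
split; [by apply: out; rewrite in_itv/= ltxx|by apply: out; rewrite in_itv/= ltxx andbF|].
have dp x : is_derive x 1 p (derive1 p x).
  by split; [exact: sp 0%N x|rewrite derive1E].
apply: C1_primitive => //.
- by apply: continuous_subspaceT => x; apply/differentiable_continuous/derivable1_diffP; exact: sp 0%N x.
- by apply: continuous_subspaceT => x; apply/differentiable_continuous/derivable1_diffP; exact: sp 1%N x.
Qed.

Lemma continuous_locally a b f : {within `[a, b], continuous f} ->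
  locally_integrable `]a, b[ f.
Proof. by move=> cf; exact/integrable_locally_oo/continuous_integrable. Qed.

(** The product [f * p] vanishes at both endpoints, so its derivative integrates to 0. *)
Lemma primitive_weak_deriv a b f g : a <= b -> primitive a b f g -> is_weak_deriv a b f g.
Proof.
move=> ab pfg; have cf := primitive_continuous pfg; have [ig _] := pfg.
split; [exact: continuous_locally|exact: integrable_locally_oo|].
move=> p tp; have [pa pb pp] := test_functionE tp.
have [_ /(_ b)] := primitiveM pfg pp; rewrite itv_in ab lexx => /(_ isT).
rewrite pa pb !mulr0 add0r => E.
have cp := primitive_continuous pp.
have [M pM] := continuous_bounded cp.
have [N fN] := continuous_bounded cf.
have i1 := itv_integrableM ig (continuous_measurable cp) pM.
have i2 : leb.-integrable `[a, b] (EFin \o (fun x => f x * derive1 p x)).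
  have := itv_integrableM pp.1 (continuous_measurable cf) fN.
  by apply: itv_integrable_eq => // x _; rewrite mulrC.
rewrite !Rintegral_oo_cc//; apply/eqP; rewrite -addr_eq0 addrC -RintegralD//.
by rewrite -E.
Qed.

Lemma weak_deriv_ae_eq a b f g g' : is_weak_deriv a b f g -> is_weak_deriv a b f g' ->
  {ae leb, forall x, x \in `]a, b[ -> g x = g' x}.
Proof.
move=> [_ lg wg] [_ lg' wg'].
have := @ae_eq0_of_bumps R a b (g \- g') (locally_integrableB lg lg').
move=> H; apply: ae_sub (H _) => [x E xab|s r r0 as_ sb].
  by apply/eqP; rewrite -subr_eq0; apply/eqP; exact: E.
have [i _] := sbump_integral lg r0 as_ sb.
have [i' _] := sbump_integral lg' r0 as_ sb.
have tp := test_function_sbump r0 as_ sb.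
under eq_Rintegral do rewrite mulrBl.
rewrite RintegralB//; apply/eqP; rewrite subr_eq0 -eqr_opp; apply/eqP.
by rewrite -wg// -wg'.
Qed.

(** With [G] the indefinite integral of [g], [f - G] has zero weak derivative. Tested on
    [test_function_diff], its bump integrals do not depend on position, so it is almost everywhere
    constant. *)
Lemma weak_deriv_primitive_ae a b f g : a <= b -> is_weak_deriv a b f g ->
  leb.-integrable `[a, b] (EFin \o g) ->
  exists2 F, primitive a b F g & {ae leb, forall x, x \in `]a, b[ -> f x = F x}.
Proof.
move=> ab [lf _ wf] ig.
pose G x := \int[leb]_(t in `[a, x]) g t.
have pG : primitive a b G g.
  by split => // x _; rewrite {2}/G set_itv1 Rintegral_set1 add0r.
have [lG _ wG] := primitive_weak_deriv ab pG.
have [c Hc] : exists c, {ae leb, forall x, x \in `]a, b[ -> (f \- G) x = c}.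
  apply: ae_cst_of_bumps; first exact: locally_integrableB.
  move=> s t r r0 as_ sb at_ tb.
  have [p tp dp] := test_function_diff r0 as_ at_ sb tb.
  have [fs _] := sbump_integral lf r0 as_ sb.
  have [ft _] := sbump_integral lf r0 at_ tb.
  have [Gs _] := sbump_integral lG r0 as_ sb.
  have [Gt _] := sbump_integral lG r0 at_ tb.
  have := etrans (wf p tp) (esym (wG p tp)).
  under eq_Rintegral do rewrite dp mulrBr.
  rewrite (itv_RintegralB fs ft).
  under [RHS]eq_Rintegral do rewrite dp mulrBr.
  rewrite (itv_RintegralB Gs Gt) => E.
  under eq_Rintegral do rewrite mulrBl.
  rewrite (itv_RintegralB fs Gs).
  under [RHS]eq_Rintegral do rewrite mulrBl.
  rewrite (itv_RintegralB ft Gt).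
  exact: subr_swap E.
exists (fun x => c + G x).
  split => // x xab; rewrite [in LHS](pG.2 x)// addrA; congr (_ + _ + _).
apply: ae_sub Hc => x H xab; rewrite -(H xab)/=; ring.
Qed.

Lemma weak_deriv_primitive a b f g : a < b -> is_weak_deriv a b f g ->
  leb.-integrable `[a, b] (EFin \o g) -> {within `[a, b], continuous f} ->
  primitive a b f g.
Proof.
move=> ab wf ig cf; have [F pF fF] := weak_deriv_primitive_ae (ltW ab) wf ig.
have E := ae_eq_continuous ab cf (primitive_continuous pF) fF.
split => // x xab; rewrite !E//; first exact: pF.2.
by rewrite in_itv/= lexx ltW.
Qed.

End weak_derivatives.
(** * The spaces L^2(mu) and H^1(mu) *)

Section density.
Context {R : realType}.
Local Notation leb := (@lebesgue_measure R).
Variables (a b : R) (mu : probability (measurableTypeR R) R) (rho : R -> R).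
Hypothesis ab : a < b.
Hypothesis bp : bounded_perturbation a b mu rho.
Implicit Types (f g h : R -> R).

Let crho : {within `[a, b], continuous rho} := bp_continuous bp.
Let I : set (measurableTypeR R) := `[a, b]%classic.
Let mI : measurable I. Proof. exact: measurable_itv. Qed.
Let rho0 x : x \in `[a, b] -> 0 <= rho x.
Proof. by move=> xI; exact/ltW/(bp_gt0 bp). Qed.

Lemma density_ubound : exists2 M, 0 < M & forall x, x \in `[a, b] -> rho x <= M.
Proof.
have [M HM] := continuous_bounded crho; exists (`|M| + 1); first by rewrite ltr_wpDl.
move=> x xI; rewrite (le_trans (ler_norm _))// (le_trans (HM x xI))//.
by rewrite (le_trans (ler_norm _))// lerDl.
Qed.

Lemma density_lbound : exists2 m, 0 < m & forall x, x \in `[a, b] -> m <= rho x.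
Proof.
have aI : a \in `[a, b] by rewrite in_itv/= lexx ltW.
have [||c /set_mem cI cm] := @compact_EVT_min _ _ rho `[a, b]%classic _ _ crho.
- by exists a.
- exact: segment_compact.
- by exists (rho c) => [|x xI]; [exact: bp_gt0 bp _ cI|apply: cm; rewrite inE].
Qed.

Lemma mu_dominated : mu `<< leb.
Proof.
apply/null_content_dominatesP => A mA A0; rewrite (bp_density bp)//.
apply: null_set_integral.
- exact: measurableI.
- apply/measurable_EFinP; apply: (@measurable_funS _ _ _ _ I) => //.
  exact: continuous_measurable.
- by apply: (@subset_measure0 _ _ _ leb _ A) => //; exact: measurableI.
Qed.

(** The change of variables holds with the abstract Radon-Nikodym derivative, which equals [rho]
    almost everywhere on [[a, b]] since both have the same integral over each measurable subset. *)
Lemma ge0_integral_mu f : measurable_fun I f -> (forall x, I x -> 0 <= f x) ->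
  (\int[mu]_(x in I) (f x)%:E = \int[leb]_(x in I) (f x * rho x)%:E)%E.
Proof.
move=> mf f0.
have mrho : measurable_fun I rho by exact: continuous_measurable.
(* The cut-off makes the integrand nonnegative everywhere, as the change of variables requires. *)
pose g x := ((f \_ I) x)%:E.
have g0 x : (0 <= g x)%E.
  by rewrite /g lee_fin patchE; case: ifPn => // /set_mem; exact: f0.
have mg : measurable_fun I g.
  apply/measurable_EFinP; apply: (eq_measurable_fun f) => // x xI.
  by rewrite patchE xI.
have -> : (\int[mu]_(x in I) (f x)%:E = \int[mu]_(x in I) g x)%E.
  by apply: eq_integral => x xI; rewrite /g patchE xI.
rewrite -(Radon_Nikodym_SigmaFinite.change_of_variables mu_dominated)//.
have irn := Radon_Nikodym_SigmaFinite.f_integrable mu_dominated.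
have irnI : leb.-integrable I (Radon_Nikodym_SigmaFinite.f mu leb).
  exact: integrableS irn.
apply: ae_eq_integral => //.
- by apply: emeasurable_funM => //; exact: (measurable_int leb irnI).
- by apply/measurable_EFinP; exact: measurable_funM.
- have ae : ae_eq leb I (Radon_Nikodym_SigmaFinite.f mu leb) (EFin \o rho).
    apply: integral_ae_eq => //; first exact/measurable_EFinP.
    move=> E EI mE; rewrite -(Radon_Nikodym_SigmaFinite.f_integral mu_dominated)//.
    by apply: (etrans (bp_density bp mE)); rewrite setIidl.
  apply: filterS ae => x H Ix; rewrite H// /g patchE mem_set//.
Qed.

(** [rho] lies between two positive constants on [[a, b]], so both integrals of [|f|] are finite
    together. *)
Lemma integrable_mu f : mu.-integrable I (EFin \o f) <-> leb.-integrable I (EFin \o f).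
Proof.
have [m m0 mP] := density_lbound; have [M M0 MP] := density_ubound.
have key : measurable_fun I f ->
    (\int[mu]_(x in I) `|f x|%:E = \int[leb]_(x in I) (`|f x| * rho x)%:E)%E.
  by move=> mf; apply: ge0_integral_mu => //; exact: measurableT_comp.
have mrho : measurable_fun I rho by exact: continuous_measurable.
have mnf : measurable_fun I f -> measurable_fun I (fun x => `|f x|).
  by move=> mf; exact: measurableT_comp.
have scale (c : R) : 0 <= c -> measurable_fun I f ->
   (\int[leb]_(x in I) (c * `|f x|)%:E = c%:E * \int[leb]_(x in I) `|f x|%:E)%E.
  move=> c0 mf; under eq_integral do rewrite EFinM.
  by rewrite ge0_integralZl//; apply/measurable_EFinP; exact: mnf.
split=> /integrableP[/measurable_EFinP mf fi]; apply/integrableP; split.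
- exact/measurable_EFinP.
- have : (m%:E * \int[leb]_(x in I) `|f x|%:E < +oo)%E.
    apply: le_lt_trans fi; rewrite /= (key mf) -(scale _ (ltW m0) mf).
    apply: ge0_le_integral => //=.
    + by move=> x _; rewrite lee_fin mulr_ge0// ltW.
    + by apply/measurable_EFinP; apply: measurable_funM => //; exact: mnf.
    + by apply/measurable_EFinP; apply: measurable_funM => //; exact: mnf.
    + by move=> x xI; rewrite lee_fin mulrC ler_wpM2l// mP.
  have /= := integral_ge0 (D := I) leb (f := fun x => `|f x|%:E) (fun x _ => normr_ge0 _).
  by case: (\int[leb]_(x in I) _)%E => // [r|] _ //=; rewrite ?ltry// gt0_muley// lte_fin.
- exact/measurable_EFinP.
- rewrite /= key//; apply: (@le_lt_trans _ _ (M%:E * \int[leb]_(x in I) `|f x|%:E)%E).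
    rewrite -(scale _ (ltW M0) mf); apply: ge0_le_integral => //=.
    + by move=> x xI; rewrite lee_fin mulr_ge0// rho0.
    + by apply/measurable_EFinP; apply: measurable_funM => //; exact: mnf.
    + by apply/measurable_EFinP; apply: measurable_funM => //; exact: mnf.
    + by move=> x xI; rewrite lee_fin [leRHS]mulrC ler_wpM2l// MP.
  by rewrite lte_mul_pinfty// lee_fin ltW.
Qed.

Lemma Rintegral_mu f : leb.-integrable I (EFin \o f) ->
  \int[mu]_(x in I) f x = \int[leb]_(x in I) (f x * rho x).
Proof.
move=> fi; have mf : measurable_fun I f by exact: integrable_measurable.
rewrite /Rintegral; congr fine; rewrite integralE [RHS]integralE; congr (_ - _)%E.
- transitivity (\int[mu]_(x in I) (Num.max (f x) 0)%:E)%E.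
    by apply: eq_integral => x _; rewrite funeposE/= EFin_max.
  rewrite ge0_integral_mu; last 2 first.
    exact: measurable_funrpos.
    by move=> x _; rewrite le_max lexx orbT.
  apply: eq_integral => x /set_mem/= xI.
  by rewrite funeposE/= -EFin_max maxr_pMl ?mul0r// rho0.
- transitivity (\int[mu]_(x in I) (Num.max (- f x) 0)%:E)%E.
    by apply: eq_integral => x _; rewrite funenegE/= EFin_max.
  rewrite ge0_integral_mu; last 2 first.
    exact: measurable_funrneg.
    by move=> x _; rewrite le_max lexx orbT.
  apply: eq_integral => x /set_mem/= xI.
  by rewrite funenegE/= -EFin_max maxr_pMl ?mul0r ?mulNr// rho0.
Qed.

(** Stated for Lebesgue measure: by [integrable_mu] the space is that of [mu], and the weight
    disappears from integrability arguments. *)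
Definition sq_integrable f := measurable_fun I f /\
  leb.-integrable I (EFin \o (fun x => f x ^+ 2)).

Lemma L2P f : L2 a b mu f <-> sq_integrable f.
Proof.
rewrite /L2 /= /sq_integrable; split=> [L|[mf fi]].
  have mfI : measurable_fun I f.
    move: (L); rewrite inE => /andP[/[!inE]/= mf _].
    by apply/(measurable_restrictT _ _).2.
  split => //; apply/integrable_mu.
  have := Lfun2_integrable_sqr L => /(integrableS _ mI) => /(_ measurableT (@subsetT _ _)).
  by apply: integrable_eq => // x xI; rewrite patchE mem_set.
rewrite inE; apply/andP; split; rewrite inE /=.
  exact/(measurable_restrictT _ _).1.
rewrite /finite_norm unlock /=; apply: poweR_lty.
have /integrable_mu/integrableP[_] := fi; apply: le_lt_trans.
rewrite [leRHS]integral_mkcond le_eqVlt; apply/orP; left; apply/eqP.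
apply: eq_integral => x _; rewrite /= !patchE; case: ifPn => _; last first.
  by rewrite [point](_ : _ = 0)// normr0 powR_mulrn// expr0n.
by rewrite powR_mulrn// normrX.
Qed.

End density.

(** * Square integrable functions and the Riesz-Fischer theorem *)

Section square_integrable.
Context {R : realType}.
Local Notation leb := (@lebesgue_measure R).
Variables (a b : R).
Implicit Types (f g h : R -> R).

Local Notation sq := (sq_integrable a b).

Lemma sq_integrable_mul f g : sq f -> sq g ->
  leb.-integrable `[a, b] (EFin \o (fun x => f x * g x)).
Proof.
move=> [mf fi] [mg gi]; have := itv_integrableD fi gi.
apply: le_integrable => //.
  by apply/measurable_EFinP; exact: measurable_funM.
move=> x _ /=; rewrite lee_fin [leRHS]ger0_norm ?addr_ge0 ?sqr_ge0//.
rewrite ler_norml; apply/andP; split.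
  by have := sqr_ge0 (f x + g x); have := sqr_ge0 (f x); have := sqr_ge0 (g x); nra.
by have := sqr_ge0 (f x - g x); have := sqr_ge0 (f x); have := sqr_ge0 (g x); nra.
Qed.

Lemma sq_integrable_eq f g : (forall x, x \in `[a, b] -> f x = g x) -> sq f -> sq g.
Proof.
move=> fg [mf fi]; split; first by apply: (eq_measurable_fun f) mf => x /set_mem/fg.
by apply: itv_integrable_eq fi => x xI; rewrite fg.
Qed.

Lemma sq_integrableD f g : sq f -> sq g -> sq (fun x => f x + g x).
Proof.
move=> sf sg; have [mf fi] := sf; have [mg gi] := sg.
split; first exact: measurable_funD.
have := itv_integrableD (itv_integrableD fi gi) (itv_integrableZ 2 (sq_integrable_mul sf sg)).
by apply: itv_integrable_eq => x _; ring.
Qed.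

Lemma sq_integrableZ c f : sq f -> sq (fun x => c * f x).
Proof.
move=> [mf fi]; split; first exact: measurable_funM.
have := itv_integrableZ (c ^+ 2) fi.
by apply: itv_integrable_eq => x _; ring.
Qed.

Lemma sq_integrableB f g : sq f -> sq g -> sq (fun x => f x - g x).
Proof.
move=> sf sg; have := sq_integrableD sf (sq_integrableZ (-1) sg).
by apply: sq_integrable_eq => x _; rewrite mulN1r.
Qed.

Lemma sq_integrable_bounded f M : measurable_fun `[a, b] f ->
  (forall x, x \in `[a, b] -> `|f x| <= M) -> sq f.
Proof.
move=> mf fM; split => //.
have := itv_integrableM (itv_integrableM (itv_integrable_cst a b 1) mf fM) mf fM.
by apply: itv_integrable_eq => x _; rewrite /= mul1r expr2.
Qed.

Lemma sq_integrable_continuous f : {within `[a, b], continuous f} -> sq f.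
Proof.
move=> cf; have [M fM] := continuous_bounded cf.
by apply: sq_integrable_bounded fM; exact: continuous_measurable.
Qed.

Lemma sq_integrable_cst c : sq (cst c).
Proof. by apply: sq_integrable_continuous; exact: within_cst. Qed.

Lemma sq_integrableW f : sq f -> leb.-integrable `[a, b] (EFin \o f).
Proof.
move=> sf; have := sq_integrable_mul (sq_integrable_cst 1) sf.
by apply: itv_integrable_eq => x _; rewrite /= mul1r.
Qed.

Definition sqn f := \int[leb]_(x in `[a, b]) (f x ^+ 2).

Lemma sqn_ge0 f : 0 <= sqn f.
Proof. by apply: Rintegral_ge0 => x _; exact: sqr_ge0. Qed.

Lemma EFin_sqn f : sq f -> (\int[leb]_(x in `[a, b]) (f x ^+ 2)%:E = (sqn f)%:E)%E.
Proof. by move=> [mf fi]; rewrite /sqn /Rintegral fineK//; exact: integrable_fin_num. Qed.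

(* From [2 |f| <= t f^2 + 1/t]. *)
Lemma norm_le_sqn f t : sq f -> 0 < t -> a <= b ->
  \int[leb]_(x in `[a, b]) `|f x| <= (t * sqn f + t^-1 * (b - a)) / 2.
Proof.
move=> sf t0 ab; have [mf fi] := sf.
have i1 := itv_integrableD (itv_integrableZ t fi) (itv_integrable_cst a b t^-1).
have i2 := itv_integrableZ 2^-1 i1.
apply: (@le_trans _ _ (\int[leb]_(x in `[a, b]) (2^-1 * (t * f x ^+ 2 + t^-1)))).
  apply: le_Rintegral => //; first exact: itv_integrable_norm (sq_integrableW sf).
  move=> x _; rewrite ler_pdivlMl//.
  rewrite -[leRHS](mulKf (lt0r_neq0 t0)) ler_pdivlMl// mulrDr mulfV ?gt_eqF//.
  rewrite -subr_ge0 (_ : _ - _ = (t * `|f x| - 1) ^+ 2) ?sqr_ge0//.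
  by rewrite sqrrB1 exprMn real_normK ?num_real// -mulr_natl; ring.
rewrite (itv_RintegralZ _ i1) (itv_RintegralD (itv_integrableZ t fi) (itv_integrable_cst a b t^-1)).
rewrite (itv_RintegralZ _ fi) -/(sqn f) Rintegral_cst//.
rewrite mulrC ler_pM2r// lerD2l.
rewrite [X in fine X](_ : _ = (b - a)%:E)//.
apply: (etrans (@lebesgue_measure_itv R `[a, b])); rewrite /= lte_fin.
by case: ltP => [_|ba]; rewrite ?EFinB//; congr EFin; apply/eqP; rewrite eq_sym subr_eq0 eq_le ba ab.
Qed.

(** Riesz-Fischer: a subsequence with fast decreasing increments has an almost everywhere absolutely
    convergent telescoping series, and Fatou's lemma turns its pointwise limit into a norm limit of
    the full sequence. *)
Lemma sq_complete (u : nat -> R -> R) : a <= b -> (forall n, sq (u n)) ->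
  (forall e, 0 < e -> exists N, forall m n, (N <= m)%N -> (N <= n)%N ->
     sqn (fun x => u m x - u n x) < e) ->
  exists2 g, sq g & forall e, 0 < e -> exists N, forall n, (N <= n)%N ->
    sqn (fun x => u n x - g x) <= e.
Proof.
move=> ab su cu.
have half0 k : 0 < (4^-1 : R) ^+ k by rewrite exprn_gt0// invr_gt0.
have /choice[N NP] k := cu _ (half0 k).
(* The cumulated sum makes [phi] nondecreasing and at least [N k]; the added [k] gives [k <= phi k],
   used under Fatou's lemma. *)
pose phi k := (\sum_(i < k.+1) N i + k)%N.
have phiN k : (N k <= phi k)%N by rewrite /phi big_ord_recr/= -addnA addnCA leq_addr.
have phiS k : (phi k <= phi k.+1)%N by rewrite /phi leq_add ?leqnSn// [leqRHS]big_ord_recr/= leq_addr.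
pose d k x := u (phi k.+1) x - u (phi k) x.
have sd k : sq (d k) by exact: sq_integrableB.
have dn k : sqn (d k) <= 4^-1 ^+ k.
  by apply/ltW/NP; [exact: leq_trans (phiN k) (phiS k)|exact: phiN].
have dl1 k : \int[leb]_(x in `[a, b]) `|d k x| <= (1 + (b - a)) / 2 * 2^-1 ^+ k.
  (* With [t = 2 ^ k] the two terms of [norm_le_sqn] balance: the first is of order
     [2 ^ k * 4 ^- k], the second of order [2 ^- k]. *)
  have t0 : 0 < (2 : R) ^+ k by rewrite exprn_gt0.
  apply: (le_trans (norm_le_sqn (sd k) t0 ab)).
  rewrite [leRHS]mulrAC ler_pM2r// mulrDl mul1r exprVn [(b - a) * _]mulrC lerD2r.
  rewrite -ler_pdivlMl// -exprVn -exprMn (_ : 2^-1 * 2^-1 = 4^-1) ?dn//.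
  by rewrite -invfM -natrM.
have mnd k : measurable_fun `[a, b] (fun x => `|d k x|%:E).
  apply/measurable_EFinP; apply: measurableT_comp => //; exact: (sd k).1.
pose S x := (\sum_(0 <= k <oo) `|d k x|%:E)%E.
have iS : leb.-integrable `[a, b] S.
  apply/integrableP; split.
    by apply: ge0_emeasurable_sum => // k _; exact: mnd.
  under eq_integral => x _ do rewrite gee0_abs ?nneseries_ge0//.
  rewrite integral_nneseries//.
  apply: (@le_lt_trans _ _ (\sum_(0 <= k <oo) ((1 + (b - a)) / 2 * 2^-1 ^+ k)%:E)%E).
    apply: lee_nneseries => [k _ _|k _]; first exact: integral_ge0.
    have idk := itv_integrable_norm (sq_integrableW (sd k)).
    by rewrite -(fineK (integrable_fin_num _ idk))// lee_fin; exact: dl1.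
  have E k : (1 + (b - a)) / 2 * 2^-1 ^+ k = (1 + (b - a)) / (2 ^ (k + 1))%:R.
    by rewrite addn1 expnS natrM invfM natrX exprVn mulrA.
  under eq_eseriesr do rewrite E.
  have := @cvg_geometric_eseries_half R (1 + (b - a)) 0.
  rewrite expr0 divr1 => /cvg_lim H.
  by rewrite [X in (X < _)%E](_ : _ = (1 + (b - a))%:E) ?ltry//; exact: H.
have mI : measurable (`[a, b]%classic : set (measurableTypeR R)) by exact: measurable_itv.
have [Z [mZ Z0 SZ]] := integrable_ae mI iS.
pose D : set (measurableTypeR R) := `[a, b] `\` Z.
have mD : measurable D by apply: measurableD => //; exact: measurable_itv.
(* Set to 0 off [D], so that the subsequence converges everywhere. *)
pose v k := (u (phi k)) \_ D.
have cv x : cvgn (v^~ x).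
  rewrite /v; have [xD|xD] := boolP (x \in D); last first.
    by under eq_fun do rewrite patchE (negbTE xD); exact: is_cvg_cst.
  under eq_fun do rewrite patchE xD.
  have Sx : S x \is a fin_num.
    apply: contrapT => nS; move: xD; rewrite inE => -[xI]; apply.
    by apply: SZ => /= /(_ xI).
  have : cvgn (series (fun k => d k x)).
    apply: normed_cvg; apply: nnseries_is_cvg => [k|]; first by rewrite /=.
    have S0 : (0 <= S x)%E by apply: nneseries_ge0 => k _ _; rewrite lee_fin.
    by move: Sx; rewrite (ge0_fin_numE S0).
  have -> : (fun n => u (phi n) x) = (fun n => u (phi 0%N) x + series (fun k => d k x) n).
    by apply/funext => n; rewrite /series/= telescope_sumr// addrC subrK.
  by move=> c; apply: is_cvgD => //; exact: is_cvg_cst.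
pose g x := limn (v^~ x).
have vg x : v^~ x @ \oo --> g x by exact: cv.
have mv k : measurable_fun `[a, b] (v k).
  apply: measurable_funTS; apply/(measurable_restrictT _ _).1 => //.
  by apply: measurable_funS ((su _).1) => //; exact: subDsetl.
have mg : measurable_fun `[a, b] g.
  by apply: (@measurable_fun_cvg _ _ _ _ v) => // x _; exact: vg.
(* Fatou's lemma along the subsequence, for fixed [n]. The integral stays extended real because
   square integrability of [g] is deduced from this bound. *)
have key e : 0 < e -> exists K, forall n, (K <= n)%N ->
   (\int[leb]_(x in `[a, b]) ((u n x - g x) ^+ 2)%:E <= e%:E)%E.
  move=> e0; have [K KP] := cu e e0; exists K => n Kn.
  pose F k x := ((u n x - v k x) ^+ 2)%:E.
  have mF k : measurable_fun `[a, b] (F k).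
    apply/measurable_EFinP; apply: measurable_funX; apply: measurable_funB => //.
    exact: (su n).1.
  have F0 k x : `[a, b]%classic x -> (0 <= F k x)%E by move=> _; rewrite lee_fin sqr_ge0.
  have := fatou leb mI mF F0.
  have -> : (\int[leb]_(x in `[a, b]) limn_einf (F^~ x) =
      \int[leb]_(x in `[a, b]) ((u n x - g x) ^+ 2)%:E)%E.
    apply: eq_integral => x _; apply: (cvg_limn_einf_sup _).1.
    apply: cvg_EFin; first by near=> k.
    have : (fun k => (u n x - v k x) ^+ 2) @ \oo --> (u n x - g x) ^+ 2.
      have w : (fun k => u n x - v k x) @ \oo --> u n x - g x.
        by apply: cvgB; [exact: cvg_cst|exact: vg].
      exact: (cvgM w w).
    exact.
  move=> /le_trans; apply.
  rewrite limn_einf_lim; apply: lime_le; first exact: is_cvg_einfs.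
  near=> k; apply: (@le_trans _ _ (\int[leb]_(x in `[a, b]) F k x)%E).
    by apply: ereal_inf_lbound; exists k => /=.
  have -> : (\int[leb]_(x in `[a, b]) F k x =
      \int[leb]_(x in `[a, b]) ((u n x - u (phi k) x) ^+ 2)%:E)%E.
    apply: ae_eq_integral => //; first exact: mF.
      apply/measurable_EFinP; apply: measurable_funX; apply: measurable_funB.
        exact: (su n).1.
      exact: (su _).1.
    exists Z; split => // x /= xn; apply: contrapT => xZ; apply: xn => xI.
    by rewrite /F /v patchE mem_set.
  rewrite EFin_sqn; last exact: sq_integrableB.
  rewrite lee_fin ltW// KP//.
  by rewrite (@leq_trans k)//; [near: k; exact: nbhs_infty_ge|exact: leq_addl].
have sg : sq g.
  have [K KP] := key 1 ltr01; have := KP K (leqnn K) => H.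
  have sug : sq (fun x => u K x - g x).
    split; first by apply: measurable_funB => //; exact: (su K).1.
    apply/integrableP; split.
      apply/measurable_EFinP; apply: measurable_funX; apply: measurable_funB => //.
      exact: (su K).1.
    apply: le_lt_trans (le_lt_trans H (ltry _)).
    by under eq_integral => x _ do rewrite /= ger0_norm ?sqr_ge0//.
  have := sq_integrableB (su K) sug; apply: sq_integrable_eq => x _; ring.
exists g => // e e0; have [K KP] := key e e0; exists K => n /KP.
by rewrite EFin_sqn ?lee_fin//; exact: sq_integrableB.
Unshelve. all: by end_near. Qed.

End square_integrable.

(** * Modification on null sets *)

Section ae_on_open_interval.
Context {R : realType}.
Local Notation leb := (@lebesgue_measure R).
Variables (a b : R).
Implicit Types (f g h : R -> R).

Lemma measurable_oo_cc f : measurable_fun `]a, b[ f -> measurable_fun `[a, b] f.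
Proof.
by move=> /measurable_fun_itv_obnd_cbndP /measurable_fun_itv_bndo_bndcP.
Qed.

Let toI f g : {ae leb, forall x, x \in `]a, b[ -> f x = g x} ->
  {ae leb, forall x, x \in `[a, b] -> f x = g x}.
Proof.
have pt c : {ae leb, forall x, x != c}.
  exists [set c]; split => //; first exact: lebesgue_measure_set1.
  by move=> x /= /negP; rewrite negbK => /eqP.
move=> fg; have pab := ae_sub2 (fun x p q => conj p q) (pt a) (pt b).
apply: (ae_sub2 _ fg pab) => x E [xa xb]; rewrite itv_in => /andP[ax xb'].
by apply: E; rewrite in_itv/= !lt_neqAle eq_sym xa ax xb xb'.
Qed.

Lemma ae_Rintegral f g : measurable_fun `[a, b] f -> measurable_fun `[a, b] g ->
  {ae leb, forall x, x \in `]a, b[ -> f x = g x} ->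
  \int[leb]_(x in `[a, b]) f x = \int[leb]_(x in `[a, b]) g x.
Proof.
move=> mf mg /toI fg; rewrite /Rintegral; congr fine; apply: ae_eq_integral => //.
- exact/measurable_EFinP.
- exact/measurable_EFinP.
- by apply: ae_sub fg => x E xI; rewrite E.
Qed.

Lemma ae_integrable f g : measurable_fun `[a, b] g ->
  leb.-integrable `[a, b] (EFin \o f) ->
  {ae leb, forall x, x \in `]a, b[ -> f x = g x} ->
  leb.-integrable `[a, b] (EFin \o g).
Proof.
move=> mg /integrableP[/measurable_EFinP mf fi] /toI fg.
apply/integrableP; split; first exact/measurable_EFinP.
apply: le_lt_trans fi; rewrite le_eqVlt; apply/orP; left; apply/eqP.
apply: ae_eq_integral => //.
- by apply/measurable_EFinP; exact: measurableT_comp.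
- by apply/measurable_EFinP; exact: measurableT_comp.
- by apply: ae_sub fg => x E xI; rewrite /= E.
Qed.

Lemma ae_sq_integrable f g : measurable_fun `[a, b] g -> sq_integrable a b f ->
  {ae leb, forall x, x \in `]a, b[ -> f x = g x} -> sq_integrable a b g.
Proof.
move=> mg [mf fi] fg; split => //; apply: ae_integrable fi _.
  exact: measurable_funX.
by apply: ae_sub fg => x E /E ->.
Qed.

(** This is how an explicit derivative is exchanged for the chosen [wderiv], and back. *)
Lemma ae_primitive f g h : measurable_fun `[a, b] h -> primitive a b f g ->
  {ae leb, forall x, x \in `]a, b[ -> g x = h x} -> primitive a b f h.
Proof.
move=> mh [ig fE] gh; split; first exact: ae_integrable gh.
move=> x xI; rewrite fE//; congr (_ + _).
have /andP[ax xb] : a <= x <= b by rewrite -itv_in.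
have sub : `[a, x] `<=` `[a, b] by apply: subset_itvl; rewrite bnd_simp.
rewrite /Rintegral; congr fine; apply: ae_eq_integral => //.
- apply/measurable_EFinP; apply: measurable_funS sub _ => //.
  exact: integrable_measurable ig.
- by apply/measurable_EFinP; apply: measurable_funS sub _.
- by apply: ae_sub (toI gh) => y E /= /sub yI; rewrite E.
Qed.

End ae_on_open_interval.

(** * The Sobolev space and its inner product *)

Section sobolev.
Context {R : realType}.
Local Notation leb := (@lebesgue_measure R).
Variables (a b : R) (mu : probability (measurableTypeR R) R) (rho : R -> R).
Hypothesis ab : a < b.
Hypothesis bp : bounded_perturbation a b mu rho.
Implicit Types (f g h : R -> R).

Local Notation sq := (sq_integrable a b).
Local Notation H1 := (H1 a b mu).
Local Notation ip := (ip a b mu).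
Local Notation ipH1 := (ipH1 a b mu).
Local Notation D := (wderiv a b).
Let I : set (measurableTypeR R) := `[a, b]%classic.
Let crho : {within `[a, b], continuous rho} := bp_continuous bp.
Let mrho : measurable_fun `[a, b] rho. Proof. exact: continuous_measurable. Qed.

Lemma primitive_add c f f' g g' : primitive a b f f' -> primitive a b g g' ->
  primitive a b (fun x => c * f x + g x) (fun x => c * f' x + g' x).
Proof.
move=> [if' fE] [ig' gE]; have icf := itv_integrableZ c if'.
split; first exact: itv_integrableD.
move=> x xI; have /andP[ax xb] : a <= x <= b by rewrite -itv_in.
have sub : `[a, x] `<=` `[a, b] by apply: subset_itvl; rewrite bnd_simp.
have i1 : leb.-integrable `[a, x] (EFin \o f') by apply: integrableS if'.
have i2 : leb.-integrable `[a, x] (EFin \o g') by apply: integrableS ig'.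
rewrite (itv_RintegralD (itv_integrableZ c i1) i2) (itv_RintegralZ _ i1).
by rewrite (fE x xI) (gE x xI); ring.
Qed.

Lemma H1_primitive f : H1 f -> exists2 g, sq g & primitive a b f g.
Proof.
move=> [cf _ [g wg /(L2P ab bp) sg]]; exists g => //.
by apply: weak_deriv_primitive => //; exact: sq_integrableW.
Qed.

Lemma primitive_H1 f g : sq g -> primitive a b f g -> H1 f.
Proof.
move=> sg pfg; have cf := primitive_continuous pfg; split => //.
  by apply/(L2P ab bp); exact: sq_integrable_continuous.
exists g; first by apply: primitive_weak_deriv => //; exact: ltW.
exact/(L2P ab bp).
Qed.

(** The existence of [g] makes the choice by [xget] a weak derivative, and two weak derivatives
    agree almost everywhere. *)
Lemma wderiv_ae f g : is_weak_deriv a b f g ->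
  {ae leb, forall x, x \in `]a, b[ -> g x = D f x}.
Proof.
move=> w; apply: (weak_deriv_ae_eq w).
have : [set g | is_weak_deriv a b f g] (xget (fun=> 0) [set g | is_weak_deriv a b f g]).
  by apply: xgetPex; exists g.
exact.
Qed.

Lemma wderiv_measurable f g : is_weak_deriv a b f g -> measurable_fun `[a, b] (D f).
Proof.
move=> w; have : [set g | is_weak_deriv a b f g] (xget (fun=> 0) [set g | is_weak_deriv a b f g]).
  by apply: xgetPex; exists g.
by move=> [_ [m _ _] _]; exact: measurable_oo_cc.
Qed.

Lemma primitive_wderiv_ae f g : primitive a b f g ->
  {ae leb, forall x, x \in `]a, b[ -> g x = D f x}.
Proof. by move=> p; apply: wderiv_ae; apply: primitive_weak_deriv => //; exact: ltW. Qed.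

Lemma H1_wderiv f : H1 f -> sq (D f) /\ primitive a b f (D f).
Proof.
move=> /H1_primitive[g sg pg].
have w := primitive_weak_deriv (ltW ab) pg.
have m := wderiv_measurable w; have ae := wderiv_ae w.
by split; [exact: ae_sq_integrable ae|exact: ae_primitive ae].
Qed.

Lemma H1_continuous f : H1 f -> {within `[a, b], continuous f}.
Proof. by case. Qed.

Lemma H1_sq f : H1 f -> sq f.
Proof. by move=> /H1_continuous; exact: sq_integrable_continuous. Qed.

Lemma ipE f g : sq f -> sq g -> ip f g = \int[leb]_(x in `[a, b]) (f x * g x * rho x).
Proof. by move=> sf sg; rewrite /Defs.ip (Rintegral_mu bp)//; exact: sq_integrable_mul. Qed.

Lemma sq_rho_integrable f g : sq f -> sq g ->
  leb.-integrable `[a, b] (EFin \o (fun x => f x * g x * rho x)).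
Proof.
move=> sf sg; have [M Mrho] := continuous_bounded crho.
exact: itv_integrableM (sq_integrable_mul sf sg) mrho Mrho.
Qed.

Lemma ip_sym f g : ip f g = ip g f.
Proof. by rewrite /Defs.ip; apply: eq_Rintegral => x _; rewrite mulrC. Qed.

Lemma ip_eq f f' g g' : (forall x, x \in `[a, b] -> f x = f' x) ->
  (forall x, x \in `[a, b] -> g x = g' x) -> ip f g = ip f' g'.
Proof.
by move=> ff gg; rewrite /Defs.ip; apply: eq_Rintegral => x; rewrite inE => xI; rewrite ff ?gg.
Qed.

Lemma ip_lin c f g h : sq f -> sq g -> sq h ->
  ip (fun x => c * f x + g x) h = c * ip f h + ip g h.
Proof.
move=> sf sg sh; have scf := sq_integrableZ c sf.
rewrite ipE//; last exact: sq_integrableD.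
rewrite !ipE// -(itv_RintegralZ _ (sq_rho_integrable sf sh)).
rewrite -(itv_RintegralD (itv_integrableZ c (sq_rho_integrable sf sh)) (sq_rho_integrable sg sh)).
by apply: eq_Rintegral => x _; ring.
Qed.

Lemma ip_ge0 f : 0 <= ip f f.
Proof. by apply: Rintegral_ge0 => x _; rewrite -expr2 sqr_ge0. Qed.

Lemma ip_ae f f' g g' : sq f -> sq f' -> sq g -> sq g' ->
  {ae leb, forall x, x \in `]a, b[ -> f x = f' x} ->
  {ae leb, forall x, x \in `]a, b[ -> g x = g' x} -> ip f g = ip f' g'.
Proof.
move=> sf sf' sg sg' ff gg; rewrite !ipE//; apply: ae_Rintegral.
- by apply: measurable_funM => //; apply: measurable_funM; [exact: sf.1|exact: sg.1].
- by apply: measurable_funM => //; apply: measurable_funM; [exact: sf'.1|exact: sg'.1].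
- by apply: (ae_sub2 _ ff gg) => x e1 e2 xI; rewrite e1 ?e2.
Qed.

(** Frees computations from the chosen [wderiv]: any square integrable derivative gives the same
    inner product. *)
Lemma ipH1E f f' g g' : sq f' -> sq g' -> primitive a b f f' -> primitive a b g g' ->
  ipH1 f g = ip f g + ip f' g'.
Proof.
move=> sf' sg' pf pg; rewrite /Defs.ipH1; congr (_ + _).
have [sDf _] := H1_wderiv (primitive_H1 sf' pf).
have [sDg _] := H1_wderiv (primitive_H1 sg' pg).
apply: ip_ae => //.
- by apply: ae_sub (primitive_wderiv_ae pf) => x E /E.
- by apply: ae_sub (primitive_wderiv_ae pg) => x E /E.
Qed.

Lemma H1_lin c f g : H1 f -> H1 g -> H1 (fun x => c * f x + g x).
Proof.
move=> /H1_wderiv[sf pf] /H1_wderiv[sg pg].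
apply: primitive_H1 (primitive_add c pf pg).
by apply: sq_integrableD => //; exact: sq_integrableZ.
Qed.

Lemma primitive_eq f f' g : (forall x, x \in `[a, b] -> f x = f' x) ->
  primitive a b f g -> primitive a b f' g.
Proof.
move=> ff [ig fE]; split => // x xI; have aI : a \in `[a, b].
  by move: xI; rewrite !in_itv/= lexx => /andP[ax /(le_trans ax)].
by rewrite -!ff//; exact: fE.
Qed.

Lemma H1_eq f f' : (forall x, x \in `[a, b] -> f x = f' x) -> H1 f -> H1 f'.
Proof.
by move=> ff /H1_wderiv[sf /(primitive_eq ff)]; exact: primitive_H1.
Qed.

Lemma H1_cst c : H1 (fun=> c).
Proof.
apply: (@primitive_H1 _ (fun=> 0)); first exact: sq_integrable_cst.
split; first exact: itv_integrable_cst.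
by move=> x _; rewrite Rintegral_cst// mul0r addr0.
Qed.

Lemma H1_sub f g : H1 f -> H1 g -> H1 (f \- g).
Proof.
move=> Hf Hg; apply: H1_eq (H1_lin (-1) Hg Hf) => x _.
by rewrite mulN1r addrC.
Qed.

Lemma ipH1_sym f g : ipH1 f g = ipH1 g f.
Proof. exact: (f_equal2 +%R (ip_sym f g) (ip_sym (D f) (D g))). Qed.

Lemma ipH1_lin c f g h : H1 f -> H1 g -> H1 h ->
  ipH1 (fun x => c * f x + g x) h = c * ipH1 f h + ipH1 g h.
Proof.
move=> Hf Hg Hh; have [sf pf] := H1_wderiv Hf; have [sg pg] := H1_wderiv Hg.
have [sh ph] := H1_wderiv Hh.
have scf := sq_integrableZ c sf.
rewrite (ipH1E (sq_integrableD scf sg) sh (primitive_add c pf pg) ph).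
rewrite (ip_lin _ (H1_sq Hf) (H1_sq Hg) (H1_sq Hh)) (ip_lin _ sf sg sh).
by rewrite /Defs.ipH1 mulrDr addrACA.
Qed.

Lemma ipH1_ge0 f : 0 <= ipH1 f f.
Proof. by rewrite addr_ge0 ?ip_ge0. Qed.

Lemma ip_sqn_ubound : exists2 M, 0 < M & forall f, sq f -> ip f f <= M * sqn a b f.
Proof.
have [M M0 MP] := density_ubound bp; exists M => // f sf; rewrite ipE//.
rewrite -(itv_RintegralZ _ sf.2); apply: le_Rintegral => //.
- exact: sq_rho_integrable.
- exact: itv_integrableZ sf.2.
- by move=> x xI; rewrite -expr2 [leRHS]mulrC ler_wpM2l ?sqr_ge0// MP.
Qed.

Lemma sqn_ip_bound : exists2 M, 0 < M & forall f, sq f -> sqn a b f <= M * ip f f.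
Proof.
have [m m0 mP] := density_lbound ab bp.
exists m^-1; first by rewrite invr_gt0.
move=> f sf; rewrite ler_pdivlMl// ipE// -(itv_RintegralZ _ sf.2).
apply: le_Rintegral => //.
- exact: itv_integrableZ sf.2.
- exact: sq_rho_integrable.
- by move=> x xI; rewrite -expr2 mulrC ler_wpM2l ?sqr_ge0// mP.
Qed.

(** Cauchy-Schwarz against the constant 1, extracted from [norm_le_sqn]. *)
Lemma norm_sq_le_sqn f : sq f ->
  (\int[leb]_(x in `[a, b]) `|f x|) ^+ 2 <= (b - a) * sqn a b f.
Proof.
move=> sf; set X := Rintegral _ _ _.
have X0 : 0 <= X by apply: Rintegral_ge0.
have L0 : 0 < b - a by rewrite subr_gt0.
move: X0; rewrite le_eqVlt => /predU1P[<-|X0].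
  by rewrite expr0n mulr_ge0 ?sqn_ge0// ltW.
(* For this [t] the second term of the bound is [X / 2], which the left-hand side absorbs. *)
have t0 : 0 < (b - a) / X by rewrite divr_gt0.
have := norm_le_sqn sf t0 (ltW ab); rewrite -/X invfM invrK.
rewrite ler_pdivlMr// [X in _ <= _ + X](_ : _ = X); last by rewrite mulrAC mulVf ?mul1r// gt_eqF.
rewrite -lerBlDr (_ : X * 2 - X = X); last by ring.
by rewrite mulrAC ler_pdivlMr// -expr2.
Qed.

End sobolev.
(** * Expansion of a reproducing kernel along an orthogonal basis *)

Section kernel_expansion.
Context {R : realType} (T : Type) (X : set T) (H : set (T -> R)).
Variable (ip : (T -> R) -> (T -> R) -> R).
Hypothesis H_lin : forall (c : R) f g, H f -> H g -> H (fun x => c * f x + g x).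
Hypothesis H0 : H (fun=> 0).
Hypothesis ip_sym : forall f g, ip f g = ip g f.
Hypothesis ip_lin : forall (c : R) f g h, H f -> H g -> H h ->
  ip (fun x => c * f x + g x) h = c * ip f h + ip g h.
Hypothesis ip_ge0 : forall f, 0 <= ip f f.
Implicit Types f g h : T -> R.

Lemma subE f g : f \- g = (fun x => -1 * g x + f x).
Proof. by apply/funext => x; rewrite mulN1r addrC. Qed.

Lemma H_sub f g : H f -> H g -> H (f \- g).
Proof. by move=> Hf Hg; rewrite subE; exact: H_lin. Qed.

Lemma ip_subl f g h : H f -> H g -> H h -> ip (f \- g) h = ip f h - ip g h.
Proof. by move=> Hf Hg Hh; rewrite subE ip_lin// mulN1r addrC. Qed.

Lemma ip_subr f g h : H f -> H g -> H h -> ip h (f \- g) = ip h f - ip h g.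
Proof. by move=> Hf Hg Hh; rewrite ip_sym ip_subl// !(ip_sym h). Qed.

Lemma ip_0l h : H h -> ip (fun=> 0) h = 0.
Proof.
move=> Hh; have := ip_lin 1 H0 H0 Hh.
rewrite (_ : (fun x => 1 * 0 + 0) = (fun=> 0)); last by apply/funext => x; rewrite mulr0 addr0.
by move=> E; lra.
Qed.

Lemma cauchy_schwarz f g : H f -> H g -> ip f g ^+ 2 <= ip f f * ip g g.
Proof.
move=> Hf Hg.
have q t : 0 <= t ^+ 2 * ip f f + 2 * t * ip f g + ip g g.
  have := ip_ge0 (fun x => t * f x + g x).
  have Hq := H_lin t Hf Hg.
  rewrite ip_lin// !(ip_sym _ (fun x => t * f x + g x)) !ip_lin// (ip_sym g f).
  by rewrite (_ : t * _ + _ = t ^+ 2 * ip f f + 2 * t * ip f g + ip g g)//; ring.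
have ff := ip_ge0 f; have gg := ip_ge0 g.
move: ff; rewrite le_eqVlt => /predU1P[f0|f0].
  (* For [ip f f = 0] the quadratic is affine in [t]; if [ip f g] were nonzero, this [t] would give
     it the value -1. *)
  have := q (- (ip g g + 1) / (2 * ip f g)); rewrite -f0 mulr0 add0r mul0r.
  have [->|fg0] := eqVneq (ip f g) 0; first by rewrite expr0n.
  rewrite (_ : 2 * _ * _ = - (ip g g + 1)); last by field.
  by move=> ?; exfalso; lra.
(* The minimizer of the quadratic. *)
have := q (- ip f g / ip f f).
rewrite (_ : _ + ip g g = ip g g - ip f g ^+ 2 / ip f f); last by field; rewrite gt_eqF.
by rewrite subr_ge0 ler_pdivrMr// mulrC.
Qed.

Variable K : T -> T -> R.
Hypothesis KP : reproducing_kernel X H ip K.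

Lemma kernel_diag x : X x -> ip (K x) (K x) = K x x.
Proof. by move=> Xx; have [HK rep] := KP Xx; exact: rep. Qed.

Lemma kernel_eval x f : X x -> H f -> f x ^+ 2 <= K x x * ip f f.
Proof.
move=> Xx Hf; have [HK rep] := KP Xx.
by rewrite -{1}(rep f Hf) -(kernel_diag Xx) mulrC; exact: cauchy_schwarz.
Qed.

Lemma kernel_norm_eval x f : X x -> H f ->
  `|f x| <= Num.sqrt (K x x) * Num.sqrt (ip f f).
Proof.
move=> Xx Hf; have K0 : 0 <= K x x by rewrite -kernel_diag.
by rewrite -sqrtrM// -sqrtr_sqr ler_wsqrtr// kernel_eval.
Qed.

(** Pairing [K x] with [K' y] and reading the result with either kernel gives [K x y = K' y x]; [K']
    is symmetric for the same reason. *)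
Lemma kernel_unique K' : reproducing_kernel X H ip K' ->
  forall x y, X x -> X y -> K x y = K' x y.
Proof.
move=> KP' x y Xx Xy; have [Hx rx] := KP Xx; have [Hy ry] := KP' y Xy.
have [Hx' rx'] := KP' x Xx.
have [Hyy ryy] := KP Xy.
by rewrite -(ry _ Hx) ip_sym rx// -(rx' _ Hy) ip_sym ry.
Qed.

Variables (phi : nat -> T -> R) (alpha : nat -> R).
Hypothesis Hphi : forall m, H (phi m).
Hypothesis alpha_gt0 : forall m, 0 < alpha m.
Hypothesis phi_orth : forall m n, ip (phi m) (phi n) = (m == n)%:R / alpha m.

Definition ksum n x y := \sum_(m < n) alpha m * phi m x * phi m y.
(** The functions [sqrt (alpha m) * phi m] being orthonormal, [ksum n x] is the projection of [K x]
    on the first [n] of them, and [krem n] is the kernel of their orthogonal complement. *)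
Definition krem n x y := K x y - ksum n x y.

Lemma ksumS n x : ksum n.+1 x = (fun y => (alpha n * phi n x) * phi n y + ksum n x y).
Proof. by apply/funext => y; rewrite /ksum big_ord_recr/= addrC. Qed.

Lemma H_ksum n x : H (ksum n x).
Proof.
elim: n => [|n IH]; last by rewrite ksumS; exact: H_lin.
by rewrite (_ : ksum 0 x = (fun=> 0))//; apply/funext => y; rewrite /ksum big_ord0.
Qed.

Lemma ip_ksum n x f : H f ->
  ip (ksum n x) f = \sum_(m < n) alpha m * phi m x * ip (phi m) f.
Proof.
move=> Hf; elim: n => [|n IH]; last first.
  rewrite ksumS ip_lin//; last exact: H_ksum.
  by rewrite IH big_ord_recr/= addrC.
rewrite big_ord0 (_ : ksum 0 x = (fun=> 0)) ?ip_0l//.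
by apply/funext => y; rewrite /ksum big_ord0.
Qed.

Lemma H_krem n x : X x -> H (krem n x).
Proof.
move=> Xx; have [HK _] := KP Xx; have := H_sub HK (H_ksum n x).
by [].
Qed.

Lemma ip_ksum_phi n x m : ip (ksum n x) (phi m) = if (m < n)%N then phi m x else 0.
Proof.
rewrite ip_ksum//; case: ifPn => mn.
  rewrite (bigD1 (Ordinal mn))//= phi_orth eqxx mul1r big1.
    by rewrite addr0 mulrAC mulfV ?mul1r// gt_eqF.
  by move=> i /eqP im; rewrite phi_orth; case: eqP => [E|_]; [case: im; exact: val_inj|rewrite mul0r mulr0].
rewrite big1// => i _; rewrite phi_orth; case: eqP => [E|_]; last by rewrite mul0r mulr0.
by rewrite -E ltn_ord in mn.
Qed.

Lemma ip_krem_phi n x m : X x -> (m < n)%N -> ip (krem n x) (phi m) = 0.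
Proof.
move=> Xx mn; have [HK rep] := KP Xx.
rewrite (_ : krem n x = K x \- ksum n x)// ip_subl//; last exact: H_ksum.
by rewrite ip_sym rep// ip_ksum_phi mn subrr.
Qed.

(** The remainder at [x] is orthogonal to [phi m] for [m < n], hence to [ksum n y], so it may be
    paired with [K y] instead. *)
Lemma ip_krem n x y : X x -> X y -> ip (krem n x) (krem n y) = krem n x y.
Proof.
move=> Xx Xy; have [HKy repy] := KP Xy; have Hx := H_krem n Xx.
rewrite (_ : krem n y = K y \- ksum n y)// ip_subr//; last exact: H_ksum.
rewrite repy// ip_sym ip_ksum// big1 ?subr0// => i _.
by rewrite ip_sym ip_krem_phi ?mulr0.
Qed.

Lemma krem_diag_ge0 n x : X x -> 0 <= krem n x x.
Proof. by move=> Xx; rewrite -ip_krem. Qed.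

Lemma kremS n x y : krem n.+1 x y = krem n x y - alpha n * phi n x * phi n y.
Proof. by rewrite /krem ksumS; ring. Qed.

Lemma krem_diag_nincr x m n : (m <= n)%N -> krem n x x <= krem m x x.
Proof.
elim: n => [|n IH]; first by rewrite leqn0 => /eqP ->.
rewrite leq_eqVlt => /predU1P[->//|/IH]; apply: le_trans.
rewrite kremS gerBl -mulrA; apply: mulr_ge0; first exact: ltW.
by rewrite -expr2 sqr_ge0.
Qed.

Lemma krem_offdiag n x y e : X x -> X y -> 0 <= e ->
  krem n x x <= e -> krem n y y <= e -> `|krem n x y| <= e.
Proof.
move=> Xx Xy e0 xe ye; rewrite -ler_sqr ?nnegrE// real_normK ?num_real//.
have := cauchy_schwarz (H_krem n Xx) (H_krem n Xy); rewrite !ip_krem//.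
move=> /le_trans; apply; rewrite expr2.
by apply: ler_pM => //; exact: krem_diag_ge0.
Qed.

Hypothesis complete : forall u : nat -> T -> R, (forall n, H (u n)) ->
  (forall e : R, 0 < e -> exists N : nat, forall m n : nat,
     (N <= m)%N -> (N <= n)%N ->
     Num.sqrt (ip (u m \- u n) (u m \- u n)) < e) ->
  exists2 f, H f & (fun n => Num.sqrt (ip (u n \- f) (u n \- f))) @ \oo --> 0.

Hypothesis total : forall f, H f -> (forall m, ip f (phi m) = 0) ->
  forall x, X x -> f x = 0.

(** Pythagoras for nested projections; [K x x] cancels in the difference of the remainders. *)
Lemma ksum_dist x m n : X x -> (m <= n)%N ->
  ip (ksum m x \- ksum n x) (ksum m x \- ksum n x) = krem m x x - krem n x x.
Proof.
move=> Xx mn; have [HK rep] := KP Xx.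
have Hm := H_ksum m x; have Hn := H_ksum n x.
have E1 k l : (k <= l)%N -> ip (ksum l x) (ksum k x) = ksum k x x.
  move=> kl; rewrite ip_sym ip_ksum; last exact: H_ksum.
  apply: eq_bigr => i _; rewrite ip_sym ip_ksum_phi ifT//.
  exact: leq_trans (ltn_ord i) kl.
rewrite ip_subl ?ip_subr//; last exact: H_sub.
rewrite (ip_sym (ksum m x) (ksum n x)) !E1// /krem; ring.
Qed.

(** The diagonal remainders decrease and are nonnegative, so by [ksum_dist] the partial sums are
    Cauchy and have a limit [f]. Then [K x - f] is orthogonal to every [phi m], hence zero on [X],
    and evaluation at [x] transfers the norm convergence. *)
Lemma krem_diag_cvg0 x e : X x -> 0 < e -> exists n, krem n x x <= e.
Proof.
move=> Xx e0; have [HK rep] := KP Xx.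
have K0 : 0 <= K x x by rewrite -kernel_diag.
have d0 n : 0 <= krem n x x by exact: krem_diag_ge0.
have cau t : 0 < t -> exists N, forall m n, (N <= m)%N -> (N <= n)%N ->
    `|krem m x x - krem n x x| < t.
  move=> t0; pose S := range (fun n => krem n x x).
  have hS : has_inf S by split; [exists (krem 0 x x), 0%N|exists 0 => _ [n _ <-]].
  have [_ [N _ <-] HN] := inf_adherent t0 hS.
  have lowS n : inf S <= krem n x x.
    by apply: ge_inf; [exists 0 => _ [k _ <-]|exists n].
  exists N => m n Nm Nn; rewrite ltr_norml.
  have := krem_diag_nincr x Nm; have := krem_diag_nincr x Nn.
  have := lowS m; have := lowS n => *; apply/andP; split; lra.
have [f Hf cf] : exists2 f, H f &
    (fun n => Num.sqrt (ip (ksum n x \- f) (ksum n x \- f))) @ \oo --> 0.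
  apply: complete => [n|t t0]; first exact: H_ksum.
  have [N NP] := cau (t ^+ 2) (exprn_gt0 2 t0); exists N => m n Nm Nn.
  rewrite -[ltRHS]gtr0_norm// -sqrtr_sqr ltr_sqrt ?exprn_gt0//.
  have [mn|/ltnW nm] := leqP m n.
    by rewrite ksum_dist// (le_lt_trans (ler_norm _))// NP.
  rewrite (_ : ip _ _ = ip (ksum n x \- ksum m x) (ksum n x \- ksum m x)).
    by rewrite ksum_dist// (le_lt_trans (ler_norm _))// NP.
  have Hm := H_ksum m x; have Hn := H_ksum n x.
  by rewrite !ip_subl ?ip_subr//; [ring|exact: H_sub..].
have small t : 0 < t -> \forall n \near \oo, Num.sqrt (ip (ksum n x \- f) (ksum n x \- f)) < t.
  move=> t0; move/cvgrPdist_lt : cf => /(_ t t0); apply: filterS => n.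
  by rewrite sub0r normrN ger0_norm ?sqrtr_ge0.
have fK : f x = K x x.
  apply/esym/eqP; rewrite -subr_eq0; apply/eqP.
  apply: (@total (K x \- f)) => //; first exact: H_sub.
  move=> m; apply/eqP; rewrite -normr_le0; apply/ler_addgt0Pl => t t0; rewrite addr0.
  pose c := Num.sqrt (ip (phi m) (phi m)) + 1.
  have c0 : 0 < c by rewrite ltr_wpDl ?sqrtr_ge0.
  near \oo => n.
  have mn : (m < n)%N by near: n; exact: nbhs_infty_gt.
  have Hs := H_ksum n x.
  (* For [n > m], [K x] and [ksum n x] have the same product with [phi m], namely [phi m x]. *)
  have -> : ip (K x \- f) (phi m) = ip (ksum n x \- f) (phi m).
    rewrite !ip_subl// ip_sym rep// ip_ksum_phi mn//.
  have := cauchy_schwarz (H_sub Hs Hf) (Hphi m).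
  rewrite -ler_sqrt; last by rewrite mulr_ge0.
  rewrite sqrtr_sqr sqrtrM// => /le_trans; apply.
  have st : Num.sqrt (ip (ksum n x \- f) (ksum n x \- f)) < t / c.
    by near: n; apply: small; rewrite divr_gt0.
  apply: (@le_trans _ _ (t / c * c)); last by rewrite divfK// gt_eqF.
  by apply: ler_pM; rewrite ?sqrtr_ge0 ?ltW// /c ltrDl.
pose c := Num.sqrt (K x x) + 1.
have c0 : 0 < c by rewrite ltr_wpDl ?sqrtr_ge0.
near \oo => n; exists n.
have -> : krem n x x = - ((ksum n x \- f) x) by rewrite /krem -fK /=; ring.
rewrite (le_trans (ler_norm _))// normrN.
apply: (le_trans (kernel_norm_eval Xx (H_sub (H_ksum n x) Hf))).
have st : Num.sqrt (ip (ksum n x \- f) (ksum n x \- f)) < e / c.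
  by near: n; apply: small; rewrite divr_gt0.
apply: (@le_trans _ _ (c * (e / c))); last by rewrite mulrC divfK// gt_eqF.
by apply: ler_pM; rewrite ?sqrtr_ge0 ?ltW// /c ltrDl.
Unshelve. all: by end_near. Qed.

End kernel_expansion.

(** * Uniform convergence *)

Section dini.
Context {R : realType}.

(* Dini's argument on the diagonal; off it, the remainder is again a kernel. *)
Lemma kernel_expansion_uniform (X : set R) (K : R -> R -> R)
    (phi : nat -> R -> R) (alpha : nat -> R) :
  compact X ->
  (forall n, {within X, continuous (fun x => krem K phi alpha n x x)}) ->
  (forall m n x, (m <= n)%N -> krem K phi alpha n x x <= krem K phi alpha m x x) ->
  (forall x e, X x -> 0 < e -> exists n, krem K phi alpha n x x <= e) ->
  (forall n x y e, X x -> X y -> 0 <= e -> krem K phi alpha n x x <= e ->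
     krem K phi alpha n y y <= e -> `|krem K phi alpha n x y| <= e) ->
  {uniform X `*` X,
     (fun (n : nat) (z : R * R) => \sum_(m < n) alpha m * phi m z.1 * phi m z.2)
       @ \oo --> (fun z : R * R => K z.1 z.2)}.
Proof.
move=> cX cr dr c0 off P /uniform_nbhs[E [entE EP]].
have [e /= e0 eE] : exists2 e : R, 0 < e & [set z | ball z.1 e z.2] `<=` E.
  by move: entE; rewrite -entourage_ballE => -[e /= e0 eE]; exists e.
(* At each [x] some remainder is below [e / 4], its continuity costs another [e / 4] nearby, and
   monotonicity covers all later indices; compactness makes the index uniform. *)
have key : \forall n \near \oo, X `<=` (fun x => krem K phi alpha n x x <= e / 2).
  move/compact_near_coveringP : cX => /near_covering_withinP; apply => x Xx.
  have [N xN] := c0 x (e / 4) Xx (divr_gt0 e0 (ltr0Sn _ _)).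
  have := (subspace_continuousP _ _).1 (cr N) x Xx.
  move=> /cvgrPdist_lt /(_ (e / 4) (divr_gt0 e0 (ltr0Sn _ _))).
  rewrite near_withinE => nx.
  near=> x' n => Xx'.
  have nN : (N <= n)%N by near: n; exact: nbhs_infty_ge.
  apply: (le_trans (dr _ _ _ nN)).
  have : X x' -> `|krem K phi alpha N x x - krem K phi alpha N x' x'| < e / 4 by near: x'.
  by move=> /(_ Xx'); rewrite ltr_norml => /andP[h1 h2]; lra.
apply: filterS key => n Xn; apply: EP => -[x y] /= [Xx Xy]; apply: eE => /=.
rewrite /ball/= -/(ksum phi alpha n x y) -/(krem K phi alpha n x y).
apply: (@le_lt_trans _ _ (e / 2)); last lra.
by apply: off => //; [lra|exact: Xn..].
Unshelve. all: by end_near. Qed.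

End dini.

(** * Completeness of the Sobolev space *)

Section sobolev_complete.
Context {R : realType}.
Local Notation leb := (@lebesgue_measure R).
Variables (a b : R) (mu : probability (measurableTypeR R) R) (rho : R -> R).
Hypothesis ab : a < b.
Hypothesis bp : bounded_perturbation a b mu rho.
Implicit Types (f g h : R -> R).

Local Notation sq := (sq_integrable a b).
Local Notation H1 := (H1 a b mu).
Local Notation ip := (ip a b mu).
Local Notation ipH1 := (ipH1 a b mu).
Local Notation D := (wderiv a b).

Lemma cauchy_cvg_real (u : nat -> R) :
  (forall e, 0 < e -> exists N, forall m n, (N <= m)%N -> (N <= n)%N -> `|u m - u n| < e) ->
  exists l : R, u @ \oo --> l.
Proof.
move=> cu; apply/cvg_ex; apply/cauchy_cvgP; apply/cauchy_ballP => e e0.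
have [N NP] := cu e e0.
pose A : set R := [set u n | n in [set n | (N <= n)%N]].
have nA : \forall n \near \oo, A (u n) by exists N => // n Nn; exists n.
exists (A, A); first by split.
by move=> [x y] /= [[m Nm <-] [n Nn <-]]; exact: NP.
Qed.

Lemma sqrD_le (x y z : R) : y ^+ 2 <= z -> (x + y) ^+ 2 <= 2 * x ^+ 2 + 2 * z.
Proof. by move=> yz; have := sqr_ge0 (x - y); rewrite sqrrB sqrrD; nra. Qed.

(** The density is bounded below, so [f] vanishes almost everywhere, hence everywhere by
    continuity. *)
Lemma continuous_ip_eq0 f : {within `[a, b], continuous f} -> ip f f = 0 ->
  forall x, x \in `[a, b] -> f x = 0.
Proof.
move=> cf f0; have sf := sq_integrable_continuous cf.
have [M M0 HM] := sqn_ip_bound ab bp.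
have n0 : sqn a b f = 0.
  by apply/eqP; rewrite eq_le sqn_ge0 andbT; have := HM f sf; rewrite f0 mulr0.
have := EFin_sqn sf; rewrite n0 => E.
have mf2 : measurable_fun `[a, b] (fun x => (f x ^+ 2)%:E).
  by apply/measurable_EFinP; apply: measurable_funX; exact: sf.1.
have mI : measurable (`[a, b]%classic : set (measurableTypeR R)) by exact: measurable_itv.
have ae := (ae_eq_integral_abs leb mI mf2).1.
apply: (@ae_eq_continuous _ a b f (fun=> 0) ab cf); first exact: within_cst.
apply: ae_sub (ae _); last first.
  by rewrite -[RHS]E; apply: eq_integral => x _; rewrite gee0_abs// lee_fin sqr_ge0.
move=> x /= H xI; have xI' : `[a, b]%classic x by exact: subset_itv_oo_cc.
by have [/eqP] := H xI'; rewrite sqrf_eq0 => /eqP.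
Qed.

(** The derivatives converge in L2 to some [g] and the values at [a] to some [l]; the limit is [l]
    plus the indefinite integral of [g]. The bound on evaluation at [a] will be supplied by a
    reproducing kernel. *)
Lemma H1_complete (u : nat -> R -> R) :
  (exists c, forall f, H1 f -> `|f a| <= c * Num.sqrt (ipH1 f f)) ->
  (forall n, H1 (u n)) ->
  (forall e : R, 0 < e -> exists N : nat, forall m n : nat,
     (N <= m)%N -> (N <= n)%N ->
     Num.sqrt (ipH1 (u m \- u n) (u m \- u n)) < e) ->
  exists2 f, H1 f & (fun n => Num.sqrt (ipH1 (u n \- f) (u n \- f))) @ \oo --> 0.
Proof.
move=> [c0 cP0] Hu cu.
have [c cpos cP] : exists2 c, 0 < c & forall f, H1 f -> `|f a| <= c * Num.sqrt (ipH1 f f).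
  exists (`|c0| + 1); first by rewrite ltr_wpDl.
  move=> f /cP0 /le_trans; apply; rewrite ler_wpM2r ?sqrtr_ge0//.
  by rewrite (le_trans (ler_norm _))// lerDl.
have [m m0 mP] := sqn_ip_bound ab bp.
have [M M0 MP] := ip_sqn_ubound bp.
have sD n : sq (D (u n)) := (H1_wderiv ab bp (Hu n)).1.
have pD n : primitive a b (u n) (D (u n)) := (H1_wderiv ab bp (Hu n)).2.
have sub_primitive f f' g g' : primitive a b f f' -> primitive a b g g' ->
    primitive a b (f \- g) (fun x => f' x - g' x).
  move=> pf pg; have [i E] := primitive_add (-1) pg pf.
  split; first by apply: itv_integrable_eq i => x _; rewrite mulN1r addrC.
  move=> x xI; have /= := E x xI; rewrite !mulN1r ![- g _ + _]addrC => ->.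
  by congr (_ + _); apply: eq_Rintegral => y _; rewrite mulN1r addrC.
have eqip f g f' g' : sq f' -> sq g' -> primitive a b f f' -> primitive a b g g' ->
    ipH1 (f \- g) (f \- g) = ip (f \- g) (f \- g) + ip (fun x => f' x - g' x) (fun x => f' x - g' x).
  move=> sf sg pf pg; have p := sub_primitive _ _ _ _ pf pg.
  by have s := sq_integrableB sf sg; rewrite (ipH1E ab bp s s p p).
have [g sg gP] : exists2 g, sq g & forall e, 0 < e -> exists N, forall n, (N <= n)%N ->
    sqn a b (fun x => D (u n) x - g x) <= e.
  apply: sq_complete => //; first exact: ltW.
  move=> e e0; have em0 : 0 < e / m by rewrite divr_gt0.
  have sem0 : 0 < Num.sqrt (e / m) by rewrite sqrtr_gt0.
  have [N NP] := cu _ sem0.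
  exists N => k l Nk Nl; have := NP k l Nk Nl; rewrite ltr_sqrt// => lt.
  apply: (le_lt_trans (mP _ (sq_integrableB (sD k) (sD l)))).
  rewrite mulrC -ltr_pdivlMr//; apply: le_lt_trans lt.
  by rewrite (eqip _ _ _ _ (sD k) (sD l) (pD k) (pD l)) lerDr ip_ge0.
have [l ul] : exists l : R, (fun n => u n a) @ \oo --> l.
  apply: cauchy_cvg_real => e e0; have [N NP] := cu (e / c) (divr_gt0 e0 cpos).
  exists N => i j Ni Nj; have := cP _ (H1_sub ab bp (Hu i) (Hu j)).
  move=> /le_lt_trans; apply; rewrite mulrC -ltr_pdivlMr//; exact: NP.
pose f x := l + \int[leb]_(t in `[a, x]) g t.
have pf : primitive a b f g.
  split; first exact: sq_integrableW.
  by move=> x _; rewrite /f set_itv1 Rintegral_set1 addr0.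
have Hf : H1 f by exact: (primitive_H1 ab bp sg pf).
exists f => //.
have L0 : 0 < b - a by rewrite subr_gt0.
(* Pointwise, [u n - f] is its value at [a] plus the integral of the error on the derivative, which
   [norm_sq_le_sqn] controls. *)
have est n : ipH1 (u n \- f) (u n \- f) <=
   M * ((b - a) * (2 * (u n a - l) ^+ 2 + 2 * ((b - a) * sqn a b (fun x => D (u n) x - g x)))
        + sqn a b (fun x => D (u n) x - g x)).
  have sd := sq_integrableB (sD n) sg.
  have p := sub_primitive _ _ _ _ (pD n) pf.
  have sdf := sq_integrable_continuous (primitive_continuous p).
  rewrite (eqip _ _ _ _ (sD n) sg (pD n) pf).
  apply: (le_trans (lerD (MP _ sdf) (MP _ sd))); rewrite -mulrDr ler_pM2l// lerD2r.
  set B := (X in _ <= _ * X).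
  have bnd x : x \in `[a, b] -> (u n \- f) x ^+ 2 <= B.
    move=> xI; rewrite (p.2 x xI) /= {1}/f set_itv1 Rintegral_set1 addr0.
    set X := u n a - l; set Y := Rintegral _ _ _.
    have YB : Y ^+ 2 <= (b - a) * sqn a b (fun x => D (u n) x - g x).
      apply: le_trans (norm_sq_le_sqn ab sd).
      have /andP[ax xb] : a <= x <= b by rewrite -itv_in.
      have sub : `[a, x] `<=` `[a, b] by apply: subset_itvl; rewrite bnd_simp.
      have id := sq_integrableW sd.
      have ix : leb.-integrable `[a, x] (EFin \o (fun x => D (u n) x - g x)).
        by apply: integrableS id.
      rewrite -real_normK ?num_real// ler_sqr ?nnegrE//; last exact: Rintegral_ge0.
      apply: (le_trans (le_normr_Rintegral _ ix)) => //.
      have := Rintegral_itvB (itv_integrable_norm id) (x := x).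
      rewrite !bnd_simp => /(_ ax xb) E; rewrite -subr_ge0 E.
      exact: Rintegral_ge0.
    exact: sqrD_le.
  have iB := itv_integrable_cst a b B.
  apply: (@le_trans _ _ (\int[leb]_(x in `[a, b]) B)).
    by apply: le_Rintegral => //; exact: sdf.2.
  rewrite Rintegral_cst// mulrC ler_wpM2r//.
    have aI : a \in `[a, b] by rewrite in_itv/= lexx ltW.
    by apply: le_trans (bnd a aI); exact: sqr_ge0.
  rewrite [X in fine X](_ : _ = (b - a)%:E)//.
  by apply: (etrans (@lebesgue_measure_itv R `[a, b])); rewrite /= lte_fin ab EFinB.
have ip_small e : 0 < e -> \forall n \near \oo, ipH1 (u n \- f) (u n \- f) < e.
  (* With both errors at most [d] the estimate is [M * (2 * L + 2 * L * L + 1) * d]; the final 2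
     instead of 1 makes it strictly less than [e]. *)
  move=> e0; pose L := b - a; pose d := e / (M * (2 * L + 2 * L * L + 2)).
  have k0 : 0 < M * (2 * L + 2 * L * L + 2).
    by rewrite mulr_gt0// addr_gt0// addr_gt0// !mulr_gt0.
  have d0 : 0 < d by rewrite divr_gt0.
  have [N NP] := gP d d0.
  near=> n.
  apply: (le_lt_trans (est n)).
  have h1 : sqn a b (fun x => D (u n) x - g x) <= d.
    by apply: NP; near: n; exact: nbhs_infty_ge.
  have h2 : (u n a - l) ^+ 2 <= d.
    have : `|l - u n a| < Num.sqrt d.
      near: n; move/cvgrPdist_lt : ul; apply; rewrite sqrtr_gt0//.
    rewrite distrC => /ltW h; rewrite -(sqr_sqrtr (ltW d0)) -real_normK ?num_real//.
    by rewrite ler_sqr ?nnegrE ?sqrtr_ge0.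
  apply: (@le_lt_trans _ _ (M * (L * (2 * d + 2 * (L * d)) + d))).
    rewrite ler_pM2l// lerD// ler_pM2l// lerD// ler_pM2l//.
    by rewrite ler_pM2l.
  rewrite (_ : e = M * (2 * L + 2 * L * L + 2) * d); last first.
    by rewrite /d mulrCA divff ?mulr1// gt_eqF.
  rewrite -mulrA ltr_pM2l//; nra.
apply/cvgrPdist_lt => e e0; have := ip_small (e ^+ 2) (exprn_gt0 2 e0).
apply: filterS => n lt; rewrite sub0r normrN ger0_norm ?sqrtr_ge0//.
by rewrite -[ltRHS]gtr0_norm// -sqrtr_sqr ltr_sqrt// exprn_gt0.
Unshelve. all: by end_near. Qed.

End sobolev_complete.
(** * The homogeneous equation and its Green function *)

Section primitive_pieces.
Context {R : realType}.
Local Notation leb := (@lebesgue_measure R).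
Implicit Types (a b c d x : R) (f g h : R -> R).

Lemma itv_integrable_sub a b c d f : a <= c -> d <= b ->
  leb.-integrable `[a, b] (EFin \o f) -> leb.-integrable `[c, d] (EFin \o f).
Proof.
move=> ac db; apply: integrableS => // x /=; rewrite !in_itv/= => /andP[cx xd].
by rewrite (le_trans ac cx) (le_trans xd db).
Qed.

Lemma Rintegral_chasles a c b f : a <= c -> c <= b ->
  leb.-integrable `[a, b] (EFin \o f) ->
  \int[leb]_(x in `[a, b]) f x =
  \int[leb]_(x in `[a, c]) f x + \int[leb]_(x in `[c, b]) f x.
Proof.
move=> ac cb fi; have := Rintegral_itvB fi (x := c).
rewrite !bnd_simp => /(_ ac cb) E; apply/eqP; rewrite addrC -subr_eq E.
rewrite Rintegral_itv_obnd_cbnd//; apply: integrableS fi => // x /=.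
by rewrite !in_itv/= => /andP[/ltW cx ->]; rewrite (le_trans ac cx).
Qed.

Lemma primitive_sub a b c d f g : a <= c -> d <= b -> primitive a b f g ->
  primitive c d f g.
Proof.
move=> ac db [ig fE]; split; first exact: itv_integrable_sub ig.
move=> x; rewrite itv_in => /andP[cx xd]; have xb := le_trans xd db.
rewrite (fE x) ?(fE c) ?itv_in; [|by rewrite ac (le_trans cx xb)|by rewrite (le_trans ac cx) xb].
rewrite -addrA; congr (_ + _); apply: Rintegral_chasles => //.
exact: itv_integrable_sub ig.
Qed.

Lemma primitive_glue a c b f g : a <= c -> c <= b ->
  primitive a c f g -> primitive c b f g -> primitive a b f g.
Proof.
move=> ac cb [i1 E1] [i2 E2].
have i2' : leb.-integrable `]c, b] (EFin \o g).
  by apply: integrableS i2 => // x /=; rewrite !in_itv/= => /andP[/ltW -> ->].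
have ig : leb.-integrable `[a, b] (EFin \o g).
  apply/integrable_patch; first exact: measurable_itv.
  have iu : leb.-integrable setT (EFin \o (fun x => (g \_ `[a, c]) x + (g \_ `]c, b]) x)).
    apply: integrable_addr => //.
      exact: (integrable_patch _ (measurable_itv _)).1 i1.
    exact: (integrable_patch _ (measurable_itv _)).1 i2'.
  apply: eq_integrable iu => // x _; congr EFin.
  rewrite !patchE !mem_setE !in_itv/=.
  have [xc|cx] := leP x c; rewrite ?andbF ?andbT ?addr0 ?(le_trans xc cb) ?andbT//=.
  by rewrite (le_trans ac (ltW cx)) add0r.
split => // x; rewrite itv_in => /andP[ax xb]; have [xc|/ltW cx] := leP x c.
  by apply: E1; rewrite itv_in ax.
have cI : c \in `[a, c] by rewrite itv_in ac lexx.
rewrite (E2 x) ?itv_in ?cx// (E1 c cI) -addrA; congr (_ + _).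
by apply/esym/Rintegral_chasles => //; exact: itv_integrable_sub ig.
Qed.

Lemma primitive_is_derive a b f g : {within `[a, b], continuous g} ->
  primitive a b f g -> forall x, x \in `]a, b[ -> is_derive x 1 f (g x).
Proof.
move=> cg [ig fE] x xab; have /andP[ax xb] : a < x < b by rewrite in_itv in xab.
have gx : {for x, continuous g}.
  have ab := lt_trans ax xb.
  by have [+ _ _] := (continuous_within_itvP g ab).1 cg; exact.
have [d1 d2] := continuous_FTC1_closed xb ig ax gx.
have dF : is_derive x 1 (fun x => f a + \int[leb]_(t in `[a, x]) g t) (g x).
  apply: (is_derive_val (is_derive_add (is_derive_cst (f a) x 1) (DeriveDef d1 _))).
    by rewrite -derive1E d2.
  by rewrite add0r.
apply: is_derive_near dF; near=> y; rewrite [RHS]fE// itv_in.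
by apply/andP; split; apply/ltW; near: y; [exact: lt_nbhsr|exact: lt_nbhsl].
Unshelve. all: by end_near. Qed.

Lemma Rintegral_bounded_cvg a b (F : nat -> R -> R) f B :
  (forall n, measurable_fun `[a, b] (F n)) ->
  (forall n x, x \in `[a, b] -> `|F n x| <= B) ->
  (forall x, x \in `[a, b] -> F^~ x @ \oo --> f x) ->
  (fun n => \int[leb]_(x in `[a, b]) F n x) @ \oo --> \int[leb]_(x in `[a, b]) f x.
Proof.
move=> mF FB Ff.
have mf : measurable_fun `[a, b] f.
  by apply: (@measurable_fun_cvg _ _ _ _ F) => // x xI; exact: Ff.
have mI : measurable (`[a, b]%classic : set (measurableTypeR R)) by exact: measurable_itv.
have mF' n : measurable_fun (`[a, b]%classic : set (measurableTypeR R)) (EFin \o F n).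
  by apply: measurableT_comp => //; exact: mF.
have mf' : measurable_fun (`[a, b]%classic : set (measurableTypeR R)) (EFin \o f).
  by apply: measurableT_comp.
have h1 : {ae leb, forall x : measurableTypeR R, `[a, b]%classic x ->
    (EFin \o F n) x @[n --> \oo] --> (EFin \o f) x}.
  by apply: aeW => x xI; apply: cvg_EFin; [exact: nearW|exact: Ff].
have h2 : {ae leb, forall (x : measurableTypeR R) n, `[a, b]%classic x ->
    (`|(EFin \o F n) x| <= (EFin \o cst B) x)%E}.
  by apply: aeW => x n xI; rewrite lee_fin; exact: FB.
have [fi _ cv] := dominated_convergence mI mF' mf' h1 (itv_integrable_cst a b B) h2.
apply: fine_cvg; rewrite /Rintegral fineK//; exact: integrable_fin_num fi.
Qed.

End primitive_pieces.

(** * Picard iteration for the solution with zero flux at the left endpoint *)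

Section fundamental_solutions.
Context {R : realType}.
Local Notation leb := (@lebesgue_measure R).
Variables (a b : R) (mu : probability (measurableTypeR R) R) (rho : R -> R).
Hypothesis ab : a < b.
Hypothesis bp : bounded_perturbation a b mu rho.
Implicit Types (f g h : R -> R).

Let crho : {within `[a, b], continuous rho} := bp_continuous bp.
Let rho_gt0 x : x \in `[a, b] -> 0 < rho x. Proof. exact: bp_gt0 bp x. Qed.
Let sub x : x \in `[a, b] -> `[a, x] `<=` `[a, b].
Proof. by rewrite itv_in => /andP[_ xb]; apply: subset_itvl; rewrite bnd_simp. Qed.

(** [inner f] is the flux, and [step] the Picard map of the system with value 1 and flux 0 at
    [a]. *)
Let inner f t := \int[leb]_(s in `[a, t]) (rho s * f s).
Let step f x := 1 + \int[leb]_(t in `[a, x]) ((rho t)^-1 * inner f t).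

Let cinv : {within `[a, b], continuous (fun t => (rho t)^-1)}.
Proof. by apply: within_invr => // x xI; rewrite gt_eqF// rho_gt0. Qed.

Let inner_primitive f : {within `[a, b], continuous f} ->
  primitive a b (inner f) (fun s => rho s * f s).
Proof.
move=> cf; split; first by apply: continuous_integrable; exact: within_mulr.
by move=> x _; rewrite {2}/inner set_itv1 Rintegral_set1 add0r.
Qed.

Let cslope f : {within `[a, b], continuous f} ->
  {within `[a, b], continuous (fun t => (rho t)^-1 * inner f t)}.
Proof. by move=> cf; apply: within_mulr => //; exact: primitive_continuous (inner_primitive cf). Qed.

Let step_primitive f : {within `[a, b], continuous f} ->
  primitive a b (step f) (fun t => (rho t)^-1 * inner f t).
Proof.
move=> cf; split; first by apply: continuous_integrable; exact: cslope.
by move=> x _; rewrite {2}/step set_itv1 Rintegral_set1 addr0.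
Qed.

Let le_int f g x : x \in `[a, b] -> {within `[a, b], continuous f} ->
  {within `[a, b], continuous g} -> (forall t, t \in `[a, x] -> f t <= g t) ->
  \int[leb]_(t in `[a, x]) f t <= \int[leb]_(t in `[a, x]) g t.
Proof.
move=> xI cf cg fg; have /andP[ax xb] : a <= x <= b by rewrite -itv_in.
apply: le_Rintegral => //; apply: continuous_integrable.
- exact: within_subset cf.
- exact: within_subset cg.
Qed.

Let inner_le f g x : x \in `[a, b] -> {within `[a, b], continuous f} ->
  {within `[a, b], continuous g} -> (forall t, t \in `[a, b] -> f t <= g t) ->
  inner f x <= inner g x.
Proof.
move=> xI cf cg fg; apply: le_int => //; [exact: within_mulr..|].
move=> t tx; have tI : t \in `[a, b] := sub xI tx.
by rewrite ler_pM2l ?rho_gt0// fg.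
Qed.

Let step_le f g x : x \in `[a, b] -> {within `[a, b], continuous f} ->
  {within `[a, b], continuous g} -> (forall t, t \in `[a, b] -> f t <= g t) ->
  step f x <= step g x.
Proof.
move=> xI cf cg fg; rewrite lerD2l; apply: le_int => //; [exact: cslope..|].
move=> t tx; have tI : t \in `[a, b] := sub xI tx.
by rewrite ler_pM2l ?invr_gt0 ?rho_gt0//; exact: inner_le.
Qed.

Let iterate n := iter n step (fun=> 1).

Let iterate_continuous n : {within `[a, b], continuous (iterate n)}.
Proof.
by elim: n => [|n IH]; [exact: within_cst|exact: primitive_continuous (step_primitive IH)].
Qed.

Let step_ge1 f x : x \in `[a, b] -> (forall t, t \in `[a, b] -> 0 <= f t) -> 1 <= step f x.
Proof.
move=> xI f0; rewrite lerDl; apply: Rintegral_ge0 => t /= tx.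
have tI : t \in `[a, b] := sub xI tx.
apply: mulr_ge0; first by rewrite invr_ge0 ltW// rho_gt0.
apply: Rintegral_ge0 => s /= st.
have sI : s \in `[a, b] := sub tI st.
by rewrite mulr_ge0 ?f0// ltW ?rho_gt0.
Qed.

Let iterate_ge1 n x : x \in `[a, b] -> 1 <= iterate n x.
Proof.
elim: n x => [//|n IH] x xI; apply: step_ge1 => // t /IH; exact: le_trans.
Qed.

(** Monotonicity of [step] propagates [1 <= step 1], so that monotone convergence replaces a
    contraction estimate. *)
Let iterate_nd n x : x \in `[a, b] -> iterate n x <= iterate n.+1 x.
Proof.
elim: n x => [|n IH] x xI; first exact: (iterate_ge1 1).
rewrite -[iterate n.+1 x]/(step (iterate n) x) -[iterate n.+2 x]/(step (iterate n.+1) x).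
exact: step_le.
Qed.

(* The exponential is a supersolution of the integral equation. *)
Let iterate_ubound : exists B, forall n x, x \in `[a, b] -> iterate n x <= B.
Proof.
have [m m0 mP] := density_lbound ab bp; have [M M0 MP] := density_ubound bp.
(* This [k] satisfies [M / m <= k * k], the condition for [step w <= w] with
   [w x = exp (k (x - a))]. *)
pose k : R := 1 + M / m; have k1 : 1 <= k by rewrite lerDl divr_ge0// ltW.
have k0 : 0 < k by exact: lt_le_trans k1.
have kk : M / m <= k * k by have := divr_gt0 M0 m0; rewrite /k; nra.
pose w (x : R) : R := expR (k * x + - (k * a)).
have dw (x : R) : is_derive x (1 : R) w (w x * k).
  exact: (@is_derive1_comp _ expR (fun x => k * x + - (k * a)) _ _ _
    (is_derive_expR _) (is_derive_affine _ _ _)).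
have cw : {within `[a, b], continuous w}.
  apply: continuous_subspaceT => x; apply/differentiable_continuous/derivable1_diffP.
  by case: (dw x).
have w1 : w a = 1 by rewrite /w subrr expR0.
have intw x : x \in `[a, b] -> \int[leb]_(t in `[a, x]) (w t) = (w x - 1) / k.
  move=> xI; have /andP[ax xb] : a <= x <= b by rewrite -itv_in.
  have -> : (w x - 1) / k = w x * k^-1 - w a * k^-1 by rewrite w1 mulrBl.
  apply: (@FTC2 _ a x (fun t => w t * k^-1)) => //.
  - by apply: within_mulr; [exact: within_subset cw|exact: within_cst].
  - exact: within_subset cw.
  - move=> t _; apply: (is_derive_val (is_derive_mul (dw t) (is_derive_cst k^-1 t 1))).
    by rewrite mulr0 addr0 mulfK// gt_eqF.
have stepw x : x \in `[a, b] -> step w x <= w x.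
  move=> xI; rewrite /step addrC -lerBrDr.
  have inw t : t \in `[a, b] -> (rho t)^-1 * inner w t <= M / m / k * w t.
    move=> tI; have inle : inner w t <= M * ((w t - 1) / k).
      rewrite -intw// -(itv_RintegralZ M); last first.
        apply: continuous_integrable; apply: within_subset cw => //.
        by move: tI; rewrite itv_in => /andP[].
      apply: le_int => //; [exact: within_mulr|by apply: within_mulr => //; exact: within_cst|].
      by move=> s /(sub tI) sI; rewrite ler_pM2r ?expR_gt0// MP.
    apply: (@le_trans _ _ (m^-1 * (M * (w t / k)))); last by rewrite le_eqVlt; apply/orP; left; apply/eqP; field; rewrite !gt_eqF.
    have wt : inner w t <= M * (w t / k).
      apply: (le_trans inle); rewrite ler_pM2l// ler_pM2r ?invr_gt0//.
      by rewrite gerBl.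
    have in0 : 0 <= inner w t.
      apply: Rintegral_ge0 => s /= /(sub tI) sI.
      by rewrite mulr_ge0 ?expR_ge0// ltW// rho_gt0.
    apply: ler_pM => //; first by rewrite invr_ge0 ltW// rho_gt0.
    by rewrite lef_pV2 ?posrE ?rho_gt0// mP.
  apply: (@le_trans _ _ (\int[leb]_(t in `[a, x]) (M / m / k * w t))).
    apply: le_int => //; [exact: cslope|by apply: within_mulr => //; exact: within_cst|].
    by move=> t /(sub xI) tI; exact: inw.
  rewrite itv_RintegralZ; last first.
    apply: continuous_integrable; apply: within_subset cw => //.
    by move: xI; rewrite itv_in => /andP[].
  rewrite intw//.
  have wx : 0 <= w x - 1.
    rewrite subr_ge0 -expR0 ler_expR subr_ge0 ler_pM2l//.
    by move: xI; rewrite itv_in => /andP[].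
  rewrite (_ : M / m / k * ((w x - 1) / k) = (M / m) / (k * k) * (w x - 1)); last first.
    by field; rewrite !gt_eqF.
  by rewrite ler_piMl// ler_pdivrMr ?mul1r// mulr_gt0.
have iterw n x : x \in `[a, b] -> iterate n x <= w x.
  elim: n x => [|n IH] x xI.
    rewrite /iterate/= -expR0 ler_expR subr_ge0 ler_pM2l//.
    by move: xI; rewrite itv_in => /andP[].
  apply: (le_trans _ (stepw x xI)); exact: step_le.
exists (w b) => n x xI; apply: (le_trans (iterw n x xI)).
rewrite ler_expR lerD2r ler_pM2l//.
by move: xI; rewrite itv_in => /andP[].
Qed.

(** The limit of the iterates is a fixed point of [step], by bounded convergence in each of the two
    nested integrals; the flux is [inner psi]. *)
Lemma left_solution : exists psi P,
  [/\ primitive a b psi (fun t => (rho t)^-1 * P t),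
      primitive a b P (fun t => rho t * psi t),
      P a = 0 & forall x, x \in `[a, b] -> 1 <= psi x].
Proof.
have [B HB] := iterate_ubound.
pose psi x := limn (iterate^~ x).
have B0 : 0 <= B.
  have aI : a \in `[a, b] by rewrite in_itv/= lexx ltW.
  exact: le_trans ler01 (HB 0%N a aI).
have cv x : x \in `[a, b] -> iterate^~ x @ \oo --> psi x.
  move=> xI; apply: nondecreasing_is_cvgn.
    by apply/nondecreasing_seqP => n; exact: iterate_nd.
  by exists B => _ [n _ <-]; exact: HB.
have psi1 x : x \in `[a, b] -> 1 <= psi x.
  move=> xI; apply: limr_ge; first exact: cv.
  by apply: nearW => n; exact: iterate_ge1.
have normB n x : x \in `[a, b] -> `|iterate n x| <= B.
  move=> xI; rewrite ger0_norm ?HB//; exact: le_trans ler01 (iterate_ge1 n xI).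
have [M HM] := continuous_bounded crho.
have [N HN] := continuous_bounded cinv.
have M0 : 0 <= M.
  have aI : a \in `[a, b] by rewrite in_itv/= lexx ltW.
  exact: le_trans (normr_ge0 _) (HM a aI).
have bd n s : s \in `[a, b] -> `|rho s * iterate n s| <= M * B.
  by move=> sI; rewrite normrM; apply: ler_pM => //; [exact: HM|exact: normB].
have inner_cv t : t \in `[a, b] -> (fun n => inner (iterate n) t) @ \oo --> inner psi t.
  move=> tI; apply: (@Rintegral_bounded_cvg _ _ _ (fun n s => rho s * iterate n s) _ (M * B)).
  - move=> n; apply: measurable_funS (sub tI) _ => //.
    by apply: continuous_measurable; exact: within_mulr.
  - by move=> n s /(sub tI) sI; exact: bd.
  - move=> s /(sub tI) sI; apply: cvgM; [exact: cvg_cst|exact: cv].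
have inner_bd n t : t \in `[a, b] -> `|inner (iterate n) t| <= M * B * (b - a).
  move=> tI; have /andP[at_ tb] : a <= t <= b by rewrite -itv_in.
  have i1 : leb.-integrable `[a, t] (EFin \o (fun s => rho s * iterate n s)).
    apply: itv_integrable_sub (lexx a) tb _.
    by apply: continuous_integrable; exact: within_mulr.
  apply: (le_trans (le_normr_Rintegral _ i1)) => //.
  apply: (@le_trans _ _ (\int[leb]_(s in `[a, t]) (M * B))).
    apply: le_Rintegral => //; [exact: itv_integrable_norm|exact: itv_integrable_cst|].
    by move=> s /(sub tI) sI; exact: bd.
  rewrite Rintegral_cst// ler_wpM2l ?mulr_ge0//.
  rewrite [X in fine X](_ : _ = (t - a)%:E) ?lerB//.
  apply: (etrans (@lebesgue_measure_itv R `[a, t])); rewrite /= lte_fin.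
  by move: at_; rewrite le_eqVlt => /predU1P[->|->]; rewrite ?ltxx ?subrr ?EFinB.
have psiE x : x \in `[a, b] -> psi x = step psi x.
  move=> xI; have c1 : (fun n => iterate n.+1 x) @ \oo --> psi x.
    by have := cv x xI; rewrite -cvg_shiftS.
  have c2 : (fun n => iterate n.+1 x) @ \oo --> step psi x.
    apply: cvgD; first exact: cvg_cst.
    apply: (@Rintegral_bounded_cvg _ _ _ (fun n t => (rho t)^-1 * inner (iterate n) t)
      _ (N * (M * B * (b - a)))).
    - move=> n; apply: measurable_funS (sub xI) _ => //.
      by apply: continuous_measurable; exact: cslope.
    - move=> n s /(sub xI) sI; rewrite normrM; apply: ler_pM => //; [exact: HN|exact: inner_bd].
    - move=> s /(sub xI) sI; apply: cvgM; [exact: cvg_cst|exact: inner_cv].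
  exact: (cvg_unique (@Rhausdorff R) c1 c2).
have mpsi : measurable_fun `[a, b] psi.
  apply: (@measurable_fun_cvg _ _ _ _ iterate) => [n|x xI]; last exact: cv.
  exact: continuous_measurable.
(* Continuity of the limit is not yet known; integrability comes from measurability and the bound
   [B]. *)
have ipsi : leb.-integrable `[a, b] (EFin \o (fun t => rho t * psi t)).
  apply: (@itv_integrableM _ _ rho psi B) => //; first exact: continuous_integrable.
  move=> x xI; rewrite ger0_norm; last exact: le_trans ler01 (psi1 x xI).
  by apply: limr_le; [exact: cv|apply: nearW => n; exact: HB].
have pP : primitive a b (inner psi) (fun t => rho t * psi t).
  split => // x _; by rewrite {2}/inner set_itv1 Rintegral_set1 add0r.
exists psi, (inner psi); split => //; last by rewrite /inner set_itv1 Rintegral_set1.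
split.
  by apply: continuous_integrable; apply: within_mulr => //; exact: primitive_continuous pP.
have aI : a \in `[a, b] by rewrite in_itv/= lexx ltW.
by move=> x xI; rewrite (psiE x xI) (psiE a aI) /step set_itv1 Rintegral_set1 addr0.
Qed.

End fundamental_solutions.
Section primitive_algebra.
Context {R : realType}.
Local Notation leb := (@lebesgue_measure R).
Implicit Types (a b c x : R) (f g h : R -> R).

Lemma primitive_cst a b c : primitive a b (fun=> c) (fun=> 0).
Proof.
split; first exact: itv_integrable_cst.
by move=> x _; rewrite Rintegral_cst// mul0r addr0.
Qed.

Lemma primitive_scale a b c f g : primitive a b f g ->
  primitive a b (fun x => c * f x) (fun x => c * g x).
Proof.
move=> pf; have := primitive_add c pf (primitive_cst a b 0).
under eq_fun do rewrite addr0.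
by under [X in primitive _ _ _ X -> _]eq_fun do rewrite addr0.
Qed.

Lemma primitive_fun a b f : leb.-integrable `[a, b] (EFin \o f) ->
  primitive a b (fun x => \int[leb]_(t in `[a, x]) f t) f.
Proof. by move=> fi; split => // x _; rewrite set_itv1 Rintegral_set1 add0r. Qed.

Lemma primitive_Rintegral a b f g : a <= b -> primitive a b f g ->
  \int[leb]_(x in `[a, b]) g x = f b - f a.
Proof.
move=> ab [_ fE]; have bI : b \in `[a, b] by rewrite itv_in ab lexx.
by rewrite (fE b bI) [f a + _]addrC addrK.
Qed.

Lemma primitive_join a c b f g h : a <= c -> c <= b ->
  primitive a c f g -> primitive c b f h ->
  primitive a b f (fun y => if y <= c then g y else h y).
Proof.
move=> ac cb pg ph; apply: (primitive_glue ac cb).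
- apply: ae_primitive (pg) _; last by apply: aeW => x; rewrite in_itv/= => /andP[_ /ltW ->].
  apply: eq_measurable_fun (integrable_measurable pg.1) => x.
  by rewrite inE/= in_itv/= => /andP[_ ->].
- apply: ae_primitive (ph) _; last by apply: aeW => x; rewrite in_itv/= leNgt => /andP[-> _].
  apply: measurable_oo_cc; apply: (@eq_measurable_fun _ _ _ _ _ h) => [x|].
    by rewrite inE/= in_itv/= leNgt => /andP[-> _].
  apply: measurable_funS (integrable_measurable ph.1) => // x /=.
  by rewrite !in_itv/= => /andP[/ltW -> /ltW ->].
Qed.

End primitive_algebra.

(* [P] is the flux [rho psi'], so that the equation reads [P' = rho psi]. *)
Definition flux_solution (R : realType) (a b : R) (rho psi P : R -> R) :=
  primitive a b psi (fun t => (rho t)^-1 * P t) /\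
  primitive a b P (fun t => rho t * psi t).

(** * The Green function as a reproducing kernel *)

Section green_function.
Context {R : realType}.
Local Notation leb := (@lebesgue_measure R).
Variables (a b : R) (mu : probability (measurableTypeR R) R) (rho : R -> R).
Hypothesis ab : a < b.
Hypothesis bp : bounded_perturbation a b mu rho.
Implicit Types (f g h psi chi P Q : R -> R).

Local Notation sq := (sq_integrable a b).
Local Notation H1 := (H1 a b mu).
Local Notation ip := (ip a b mu).
Local Notation ipH1 := (ipH1 a b mu).
Let crho : {within `[a, b], continuous rho} := bp_continuous bp.
Let rho_gt0 x : x \in `[a, b] -> 0 < rho x. Proof. exact: bp_gt0 bp x. Qed.
Let aI : a \in `[a, b]. Proof. by rewrite itv_in lexx ltW. Qed.
Let bI : b \in `[a, b]. Proof. by rewrite itv_in lexx ltW. Qed.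
Let ooI x : x \in `]a, b[ -> x \in `[a, b].
Proof. by rewrite !in_itv/= => /andP[/ltW -> /ltW ->]. Qed.
Let cinv : {within `[a, b], continuous (fun t => (rho t)^-1)}.
Proof. by apply: within_invr => // x xI; rewrite gt_eqF// rho_gt0. Qed.

(** For [chi = psi * J] the Wronskian identity forces [J' = -1 / (rho psi^2)], and the flux of [chi]
    is then [P * J - 1 / psi]. *)
Lemma fundamental_system : exists psi P chi Q,
  [/\ flux_solution a b rho psi P, flux_solution a b rho chi Q,
      P a = 0, Q b = 0 &
      forall x, x \in `[a, b] -> chi x * P x - psi x * Q x = 1].
Proof.
have [psi [P [ppsi pP Pa psi1]]] := left_solution ab bp.
have cpsi := primitive_continuous ppsi; have cP := primitive_continuous pP.
have psi0 x : x \in `[a, b] -> 0 < psi x by move=> /psi1; exact: lt_le_trans.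
have psin x : x \in `[a, b] -> psi x != 0 by move=> /psi0; exact: lt0r_neq0.
have rhon x : x \in `[a, b] -> rho x != 0 by move=> /rho_gt0; exact: lt0r_neq0.
(* [P b] is the integral of [rho * psi], at least [m * (b - a)]. *)
have Pb : P b != 0.
  have [m m0 mP] := density_lbound ab bp.
  have := primitive_Rintegral (ltW ab) pP; rewrite Pa subr0 => <-.
  apply: lt0r_neq0; apply: (@lt_le_trans _ _ (\int[leb]_(x in `[a, b]) m)).
    have -> : \int[leb]_(x in `[a, b]) m = m * b - m * a.
      apply: (@FTC2 _ a b (fun x => m * x) (fun=> m)) => //; first exact: ltW.
      - by apply: within_mulr; [exact: within_cst|by apply: continuous_subspaceT => y; exact: cvg_id].
      - exact: within_cst.
      - move=> x _; have := is_derive_affine m 0 x.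
        by under eq_fun do rewrite addr0.
    by rewrite subr_gt0 ltr_pM2l.
  apply: le_Rintegral => //; first exact: itv_integrable_cst.
    by case: pP.
  move=> x xI; have := rho_gt0 xI; have := mP x xI; have := psi1 x xI; nra.
pose w x : R := (rho x * (psi x * psi x))^-1.
have cw : {within `[a, b], continuous w}.
  apply: within_invr; first by do !apply: within_mulr.
  by move=> x xI; rewrite !mulf_neq0// ?rhon// psin.
pose G (x : R) : R := \int[leb]_(t in `[a, x]) w t.
have pG : primitive a b G w by apply: primitive_fun; exact: continuous_integrable.
have cG := primitive_continuous pG.
(* The value of [J] at [b] for which [P b * J b - 1 / psi b] vanishes. *)
pose k : R := (psi b * P b)^-1.
pose J (x : R) : R := k + (G b - G x).
have cJ : {within `[a, b], continuous J}.
  apply: within_addr; first exact: within_cst.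
  by apply: within_subr => //; exact: within_cst.
have dJ x : x \in `]a, b[ -> is_derive x 1 J (- w x).
  move=> xI; have dG := primitive_is_derive cw pG xI.
  apply: (is_derive_val (is_derive_add (is_derive_cst k x 1)
    (is_derive_sub (is_derive_cst (G b) x 1) dG))).
  by rewrite add0r sub0r.
have dpsi x : x \in `]a, b[ -> is_derive x 1 psi ((rho x)^-1 * P x).
  by move=> xI; apply: (primitive_is_derive _ ppsi xI); exact: within_mulr.
have dP x : x \in `]a, b[ -> is_derive x 1 P (rho x * psi x).
  by move=> xI; apply: (primitive_is_derive _ pP xI); exact: within_mulr.
pose chi (x : R) : R := psi x * J x.
pose Q (x : R) : R := P x * J x - (psi x)^-1.
have cchi : {within `[a, b], continuous chi} by exact: within_mulr.
have cQ : {within `[a, b], continuous Q}.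
  apply: within_subr; first exact: within_mulr.
  exact: within_invr.
exists psi, P, chi, Q; split => //.
- split; apply: C1_primitive => //.
  + exact: within_mulr.
  + move=> x xI; have xI' := ooI xI.
    apply: (is_derive_val (is_derive_mul (dpsi x xI) (dJ x xI))).
    rewrite /Q /w; move: (psin x xI') (rhon x xI') => px rx.
    by field; rewrite px rx.
  + exact: within_mulr.
  + move=> x xI; have xI' := ooI xI.
    apply: (is_derive_val (is_derive_sub (is_derive_mul (dP x xI) (dJ x xI))
      (is_derive_inv (psin x xI') (dpsi x xI)))).
    rewrite /chi /w; move: (psin x xI') (rhon x xI') => px rx.
    by field; rewrite px rx.
- rewrite /Q /J subrr addr0 /k; move: (psin b bI) => pb.
  by field; rewrite pb Pb.
- move=> x xI; rewrite /chi /Q; move: (psin x xI) => px.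
  by field.
Qed.

Lemma flux_slope_continuous psi P : flux_solution a b rho psi P ->
  {within `[a, b], continuous (fun t => (rho t)^-1 * P t)}.
Proof. by move=> [_ /primitive_continuous cP]; exact: within_mulr. Qed.

Lemma flux_H1 psi P : flux_solution a b rho psi P -> H1 psi.
Proof.
move=> fp; apply: (primitive_H1 ab bp _ fp.1); apply: sq_integrable_continuous.
exact: flux_slope_continuous fp.
Qed.

(** The integrand is [(f P)'], as [rho psi = P'] and [rho psi' = P]; only boundary terms remain. *)
Lemma flux_ipH1 psi P f : flux_solution a b rho psi P -> H1 f ->
  ipH1 f psi = f b * P b - f a * P a.
Proof.
move=> fp Hf; have [g sg pf] := H1_primitive ab bp Hf; have [ppsi pP] := fp.
have sP := sq_integrable_continuous (flux_slope_continuous fp).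
have sf := H1_sq Hf; have sp := H1_sq (flux_H1 fp).
rewrite (ipH1E ab bp sg sP pf ppsi) !(ipE bp)//.
rewrite -itv_RintegralD; [|exact: sq_rho_integrable bp _ _ _ _..].
rewrite -(primitive_Rintegral (ltW ab) (primitiveM pf pP)).
apply: eq_Rintegral => x; rewrite inE/= => xI.
by have := lt0r_neq0 (rho_gt0 xI); move: (f x) (g x) (P x) (psi x) (rho x) => *; field.
Qed.

Variables (psi P chi Q : R -> R).
Hypothesis fpsi : flux_solution a b rho psi P.
Hypothesis fchi : flux_solution a b rho chi Q.
Hypothesis Pa : P a = 0.
Hypothesis Qb : Q b = 0.
Hypothesis wronskian : forall x, x \in `[a, b] -> chi x * P x - psi x * Q x = 1.

Definition green x y := psi (Num.min x y) * chi (Num.max x y).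

Let slope x y := if y <= x then chi x * ((rho y)^-1 * P y) else psi x * ((rho y)^-1 * Q y).

Let green_primitive x : x \in `[a, b] -> primitive a b (green x) (slope x).
Proof.
rewrite itv_in => /andP[ax xb]; apply: (primitive_join ax xb).
- apply: primitive_eq (primitive_scale (chi x) (primitive_sub (lexx a) xb fpsi.1)).
  move=> y; rewrite itv_in => /andP[_ yx].
  by rewrite /green min_r// max_l// mulrC.
- apply: primitive_eq (primitive_scale (psi x) (primitive_sub ax (lexx b) fchi.1)).
  move=> y; rewrite itv_in => /andP[xy _].
  by rewrite /green min_l// max_r.
Qed.

Let slope_sq x : x \in `[a, b] -> sq (slope x).
Proof.
move=> xI; have [M HM] := continuous_bounded (flux_slope_continuous fpsi).
have [N HN] := continuous_bounded (flux_slope_continuous fchi).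
have m := integrable_measurable (green_primitive xI).1.
apply: (sq_integrable_bounded (M := `|chi x| * M + `|psi x| * N)) m _ => y yI.
have M0 := le_trans (normr_ge0 _) (HM y yI); have N0 := le_trans (normr_ge0 _) (HN y yI).
rewrite /slope; case: ifPn => _; rewrite normrM.
  apply: ler_wpDr; first by rewrite mulr_ge0.
  by rewrite ler_wpM2l// HM.
apply: ler_wpDl; first by rewrite mulr_ge0.
by rewrite ler_wpM2l// HN.
Qed.

(** Left and right of [x] the integrand is a constant multiple of [(f P)'] and of [(f Q)']. The
    conditions at [a] and [b] remove the outer boundary terms, and the inner ones add up to [f x]
    times the Wronskian. *)
Lemma green_reproducing : reproducing_kernel `[a, b] H1 ipH1 green.
Proof.
move=> x xI; have pK := green_primitive xI; have sK := slope_sq xI.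
have HK := primitive_H1 ab bp sK pK; split => // f Hf.
have /andP[ax xb] : a <= x <= b by rewrite -itv_in.
have [g sg pf] := H1_primitive ab bp Hf.
have sf := H1_sq Hf; have sG := H1_sq HK.
rewrite (ipH1E ab bp sg sK pf pK) !(ipE bp)//.
have i1 := sq_rho_integrable bp sf sG; have i2 := sq_rho_integrable bp sg sK.
rewrite -itv_RintegralD//.
rewrite (Rintegral_chasles ax xb); last exact: itv_integrableD.
have pl := primitiveM pf fpsi.2; have pr := primitiveM pf fchi.2.
have -> : \int[leb]_(y in `[a, x]) (f y * green x y * rho y + g y * slope x y * rho y) =
    chi x * (f x * P x).
  have := primitive_Rintegral ax (primitive_sub (lexx a) xb (primitive_scale (chi x) pl)).
  rewrite Pa !mulr0 subr0 => <-; apply: eq_Rintegral => y; rewrite inE/= itv_in => /andP[ay yx].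
  have yI : y \in `[a, b] by rewrite itv_in ay (le_trans yx).
  rewrite /green /slope yx min_r// max_l//.
  have := lt0r_neq0 (rho_gt0 yI).
  by move: (f y) (g y) (P y) (psi y) (chi x) (rho y) => *; field.
have -> : \int[leb]_(y in `[x, b]) (f y * green x y * rho y + g y * slope x y * rho y) =
    - (psi x * (f x * Q x)).
  have := primitive_Rintegral xb (primitive_sub ax (lexx b) (primitive_scale (psi x) pr)).
  (* At [y = x] the definition of [slope] takes the left branch, so the integrands are compared only
     for [y > x]. *)
  rewrite Qb !mulr0 sub0r => <-; apply: ae_Rintegral.
  - apply: integrable_measurable; apply: itv_integrable_sub ax (lexx b) _.
    exact: itv_integrableD.
  - apply: integrable_measurable; apply: itv_integrable_sub ax (lexx b) _.
    by apply: itv_integrableZ; case: pr.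
  apply: aeW => y; rewrite in_itv/= => /andP[xy yb].
  have yI : y \in `[a, b] by rewrite itv_in (le_trans ax (ltW xy)) ltW.
  rewrite /green /slope leNgt xy/= min_l ?(ltW xy)// max_r ?(ltW xy)//.
  have := lt0r_neq0 (rho_gt0 yI).
  by move: (f y) (g y) (Q y) (chi y) (psi x) (rho y) => *; field.
have := wronskian xI.
move: (f x) (P x) (Q x) (psi x) (chi x) => u v w y z E.
by rewrite -[RHS]mulr1 -E; ring.
Qed.

(** The same combination of the fluxes vanishes too. At [a] it reduces to [d * Q a = 0], with [Q a]
    nonzero by the Wronskian; [b] gives [c = 0]. *)
Lemma flux_lin_indep : lin_indep a b psi chi.
Proof.
move=> c d cd0.
have cP := primitive_continuous fpsi.2; have cQ := primitive_continuous fchi.2.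
have p0 : primitive a b (fun=> 0) (fun t => c * ((rho t)^-1 * P t) + (d * ((rho t)^-1 * Q t))).
  apply: (primitive_eq (f := fun x => c * psi x + d * chi x)) => //.
  have p1 := fpsi.1; have p2 := primitive_scale d fchi.1.
  exact: (primitive_add c p1 p2).
have cPQ x : x \in `[a, b] -> c * P x + d * Q x = 0.
  move=> xI; have : c * ((rho x)^-1 * P x) + (d * ((rho x)^-1 * Q x)) = 0.
    apply: (ae_eq_continuous (f := fun t => c * ((rho t)^-1 * P t) + (d * ((rho t)^-1 * Q t)))
      (g := fun=> 0) ab _ _ _ xI).
    - by apply: within_addr; do !(apply: within_mulr => //; try exact: within_cst).
    - exact: within_cst.
    - apply: (@weak_deriv_ae_eq _ a b (fun=> 0)); apply: primitive_weak_deriv (ltW ab) _ => //.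
      exact: primitive_cst.
  have := lt0r_neq0 (rho_gt0 xI); move: (P x) (Q x) (rho x) => p q r r0 E.
  by apply: (mulfI (invr_neq0 r0)); rewrite mulr0 -E; ring.
have := wronskian aI; have := cPQ a aI; rewrite Pa !mulr0 add0r sub0r => dQ Qa.
have := wronskian bI; have := cPQ b bI; rewrite Qb !mulr0 addr0 subr0 => cPb Pb.
split.
  by apply/eqP; move: cPb => /eqP; rewrite mulf_eq0 => /orP[//|/eqP P0]; move: Pb; rewrite P0 mulr0 => /esym/eqP; rewrite oner_eq0.
by apply/eqP; move: dQ => /eqP; rewrite mulf_eq0 => /orP[//|/eqP Q0]; move: Qa; rewrite Q0 mulr0 oppr0 => /esym/eqP; rewrite oner_eq0.
Qed.

Lemma green_continuous :
  {within `[a, b] `*` `[a, b], continuous (fun z : R * R => green z.1 z.2)}.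
Proof.
have cpsi := primitive_continuous fpsi.1; have cchi := primitive_continuous fchi.1.
have c1 : continuous (fun z : R * R => z.1) by move=> z; exact: cvg_fst.
have c2 : continuous (fun z : R * R => z.2) by move=> z; exact: cvg_snd.
apply: within_mulr.
- apply: (within_comp (g := fun z : R * R => Num.min z.1 z.2)) cpsi.
    by apply: continuous_subspaceT => z; apply: (@continuous_min R); [exact: c1|exact: c2].
  by move=> [x y] [/= xI yI]; case: leP.
- apply: (within_comp (g := fun z : R * R => Num.max z.1 z.2)) cchi.
    by apply: continuous_subspaceT => z; apply: (@continuous_max R); [exact: c1|exact: c2].
  by move=> [x y] [/= xI yI]; case: leP.
Qed.

End green_function.

(** * Piecewise C1 densities *)

Section piecewise.
Context {R : realType}.
Local Notation leb := (@lebesgue_measure R).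
Implicit Types (a b c d x : R) (f g h : R -> R).

Lemma C1_on_inv c d f : (forall x, x \in `[c, d] -> f x != 0) -> C1_on c d f ->
  C1_on c d (fun x => (f x)^-1).
Proof.
move=> f0 [cf [g cg fg]]; split; first exact: within_invr.
exists (fun x => g x * ((f x)^-1 * (f x)^-1) * -1).
  apply: within_mulr; last exact: within_cst.
  by apply: within_mulr => //; apply: within_mulr; exact: within_invr.
move=> x xI; have xI' : x \in `[c, d].
  by move: xI; rewrite !in_itv/= => /andP[/ltW -> /ltW ->].
apply: (is_derive_val (is_derive_inv (f0 x xI') (fg x xI))).
by rewrite mulrN1 expr2 invfM.
Qed.

Lemma piecewise_C1_inv a b f : (forall x, x \in `[a, b] -> f x != 0) ->
  piecewise_C1 a b f -> piecewise_C1 a b (fun x => (f x)^-1).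
Proof.
move=> f0 [n [t [t0 tn tP]]]; exists n, t; split => // i ni.
have [ti Ci] := tP i ni; split => //; apply: C1_on_inv => // x.
rewrite itv_in => /andP[tx xt]; apply: f0; rewrite itv_in.
have nd j k : (j <= k)%N -> (k <= n)%N -> t j <= t k.
  elim: k => [|k IH]; first by rewrite leqn0 => /eqP->.
  rewrite leq_eqVlt => /predU1P[->//|jk] kn.
  by apply: (le_trans (IH jk (ltnW kn))); apply/ltW; case: (tP k kn).
rewrite -t0 -tn; apply/andP; split.
  by apply: le_trans tx; apply: nd => //; exact: ltnW.
by apply: (le_trans xt); apply: nd.
Qed.

(** Induction on the number of pieces, gluing at the breakpoints, where the pointwise derivative may
    be missing but which form a null set. *)
Lemma piecewise_C1_primitive a b f : piecewise_C1 a b f ->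
  exists2 g, primitive a b f g &
    (exists M, forall x, x \in `[a, b] -> `|g x| <= M) /\
    {ae leb, forall x : R, x \in `]a, b[ -> is_derive x (1 : R) f (g x)}.
Proof.
move=> [n [t [<- <-]]].
suff : (forall i, (i < n)%N -> t i < t i.+1 /\ C1_on (t i) (t i.+1) f) ->
  t 0%N <= t n /\ exists2 g, primitive (t 0%N) (t n) f g &
    (exists M, forall x, x \in `[t 0%N, t n] -> `|g x| <= M) /\
    {ae leb, forall x : R, x \in `]t 0%N, t n[ -> is_derive x (1 : R) f (g x)}.
  by move=> + H => /(_ H)[].
elim: n => [_|n IH tP].
  split => //; exists (fun=> 0).
    split; first exact: itv_integrable_cst.
    by move=> x; rewrite itv_in => /le_anti <-; rewrite set_itv1 Rintegral_set1 addr0.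
  split; first by exists 0 => x _; rewrite normr0.
  by apply: aeW => x; rewrite in_itv/= => /andP[x1 /(lt_trans x1)]; rewrite ltxx.
have [t0n [g pg [[M HM] dg]]] := IH (fun i ni => tP i (ltnW ni)).
have [tn [cf [h ch dh]]] := tP n (ltnSn n).
split; first exact: le_trans t0n (ltW tn).
have ph : primitive (t n) (t n.+1) f h by exact: C1_primitive.
have [N HN] := continuous_bounded ch.
exists (fun y => if y <= t n then g y else h y).
  exact: (primitive_join t0n (ltW tn) pg ph).
split.
  exists (Num.max M N) => x; rewrite itv_in => /andP[x0 xn]; rewrite le_max.
  case: ifPn => xt; first by rewrite HM// itv_in x0.
  by rewrite HN ?orbT// itv_in xn andbT ltW// ltNge.
have dn : {ae leb, forall x : R, x != t n}.
  exists [set t n]; split => //; first exact: lebesgue_measure_set1.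
  by move=> x /= /negP; rewrite negbK => /eqP.
apply: ae_sub2 dg dn => x dgx xn; rewrite in_itv/= => /andP[x0 xn1].
case: ifPn => xt; last by apply: dh; rewrite in_itv/= xn1 ltNge xt.
by apply: dgx; rewrite in_itv/= x0 lt_neqAle xn.
Qed.

(** Second derivatives are weak derivatives of [wderiv a b f], itself known only almost
    everywhere. *)
Lemma weak_deriv_ae a b f f' g : is_weak_deriv a b f g ->
  locally_integrable `]a, b[ f' ->
  {ae leb, forall x, x \in `]a, b[ -> f x = f' x} -> is_weak_deriv a b f' g.
Proof.
move=> [lf lg wg] lf' ff'; split => // p tp; rewrite -(wg p tp).
have mI : measurable (`]a, b[%classic : set (measurableTypeR R)) by exact: measurable_itv.
have mp : measurable_fun `]a, b[ (derive1 p).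
  apply: measurable_funTS; apply: continuous_measurable_fun.
  have := tp.1 1%N => dp x; apply/differentiable_continuous/derivable1_diffP; exact: dp.
have [mf _ _] := lf; have [mf' _ _] := lf'.
rewrite /Rintegral; congr fine; apply: ae_eq_integral => //.
- by apply/measurable_EFinP; exact: measurable_funM.
- by apply/measurable_EFinP; exact: measurable_funM.
- by apply: ae_sub ff' => x fx xI; rewrite /= fx.
Qed.

End piecewise.

(** * Equivalence of the flux system and the homogeneous equation *)

Section homogeneous_equation.
Context {R : realType}.
Local Notation leb := (@lebesgue_measure R).
Variables (a b : R) (mu : probability (measurableTypeR R) R) (rho : R -> R).
Hypothesis ab : a < b.
Hypothesis bp : bounded_perturbation a b mu rho.
Implicit Types (f g h psi P : R -> R).

Local Notation sq := (sq_integrable a b).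
Local Notation D := (wderiv a b).
Local Notation H1 := (H1 a b mu).
Let crho : {within `[a, b], continuous rho} := bp_continuous bp.
Let rho_gt0 x : x \in `[a, b] -> 0 < rho x. Proof. exact: bp_gt0 bp x. Qed.
Let rho_neq0 x : x \in `[a, b] -> rho x != 0. Proof. by move/rho_gt0/lt0r_neq0. Qed.
Let ooI x : x \in `]a, b[ -> x \in `[a, b].
Proof. by rewrite !in_itv/= => /andP[/ltW -> /ltW ->]. Qed.
Let cinv : {within `[a, b], continuous (fun t => (rho t)^-1)}.
Proof. by apply: within_invr. Qed.

Lemma derive1_potential x r : 0 < rho x -> is_derive x (1 : R) rho r ->
  derive1 (potential rho) x = - (r / rho x).
Proof.
move=> r0 dr; rewrite derive1E.
have dl := @is_derive1_comp _ (@ln R) rho x _ _ (is_derive1_ln r0) dr.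
have := is_derive_opp dl => d; rewrite (@derive_val _ _ _ _ _ _ _ d).
by rewrite mulrC.
Qed.

Let L2_bounded g h M : primitive a b g h -> (forall x, x \in `[a, b] -> `|h x| <= M) ->
  L2 a b mu h.
Proof.
move=> pg hM; apply/(L2P ab bp); apply: sq_integrable_bounded hM.
exact: integrable_measurable pg.1.
Qed.

(** [1 / rho] is piecewise C1 as well, so [psi' = P / rho] is absolutely continuous with derivative
    [psi + P (1/rho)']; and [(1/rho)' = V' / rho]. *)
Lemma flux_homogeneous psi P : flux_solution a b rho psi P ->
  homogeneous_solution a b mu rho psi.
Proof.
move=> fp; have [ppsi pP] := fp.
have cpsi := primitive_continuous ppsi; have cP := primitive_continuous pP.
have Hpsi := flux_H1 ab bp fp.
have [sD pD] := H1_wderiv ab bp Hpsi.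
have [s ps [[M HM] ds]] := piecewise_C1_primitive (piecewise_C1_inv rho_neq0 (bp_piecewise bp)).
have pPs := primitiveM pP ps.
have DP : {ae leb, forall x, x \in `]a, b[ -> P x * (rho x)^-1 = D psi x}.
  by apply: ae_sub (primitive_wderiv_ae ab ppsi) => x + xI => <- //; rewrite mulrC.
have w : is_weak_deriv a b (D psi) (fun x => rho x * psi x * (rho x)^-1 + P x * s x).
  apply: weak_deriv_ae DP; first exact: primitive_weak_deriv (ltW ab) pPs.
  by apply: integrable_locally_oo; exact: sq_integrableW.
split.
  split => //; exists (fun x => rho x * psi x * (rho x)^-1 + P x * s x) => //.
  have [N HN] := continuous_bounded cP; have [N' HN'] := continuous_bounded cpsi.
  apply: (@L2_bounded _ _ (N' + N * M) pPs) => x xI.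
  rewrite mulrAC mulfV ?rho_neq0// mul1r; apply: (le_trans (ler_normD _ _)).
  by apply: lerD; [exact: HN'|rewrite normrM; apply: ler_pM => //; [exact: HN|exact: HM]].
have dV : {ae leb, forall x : R, x \in `]a, b[ -> derive1 (potential rho) x = s x * rho x}.
  apply: ae_sub ds => x dx xI; have r0 := rho_gt0 (ooI xI).
  have : is_derive x (1 : R) rho (- (s x / (rho x)^-1 ^+ 2)).
    have i0 : (rho x)^-1 != 0 by rewrite invr_neq0// lt0r_neq0.
    have := @is_derive_inv _ (fun t => (rho t)^-1) x _ i0 (dx xI).
    by under eq_fun do rewrite invrK.
  move=> /(derive1_potential r0) ->.
  by move: (s x) (lt0r_neq0 r0) => y ?; field.
have := ae_sub2 _ (wderiv_ae w) (ae_sub2 _ DP dV).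
move=> /(_ (fun x => x \in `]a, b[ -> P x * (rho x)^-1 = D psi x /\ derive1 (potential rho) x = s x * rho x)
  (fun x => x \in `]a, b[ -> D (D psi) x - D psi x * derive1 (potential rho) x - psi x = 0)).
apply; last by move=> x h1 h2 xI; split; [exact: h1|exact: h2].
move=> x h1 h2 xI; have [<- ->] := h2 xI; rewrite -h1//.
by have := rho_neq0 (ooI xI); move: (rho x) (P x) (s x) (psi x) => *; field.
Qed.

Lemma flux_vanishes psi P c : flux_solution a b rho psi P -> P c = 0 ->
  wderiv_vanishes a b psi c.
Proof.
move=> fp Pc; exists (fun t => (rho t)^-1 * P t); split.
- exact: (flux_slope_continuous bp fp).
- exact: primitive_weak_deriv (ltW ab) fp.1.
- by rewrite Pc mulr0.
Qed.

(** With [F] the continuous version of [psi'], the flux is [rho * F]: since [rho' = - V' rho], its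
    derivative is [rho (psi'' - V' psi') = rho psi]. *)
Lemma homogeneous_flux psi c : c \in `[a, b] ->
  homogeneous_solution a b mu rho psi -> wderiv_vanishes a b psi c ->
  exists2 P, flux_solution a b rho psi P & P c = 0.
Proof.
move=> cI [[Hpsi [k wk /(L2P ab bp) sk]] eqn] [g [cg wg gc]].
have [F pF DF] := weak_deriv_primitive_ae (ltW ab) wk (sq_integrableW sk).
have cF := primitive_continuous pF.
(* The representative given by [wderiv_vanishes] is continuous and almost everywhere equal to [F],
   so the boundary condition passes to [F]. *)
have gF : forall x, x \in `[a, b] -> g x = F x.
  apply: ae_eq_continuous => //.
  by apply: ae_sub2 (wderiv_ae wg) DF => x h1 h2 xI; rewrite h1// h2.
have [r pr [_ dr]] := piecewise_C1_primitive (bp_piecewise bp).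
have [sD pD] := H1_wderiv ab bp Hpsi.
exists (fun x => rho x * F x); last by rewrite -gF// gc mulr0.
split.
  apply: ae_primitive pD _.
    apply: continuous_measurable; apply: within_mulr => //; exact: within_mulr.
  by apply: ae_sub DF => x h xI; rewrite h// mulKf// rho_neq0// ooI.
have cpsi := H1_continuous Hpsi.
apply: ae_primitive (primitiveM pr pF) _.
  by apply: continuous_measurable; exact: within_mulr.
have dV : {ae leb, forall x : R, x \in `]a, b[ -> derive1 (potential rho) x = - (r x / rho x)}.
  apply: ae_sub dr => x dx xI; apply: derive1_potential (dx xI).
  exact: rho_gt0 (ooI xI).
have e1 : {ae leb, forall x, x \in `]a, b[ -> D psi x = F x /\ k x = D (D psi) x}.
  by apply: ae_sub2 DF (wderiv_ae wk) => x h1 h2 xI; split; [exact: h1|exact: h2].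
have e2 : {ae leb, forall x : R, x \in `]a, b[ -> derive1 (potential rho) x = - (r x / rho x) /\
    D (D psi) x - D psi x * derive1 (potential rho) x - psi x = 0}.
  by apply: ae_sub2 dV eqn => x h1 h2 xI; split; [exact: h1|exact: h2].
apply: ae_sub2 e1 e2 => x h1 h2 xI; have [E1 ->] := h1 xI; have [E2 E3] := h2 xI.
move: E3; rewrite E1 E2 => /eqP; rewrite subr_eq0 => /eqP <-.
by have := rho_neq0 (ooI xI); move: (rho x) (F x) (r x) (D (D psi) x) => *; field.
Qed.

End homogeneous_equation.
(** * The Poincare basis *)

Section poincare_kernel.
Context {R : realType}.
Variables (a b : R) (mu : probability (measurableTypeR R) R) (rho : R -> R).
Variables (lambda : nat -> R) (phi : nat -> R -> R).
Hypothesis ab : a < b.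
Hypothesis bp : bounded_perturbation a b mu rho.
Hypothesis pb : poincare_basis a b mu lambda phi.

Local Notation H1 := (H1 a b mu).
Local Notation ip := (ip a b mu).
Local Notation ipH1 := (ipH1 a b mu).
Local Notation alpha := (fun m : nat => (1 + lambda m)^-1).

Lemma poincare_eigenvalue_ge0 m : 0 <= lambda m.
Proof.
elim: m => [|m IH]; first by rewrite (pb_lambda0 pb).
exact: le_trans IH (ltW (pb_increasing pb m)).
Qed.

Lemma poincare_eigenvalue_gt0 m : 0 < 1 + lambda m.
Proof. by rewrite ltr_pwDl ?poincare_eigenvalue_ge0. Qed.

Lemma poincare_H1 m : H1 (phi m).
Proof. by case: (pb_solution pb m). Qed.

(** Adds the L2 product to the spectral relation; this is the origin of [alpha]. *)
Lemma poincare_ipH1 m f : H1 f -> ipH1 (phi m) f = (1 + lambda m) * ip (phi m) f.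
Proof.
by move=> Hf; have [_ /(_ f Hf) E] := pb_solution pb m; rewrite /Defs.ipH1 E mulrDl mul1r.
Qed.

Lemma poincare_orth m n : ipH1 (phi m) (phi n) = (m == n)%:R / alpha m.
Proof.
by rewrite (poincare_ipH1 m (poincare_H1 n)) (pb_orthonormal pb) invrK mulrC.
Qed.

(** Orthogonality in [H1] implies orthogonality in L2, as [1 + lambda m > 0]. All partial expansions
    of [f] are then zero, so its norm is a constant sequence tending to 0. *)
Lemma poincare_total f : H1 f -> (forall m, ipH1 f (phi m) = 0) ->
  forall x, x \in `[a, b] -> f x = 0.
Proof.
move=> Hf f0; have ip0 m : ip f (phi m) = 0.
  apply: (mulfI (lt0r_neq0 (poincare_eigenvalue_gt0 m))).
  by rewrite mulr0 ip_sym -poincare_ipH1// ipH1_sym f0.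
have [cf Lf _] := Hf; apply: (continuous_ip_eq0 ab bp cf).
have := pb_total pb Lf.
have -> : (fun n => L2norm a b mu (fun x => f x - \sum_(m < n) ip f (phi m) * phi m x)) =
    fun=> L2norm a b mu f.
  apply/funext => n; rewrite /L2norm; congr Num.sqrt; apply: ip_eq => x _.
    by rewrite big1 ?subr0// => i _; rewrite ip0 mul0r.
  by rewrite big1 ?subr0// => i _; rewrite ip0 mul0r.
move=> /(cvg_unique (@Rhausdorff R) (cvg_cst _)) /eqP.
rewrite sqrtr_eq0 => le0; apply/eqP; rewrite eq_le le0; exact: ip_ge0.
Qed.

Variable K : R -> R -> R.
Hypothesis KP : reproducing_kernel `[a, b] H1 ipH1 K.

(** The kernel bounds evaluation at every point; this also gives definiteness and, at [a], the
    hypothesis of [H1_complete]. *)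
Lemma sobolev_rkhs : is_rkhs `[a, b] H1 ipH1.
Proof.
have eval x f : x \in `[a, b] -> H1 f -> `|f x| <= Num.sqrt (K x x) * Num.sqrt (ipH1 f f).
  move=> xI Hf; exact: (kernel_norm_eval (H1_lin ab bp) (ipH1_sym _ _ _)
    (ipH1_lin ab bp) (ipH1_ge0 _ _ _) KP xI Hf).
split.
- by move=> f g fg; exact: H1_eq ab bp _ _ fg.
- exact: H1_cst ab bp 0.
- exact: H1_lin ab bp.
- by move=> f g _ _; exact: ipH1_sym.
- exact: ipH1_lin ab bp.
- by move=> f _; exact: ipH1_ge0.
- move=> f Hf f0 x xI; apply/normr0_eq0/le_anti; rewrite normr_ge0 andbT.
  by have := eval x f xI Hf; rewrite f0 sqrtr0 mulr0.
- move=> u; apply: (H1_complete ab bp); exists (Num.sqrt (K a a)) => f; apply: eval.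
  by rewrite in_itv/= lexx ltW.
- by move=> x xI; exists (Num.sqrt (K x x)) => f; exact: eval.
Qed.

(** Reproduce [phi m] at [x] in [H1], then convert to L2 with [poincare_ipH1]. *)
Lemma poincare_kernel_eigen m x : x \in `[a, b] ->
  \int[mu]_(y in `[a, b]) (K x y * phi m y) = alpha m * phi m x.
Proof.
move=> xI; have [HK rep] := KP xI; rewrite -/(ip (K x) (phi m)).
have l0 := lt0r_neq0 (poincare_eigenvalue_gt0 m).
apply: (mulfI l0); rewrite mulVKf// ip_sym -poincare_ipH1// rep//; exact: poincare_H1.
Qed.

Lemma poincare_kernel_mass x : x \in `[a, b] -> \int[mu]_(y in `[a, b]) K x y = 1.
Proof.
move=> xI; have := poincare_kernel_eigen 0 xI.
rewrite (pb_phi0 pb xI) (pb_lambda0 pb) addr0 invr1 mulr1 => <-.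
by apply: eq_Rintegral => y; rewrite inE/= => yI; rewrite (pb_phi0 pb yI) mulr1.
Qed.

Lemma mercer_uniform :
  {within `[a, b] `*` `[a, b], continuous (fun z : R * R => K z.1 z.2)} ->
  {uniform `[a, b] `*` `[a, b],
    (fun (n : nat) (z : R * R) => \sum_(m < n) alpha m * phi m z.1 * phi m z.2)
      @ \oo --> (fun z : R * R => K z.1 z.2)}.
Proof.
move=> cK; have a0 m : 0 < alpha m by rewrite invr_gt0 poincare_eigenvalue_gt0.
have cphi m : {within `[a, b], continuous (phi m)} := H1_continuous (poincare_H1 m).
apply: (@kernel_expansion_uniform _ `[a, b]%classic K phi alpha).
- exact: segment_compact.
- move=> n; apply: within_subr.
    apply: (within_comp (g := fun x : R => (x, x))) cK => [|x xI]; last by split.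
    apply: continuous_subspaceT => x.
    by apply: (@cvg_pair _ _ _ (nbhs x) (nbhs x) (nbhs x) _ _ _ id id); exact: cvg_id.
  rewrite /ksum; elim: n => [|n IH].
    apply: (@within_eqf R R _ (fun=> 0)); last exact: within_cst.
    by move=> x _; rewrite big_ord0.
  have cn : {within `[a, b], continuous (fun x : R => alpha n * phi n x * phi n x)}.
    by apply: within_mulr => //; apply: within_mulr => //; exact: within_cst.
  apply: (@within_eqf R R) (within_addr IH cn).
  by move=> x _; rewrite big_ord_recr.
- by move=> m n x mn; exact (krem_diag_nincr K phi a0 x mn).
- move=> x e xI e0.
  exact: (krem_diag_cvg0 (H1_lin ab bp) (H1_cst ab bp 0) (ipH1_sym _ _ _)
    (ipH1_lin ab bp) (ipH1_ge0 _ _ _) KP poincare_H1 a0 poincare_orth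
    (rkhs_complete sobolev_rkhs) poincare_total xI e0).
- move=> n x y e; exact: (krem_offdiag (H1_lin ab bp) (H1_cst ab bp 0) (ipH1_sym _ _ _)
    (ipH1_lin ab bp) (ipH1_ge0 _ _ _) KP poincare_H1 a0 poincare_orth).
Qed.

End poincare_kernel.

(** * The kernel formula for an arbitrary fundamental pair *)

Section fundamental_pair_formula.
Context {R : realType}.
Variables (a b : R) (mu : probability (measurableTypeR R) R) (rho : R -> R).
Hypothesis ab : a < b.
Hypothesis bp : bounded_perturbation a b mu rho.
Local Notation leb := (@lebesgue_measure R).
Local Notation H1 := (H1 a b mu).
Local Notation ipH1 := (ipH1 a b mu).

Lemma flux_mass psi P : flux_solution a b rho psi P ->
  \int[mu]_(x in `[a, b]) psi x = P b - P a.
Proof.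
move=> fp; have cpsi := primitive_continuous fp.1.
rewrite (Rintegral_mu bp); last exact: continuous_integrable.
rewrite -(primitive_Rintegral (ltW ab) fp.2); apply: eq_Rintegral => x _.
by rewrite mulrC.
Qed.

(** Pairing [K x] with [psi] gives [psi x] by reproduction and the boundary terms by [flux_ipH1]. *)
Lemma flux_kernel K psi P : reproducing_kernel `[a, b] H1 ipH1 K ->
  flux_solution a b rho psi P ->
  forall x, x \in `[a, b] -> psi x = K x b * P b - K x a * P a.
Proof.
move=> KP fp x xI; have [HK rep] := KP x xI; have Hp := flux_H1 ab bp fp.
by rewrite -(rep _ Hp) ipH1_sym (flux_ipH1 ab bp fp HK).
Qed.

Lemma fundamental_pair_formula K psi chi :
  reproducing_kernel `[a, b] H1 ipH1 K -> fundamental_pair a b mu rho psi chi ->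
  let C := chi b * \int[mu]_(x in `[a, b]) psi x in
  [/\ C = psi a * \int[mu]_(y in `[a, b]) chi y, C != 0 &
    forall x y, x \in `[a, b] -> y \in `[a, b] ->
      K x y = C^-1 * (psi (Num.min x y) * chi (Num.max x y))].
Proof.
move=> KP [hpsi hchi li vpsi vchi].
have aI : a \in `[a, b] by rewrite in_itv/= lexx ltW.
have bI : b \in `[a, b] by rewrite in_itv/= lexx andbT ltW.
have [P fpsi Pa] := homogeneous_flux ab bp aI hpsi vpsi.
have [Q fchi Qb] := homogeneous_flux ab bp bI hchi vchi.
have [psi0 [P0 [chi0 [Q0 [fpsi0 fchi0 P0a Q0b W]]]]] := fundamental_system ab bp.
have KE x y : x \in `[a, b] -> y \in `[a, b] -> K x y = green psi0 chi0 x y.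
  move=> xI yI; have GP := green_reproducing ab bp fpsi0 fchi0 P0a Q0b W.
  exact: (kernel_unique (ipH1_sym _ _ _) KP GP).
(* These are the factors in [flux_kernel], since [K x b = psi0 x * chi0 b] and
   [K x a = psi0 a * chi0 x]. *)
pose c := chi0 b * P b; pose d := - (psi0 a * Q a).
have cE x : x \in `[a, b] -> psi x = c * psi0 x.
  move=> xI; rewrite (flux_kernel KP fpsi xI) Pa mulr0 subr0 KE// /c.
  have /andP[_ xb] : a <= x <= b by rewrite -itv_in.
  by rewrite /green min_l// max_r//; ring.
have dE x : x \in `[a, b] -> chi x = d * chi0 x.
  move=> xI; rewrite (flux_kernel KP fchi xI) Qb mulr0 sub0r KE// /d.
  have /andP[ax _] : a <= x <= b by rewrite -itv_in.
  by rewrite /green min_r// max_l//; ring.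
(* A zero factor would make a member of the pair vanish identically, against independence. *)
have c0 : c != 0.
  apply/eqP => c0; have [|/eqP] := li 1 0; last by rewrite oner_eq0.
  by move=> x xI; rewrite cE// c0; ring.
have d0 : d != 0.
  apply/eqP => d0; have [|_ /eqP] := li 0 1; last by rewrite oner_eq0.
  by move=> x xI; rewrite dE// d0; ring.
(* The masses of [psi] and [chi] are [P b] and [- Q a], so both expressions for the normalization
   equal [c * d]. *)
rewrite (flux_mass fpsi) (flux_mass fchi) Pa Qb subr0 sub0r (dE b bI) (cE a aI) /=.
have -> : d * chi0 b * P b = c * d by rewrite /c; ring.
split; [by rewrite {1}/d; ring|by rewrite mulf_neq0|].
move=> x y xI yI; rewrite KE// /green cE ?dE; last 2 first.
- by case: leP.
- by case: leP.
by rewrite mulrACA mulKf// mulf_neq0.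
Qed.

End fundamental_pair_formula.
Theorem proposition4 (R : realType) (a b : R)
    (mu : probability (measurableTypeR R) R) (rho : R -> R)
    (lambda : nat -> R) (phi : nat -> R -> R)
    (hab : a < b)
    (hmu : bounded_perturbation a b mu rho)
    (hphi : poincare_basis a b mu lambda phi) :
  let alpha := fun m : nat => (1 + lambda m)^-1 in
  is_rkhs `[a, b] (H1 a b mu) (ipH1 a b mu) /\
  (exists K : R -> R -> R,
     reproducing_kernel `[a, b] (H1 a b mu) (ipH1 a b mu) K) /\
  (exists psi chi : R -> R, fundamental_pair a b mu rho psi chi) /\
  forall K : R -> R -> R,
    reproducing_kernel `[a, b] (H1 a b mu) (ipH1 a b mu) K ->
    [/\ {within `[a, b] `*` `[a, b], continuous (fun z : R * R => K z.1 z.2)},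
        forall x, x \in `[a, b] -> \int[mu]_(y in `[a, b]) K x y = 1,
        forall m x, x \in `[a, b] ->
          \int[mu]_(y in `[a, b]) (K x y * phi m y) = alpha m * phi m x,
        {uniform `[a, b] `*` `[a, b],
          (fun (n : nat) (z : R * R) =>
             \sum_(m < n) alpha m * phi m z.1 * phi m z.2) @ \oo -->
          (fun z : R * R => K z.1 z.2)} &
        forall psi chi : R -> R, fundamental_pair a b mu rho psi chi ->
          let C := chi b * \int[mu]_(x in `[a, b]) psi x in
          [/\ C = psi a * \int[mu]_(y in `[a, b]) chi y,
              C != 0 &
              forall x y, x \in `[a, b] -> y \in `[a, b] ->
                K x y = C^-1 * (psi (Num.min x y) * chi (Num.max x y))]].
Proof.
move=> alpha.
have [psi [P [chi [Q [fpsi fchi Pa Qb W]]]]] := fundamental_system hab hmu.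
have GP := green_reproducing hab hmu fpsi fchi Pa Qb W.
split; first exact (sobolev_rkhs hab hmu GP).
split; first by exists (green psi chi).
split.
  exists psi, chi; split.
  - exact (flux_homogeneous hab hmu fpsi).
  - exact (flux_homogeneous hab hmu fchi).
  - exact (flux_lin_indep hab hmu fpsi fchi Pa Qb W).
  - exact (flux_vanishes hab hmu fpsi Pa).
  - exact (flux_vanishes hab hmu fchi Qb).
move=> K KP.
(* On the square, every reproducing kernel agrees with the Green function and inherits its
   continuity. *)
have cK : {within `[a, b] `*` `[a, b], continuous (fun z : R * R => K z.1 z.2)}.
  apply: within_eqf (green_continuous fpsi fchi) => -[x y] [xI yI] /=.
  exact: (kernel_unique (ipH1_sym _ _ _) GP KP).
split => //.
- exact (poincare_kernel_mass hphi KP).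
- exact (poincare_kernel_eigen hphi KP).
- exact (mercer_uniform hab hmu hphi KP cK).
- move=> psi' chi' fp; exact (fundamental_pair_formula hab hmu KP fp).
Qed.
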